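(* Let $d\ge1$, $\gamma\in(0,1)$, $\beta\in(0,\infty)$, let $\varphi$ be a profile function, and let $(G_t)_{t>0}$ be the age-based spatial preferential attachment network. For any function $g:\mathbb{N}_0\to[0,\infty)$ growing no faster than exponentially, $$\frac1t\sum_{\mathbf{x}\in G_t}g\big(|\mathcal{Y}_{\mathbf{x}}(G_t)|\big)=\int g\,d\nu_t\longrightarrow\int g\,d\nu$$ in probability, as $t\to\infty$, where $\nu$ is the Poisson distribution with parameter $\beta/(1-\gamma)$.
   Context: A profile function is a nonincreasing integrable function $\varphi:[0,\infty)\to[0,1]$ with $\int_{\mathbb{R}^d}\varphi(|x|^d)\,dx=1$ ($|\cdot|$ Euclidean norm). Let $\mathbb{T}^d_1=(-\tfrac12,\tfrac12]^d$ with torus metric $d_1(x,y)=\min\{|x-y+v|: v\in\{-1,0,1\}^d\}$. The age-based spatial preferential attachment network $(G_t)_{t>0}$: vertices $(x,u)$ (position $x\in\mathbb{T}_1^d$, birth time $u>0$) arrive according to a standard (unit rate) Poisson process in time and are placed independently and uniformly on $\mathbb{T}^d_1$. The vertices of $G_t$ are those born in $(0,t]$. A vertex $(x,u)$, at its birth time $u$, is connected to each already existing vertex $(y,s)$, $s<u$, independently with probability $\varphi\big(\frac{u\,d_1(x,y)^d}{\beta\,(u/s)^\gamma}\big)$. For a vertex $\mathbf{x}=(x,u)$ of $G_t$, $\mathcal{Y}_{\mathbf{x}}(G_t)=\{\mathbf{y}=(y,s)\in G_t:\ \mathbf{x}\leftrightarrow\mathbf{y},\ s\le u\}$ is the set of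 its older neighbours ($\leftrightarrow$ means joined by an edge); its cardinality is the outdegree of $\mathbf{x}$. The empirical outdegree distribution is $\nu_t(k)=\frac1t\sum_{\mathbf{x}\in G_t}\mathbf{1}\{|\mathcal{Y}_{\mathbf{x}}(G_t)|=k\}$, $k\in\mathbb{N}_0$ (normalised by $t$, so its total mass tends to one but need not equal one). *)

(* Defs.v *)
From HB Require Import structures.
From mathcomp Require Import all_boot all_order all_algebra.
From mathcomp Require Import finmap.
From mathcomp Require Import all_classical all_reals all_analysis.
From mathcomp Require Import measurable_realfun.

Set Implicit Arguments.
Unset Strict Implicit.
Unset Printing Implicit Defensive.

Import Order.TTheory GRing.Theory Num.Theory.
Import numFieldNormedType.Exports.

Local Open Scope classical_set_scope.
Local Open Scope ring_scope.

Section lebesgue_tuple.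
Context {R : realType}.
Local Notation Rd d := (d.-tuple (measurableTypeR R)).

Definition cons_Rd d (p : measurableTypeR R * Rd d) : Rd d.+1 :=
  [tuple of p.1 :: p.2].

Lemma measurable_cons_Rd d : measurable_fun setT (@cons_Rd d).
Proof. exact: measurable_cons measurable_fst measurable_snd. Qed.

Section step.
Context d (m : {sigma_finite_measure set (Rd d) -> \bar R}).

Definition lebesgue_cons : set (Rd d.+1) -> \bar R :=
  pushforward ((@lebesgue_measure R) \x m)%E (@cons_Rd d).

Let lebesgue_cons0 : lebesgue_cons set0 = 0%E.
Proof. by rewrite /lebesgue_cons /pushforward preimage_set0 measure0. Qed.

Let lebesgue_cons_ge0 A : (0 <= lebesgue_cons A)%E.
Proof. by rewrite /lebesgue_cons /pushforward measure_ge0. Qed.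

Let lebesgue_cons_sigma_additive : semi_sigma_additive lebesgue_cons.
Proof.
have mcons A : measurable A -> measurable (@cons_Rd d @^-1` A).
  by move=> mA; rewrite -[X in measurable X]setTI; exact: measurable_cons_Rd.
move=> F mF tF mUF; rewrite /lebesgue_cons /pushforward preimage_bigcup.
apply: measure_semi_sigma_additive => [n||]; first exact: mcons.
- apply/trivIsetP => /= i j _ _ ij; rewrite -preimage_setI.
  by move/trivIsetP : tF => /(_ _ _ _ _ ij) ->//; rewrite preimage_set0.
- by rewrite -preimage_bigcup; exact: mcons.
Qed.

HB.instance Definition _ := isMeasure.Build _ _ _ lebesgue_cons
  lebesgue_cons0 lebesgue_cons_ge0 lebesgue_cons_sigma_additive.

Lemma lebesgue_cons_sigma_finite : sigma_finite setT lebesgue_cons.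
Proof.
have /sigma_finiteP[F [TF ndF Foo]] := sigma_finiteT (@lebesgue_measure R).
have /sigma_finiteP[G [TG ndG Goo]] := sigma_finiteT m.
pose H n := [set t : Rd d.+1 |
  F n (thead t) /\ G n ([tuple of behead t] : Rd d)].
exists H.
  rewrite predeqE => t; split => // _.
  have [i _ Fi] : (\bigcup_i F i) (thead t) by rewrite -TF.
  have [j _ Gj] : (\bigcup_i G i) ([tuple of behead t] : Rd d) by rewrite -TG.
  exists (maxn i j) => //; split.
    by move: Fi; exact/subsetPset/ndF/leq_maxl.
  by move: Gj; exact/subsetPset/ndG/leq_maxr.
move=> n; have [mF Fn] := Foo n; have [mG Gn] := Goo n; split.
  apply: measurableI.
    rewrite -[X in measurable X]setTI.
    exact: (measurable_tnth ord0).
  rewrite -[X in measurable X]setTI.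
  exact: measurable_behead.
rewrite /lebesgue_cons /pushforward (_ : _ @^-1` _ = F n `*` G n).
  by rewrite product_measure1E// lte_mul_pinfty// ge0_fin_numE.
have consK (p : measurableTypeR R * Rd d) :
    ([tuple of behead (cons_Rd p)] : Rd d) = p.2 by exact: val_inj.
by apply/seteqP; split => p; rewrite /H /= consK theadE.
Qed.

HB.instance Definition _ := Measure_isSigmaFinite.Build _ _ _ lebesgue_cons
  lebesgue_cons_sigma_finite.

End step.

(* Lebesgue measure on R^d: the d-fold product of the measure on R, carried to
   d-tuples by (x, t) |-> x :: t. *)
Fixpoint lebesgue_tuple d : {sigma_finite_measure set (Rd d) -> \bar R} :=
  if d is d'.+1 then lebesgue_cons (lebesgue_tuple d')
  else dirac ([tuple] : Rd 0).

End lebesgue_tuple.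

Notation Rd R d := (d.-tuple (measurableTypeR R)).

Section torus.
Context {R : realType} {d : nat}.
Implicit Types x y : Rd R d.

Definition enorm x : R := Num.sqrt (\sum_(i < d) tnth x i ^+ 2).

Definition torus : set (Rd R d) :=
  [set x | forall i, - 2^-1 < (tnth x i : R) <= 2^-1].

(* The shift vectors v - (1, ..., 1), with v ranging over {0, 1, 2}^d, are the
   elements of {-1, 0, 1}^d; the default value of the minimum is the term of
   the zero shift. *)
Definition torus_dist x y : R :=
  \big[Num.min/enorm [tuple tnth x i - tnth y i | i < d]]_
    (v : {ffun 'I_d -> 'I_3})
    enorm [tuple tnth x i - tnth y i + ((v i : nat)%:R - 1) | i < d].

End torus.

Record profile {R : realType} (d : nat) (phi : R -> R) : Prop := Profile {
  profile_ge0 : forall x, 0 <= x -> 0 <= phi x ;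
  profile_le1 : forall x, 0 <= x -> phi x <= 1 ;
  profile_nonincreasing : forall x y, 0 <= x -> x <= y -> phi y <= phi x ;
  profile_integrable :
    (@lebesgue_measure R).-integrable `[0, +oo[ (EFin \o phi) ;
  profile_normalized :
    (\int[@lebesgue_tuple R d]_x (phi (enorm x ^+ d))%:E = 1)%E }.

Section independence.
Context {disp} {T : measurableType disp} {R : realType} (P : probability T R).

Definition events_of {disp'} {T' : measurableType disp'} (X : T -> T') :
  set_system T := preimage_set_system setT X measurable.

Definition mutually_independent (I : choiceType) (F : I -> set_system T) :=
  forall (s : seq I) (A : I -> set T), uniq s ->
    {in s, forall i, F i (A i)} ->
    (P (\bigcap_(i in [set` s]) A i) = \prod_(i <- s) P (A i))%E.

Definition cvg_in_probability (X : R -> T -> \bar R) (l : \bar R) :=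
  (forall t, measurable_fun setT (X t)) /\
  forall e : R, 0 < e ->
    P [set w | (e%:E < `|X t w - l|)%E] @[t --> +oo] --> (0 : \bar R).

End independence.

(* The vertices are numbered 0, 1, 2, ... in their order of arrival; gap n is
   the waiting time between the arrivals of vertices n - 1 and n, pos n is the
   position of vertex n, and adj w is the edge relation of the union over t of
   the graphs G_t in the outcome w: G_t is the subgraph induced by
   vertices t w. *)
Section network.
Context {R : realType} {d : nat} {disp} {T : measurableType disp}
  {P : probability T R}.
Variables (gamma beta : R) (phi : R -> R).
Variables (gap : nat -> {RV P >-> measurableTypeR R})
  (pos : nat -> {RV P >-> Rd R d}) (adj : T -> rel nat).

Definition birth (n : nat) (w : T) : R := \sum_(i < n.+1) gap i w.

Definition vertices (t : R) (w : T) : set nat := [set n | birth n w <= t].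

(* probability that vertex n is connected at its birth to the older vertex m *)
Definition edge_prob (m n : nat) (w : T) : R :=
  phi (birth n w * torus_dist (pos n w) (pos m w) ^+ d /
       (beta * (birth n w / birth m w) `^ gamma)).

Definition mark_events (i : nat + nat) : set_system T :=
  match i with
  | inl n => events_of (gap n)
  | inr n => events_of (pos n)
  end.

Definition vertex_events : set_system T := <<s \bigcup_i mark_events i >>.

(* The arrival times of a standard Poisson process are the partial sums of
   i.i.d. exponential variables of parameter 1.  network_edges says that, given
   the birth times and positions of all the vertices, the edges are present
   independently of each other, with probabilities edge_prob. *)
Record age_based_network : Prop := AgeBasedNetwork {
  network_gap_gt0 : forall n w, 0 < gap n w ;
  network_gap : forall n B, measurable B ->
    P (gap n @^-1` B) = exponential_prob 1 B ;
  network_pos_torus : forall n w, torus (pos n w) ;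
  network_pos : forall n B, measurable B ->
    P (pos n @^-1` B) = lebesgue_tuple d (B `&` torus) ;
  network_marks : mutually_independent P mark_events ;
  network_adj_irr : forall w, irreflexive (adj w) ;
  network_adj_sym : forall w, symmetric (adj w) ;
  network_adj_measurable : forall m n, measurable [set w | adj w m n] ;
  network_edges : forall (s : seq (nat * nat)) (A : set T),
    uniq s -> {in s, forall e, (e.1 < e.2)%N} -> vertex_events A ->
    P (A `&` [set w | all (fun e => adj w e.1 e.2) s]) =
    (\int[P]_(w in A) (\prod_(e <- s) edge_prob e.1 e.2 w)%:E)%E }.

Definition older_neighbours (t : R) (n : nat) (w : T) : set nat :=
  [set m | vertices t w m /\ adj w n m /\ birth m w <= birth n w].

Definition outdegree (t : R) (n : nat) (w : T) : nat :=
  #|` fset_set (older_neighbours t n w)|.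

Definition vertex_average (g : nat -> R) (t : R) (w : T) : \bar R :=
  ((t^-1)%:E * \esum_(n in vertices t w) (g (outdegree t n w))%:E)%E.

(* For t > 0, the measure on nat giving mass
   t^-1 * #|{n in vertices t w | outdegree t n w = k}| to {k}; the absolute
   value only serves to make it a measure for all t. *)
Definition empirical_outdegree (t : R) (w : T) : {measure set nat -> \bar R} :=
  mscale (`|t^-1|%:nng) (mseries (fun n =>
    if birth n w <= t then \d_(outdegree t n w) : {measure set nat -> \bar R}
    else mzero) 0).

End network.

(* Main.v *)
(** Number the vertices by order of arrival, so that the outdegree of vertex n
    counts the edges to the vertices m < n.  On the torus, averaging the
    probability of an edge over the position of one endpoint gives a function
    p_mn of the birth times only.  Averaging out one position at a time, the
    conditional mean of z ^ outdegree given the birth times is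
    prod_(m < n) (1 - (1 - z) p_mn).  By the law of large numbers the n-th birth
    time is asymptotically n, whence sum_(m < n) p_mn tends to
    lam = beta / (1 - gamma) and max_m p_mn to 0, and this product tends to
    exp (- (1 - z) lam), the generating function of the Poisson law.  The edges
    of two vertices n < n' are correlated only through the positions of the
    m < n, which costs at most sum_m p_mn p_mn', so Chebyshev's inequality gives
    convergence in probability of the averages of z ^ outdegree for 0 <= z <= 1.
    Uniform exponential moments, on an event where the birth times grow at least
    linearly, extend this first to indicators of a single outdegree and then to
    all exponentially bounded g.  Finally the number of vertices at time t lies
    between (1 - dl) t and (1 + dl) t with high probability, and g >= 0. *)

Require Import Defs.
From HB Require Import structures.
From mathcomp Require Import all_boot all_order all_algebra.
From mathcomp Require Import finmap.
From mathcomp Require Import all_classical all_reals all_analysis.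
From mathcomp Require Import measurable_realfun.
From mathcomp Require Import ring lra zify.

Set Implicit Arguments.
Unset Strict Implicit.
Unset Printing Implicit Defensive.

Import Order.TTheory GRing.Theory Num.Theory.
Import numFieldNormedType.Exports.

Local Open Scope classical_set_scope.
Local Open Scope ring_scope.

(** * Integration on the torus *)

(** No conditional expectation is formed. The mean over one position given everything else is
    Tonelli's theorem on the product of the sigma-algebra of all other marks with the law of that
    position; conditioning on the birth times is replaced by carrying the indicator of an event that
    does not depend on positions. The mean p_mn is not explicit. What controls it is that, with c
    the coefficient of the d-th power of the distance, c times the mean is the integral of the
    profile over a cube of side c^(1/d), hence at most 1 and tending to 1 as c grows. So p_mn is
    close to beta t_n^(gamma-1) t_m^(-gamma), and the sum of m^(-gamma) up to n, about
    n^(1-gamma)/(1-gamma), is the origin of the Poisson parameter. All edges from n to older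
    vertices share the position of n, but that of an older m enters one factor only and can be
    averaged with n held fixed. For n < n' the position of m < n sits in two factors, and only the
    product of these two edge probabilities fails to average exactly. *)

Section affine_change_of_variable.
Variables (R : realType) (a b : R).
Hypothesis a0 : 0 < a.

Let h (x : measurableTypeR R) : measurableTypeR R := a * x + b.

Let mh : measurable_fun setT h.
Proof. by apply: measurable_funD => //; exact: measurable_funM. Qed.

Let mu : {measure set (measurableTypeR R) -> \bar R}.
Proof.
refine (mscale (NngNum (ltW a0)) (pushforward lebesgue_measure h)).
exact: mh.
Defined.

(** [mu] gives a half-open interval [a] times the length of its preimage, which is its own length;
    agreement on these intervals determines the measure. *)
Let lebesgue_measure_affine (A : set R) :
  measurable A -> lebesgue_measure A = mu A.
Proof.
move=> mA.
apply: (@lebesgue_measure_unique R mu) => // _ [[c d]] _ <-.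
rewrite (_ : mu _ = (a%:E * lebesgue_measure (h @^-1` `]c, d]))%E)//.
have -> : h @^-1` `]c, d] = `](c - b) / a, (d - b) / a]%classic.
  apply/seteqP; split => x /=; rewrite /h !in_itv /= => /andP[h1 h2].
    by rewrite ltr_pdivrMr// ler_pdivlMr// ltrBlDr lerBrDr [x * a]mulrC h1 h2.
  move: h1 h2; rewrite ltr_pdivrMr// ler_pdivlMr// ltrBlDr lerBrDr.
  by rewrite [x * a]mulrC => -> ->.
rewrite !lebesgue_measure_itv /= !lte_fin ltr_pM2r ?invr_gt0// ltrD2r.
case: ifPn => _; last by rewrite mule0.
rewrite -!EFinB -EFinM; congr (_%:E).
by field; exact: lt0r_neq0.
Qed.

Lemma ge0_integral_affine (f : R -> \bar R) :
  measurable_fun setT f -> (forall x, 0 <= f x)%E ->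
  (\int[lebesgue_measure]_x f (a * x + b)%R =
   (a^-1)%:E * \int[lebesgue_measure]_x f x)%E.
Proof.
move=> mf f0.
have -> : (\int[lebesgue_measure]_x f x = \int[mu]_x f x)%E.
  by apply: eq_measure_integral => A mA _; exact: lebesgue_measure_affine.
rewrite ge0_integral_mscale//= ge0_integral_pushforward//=.
by rewrite muleA -EFinM mulVf ?gt_eqF// mul1e.
Qed.

End affine_change_of_variable.

Section lebesgue_tuple_integrals.
Variable R : realType.
Implicit Types d : nat.
Local Notation leb := (@lebesgue_measure R).

Lemma measurable_fun_tupleP disp (T1 : measurableType disp) d (f : T1 -> Rd R d) :
  (forall i, measurable_fun setT (fun x => tnth (f x) i)) ->
  measurable_fun setT f.
Proof. by move=> mf; apply/measurable_fun_tnthP. Qed.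

Lemma ge0_integral_lebesgue_tupleS d (f : Rd R d.+1 -> \bar R) :
  measurable_fun setT f -> (forall x, 0 <= f x)%E ->
  (\int[lebesgue_tuple d.+1]_x f x =
   \int[leb]_x \int[lebesgue_tuple d]_t f (cons_Rd (x, t)))%E.
Proof.
move=> mf f0.
rewrite [LHS](_ : _ = \int[pushforward (leb \x lebesgue_tuple d)%E
  (@cons_Rd R d)]_x f x)%E//.
rewrite ge0_integral_pushforward//; last exact: measurable_cons_Rd.
rewrite preimage_setT fubini_tonelli1//; last first.
  by move=> p; exact: (f0 (cons_Rd p)).
by apply: measurableT_comp => //; exact: measurable_cons_Rd.
Qed.

Definition scale_Rd d (a : R) (x : Rd R d) : Rd R d := [tuple a * tnth x i | i < d].

Lemma scale_Rd_cons d a (x : R) (t : Rd R d) :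
  scale_Rd a (cons_Rd (x, t)) = cons_Rd (a * x, scale_Rd a t).
Proof.
apply: eq_from_tnth => i; rewrite tnth_mktuple.
case: (unliftP ord0 i) => [j|] ->; last by rewrite !tnth0.
by rewrite !tnthS tnth_mktuple.
Qed.

Lemma measurable_scale_Rd d a : measurable_fun setT (@scale_Rd d a).
Proof.
apply: measurable_fun_tupleP => i.
rewrite (_ : (fun _ => _) = (fun x : Rd R d => a * tnth x i)); last first.
  by apply/funext => x; rewrite tnth_mktuple.
by apply: measurable_funM => //; exact: measurable_tnth.
Qed.

Lemma ge0_integral_scale_Rd d (a : R) (f : Rd R d -> \bar R) : 0 < a ->
  measurable_fun setT f -> (forall x, 0 <= f x)%E ->
  (\int[lebesgue_tuple d]_x f (scale_Rd a x) =
   ((a^-1) ^+ d)%:E * \int[lebesgue_tuple d]_x f x)%E.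
Proof.
move=> a0; elim: d f => [|d IH] f mf f0.
  rewrite expr0 mul1e; apply: eq_integral => x _; congr f.
  by apply: eq_from_tnth => -[].
have msf : measurable_fun setT (f \o @scale_Rd _ a).
  by apply: measurableT_comp => //; exact: measurable_scale_Rd.
rewrite (ge0_integral_lebesgue_tupleS msf) => [|x]; last exact: f0.
rewrite ge0_integral_lebesgue_tupleS//.
have mfc x : measurable_fun setT (fun t => f (cons_Rd (x, t))).
  apply: measurableT_comp => //.
  by apply: measurableT_comp => //; exact: measurable_cons_Rd.
under eq_integral.
  move=> x _.
  under eq_integral do rewrite /= scale_Rd_cons.
  rewrite (IH (fun t => f (cons_Rd (a * x, t))))//.
  over.
have mF : measurable_fun setT
    (fun x => \int[lebesgue_tuple d]_t f (cons_Rd (x, t)))%E.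
  apply: (@measurable_fun_fubini_tonelli_F _ _ _ _ _ (lebesgue_tuple d)
     (fun p => f (cons_Rd p))) => [|//].
  by apply: measurableT_comp => //; exact: measurable_cons_Rd.
set h := (fun x => \int[lebesgue_tuple d]_t f (cons_Rd (x, t)))%E in mF *.
have h0 x : (0 <= h x)%E by apply: integral_ge0.
have aff := @ge0_integral_affine R a 0 a0 h mF h0.
have ma : measurable_fun setT (fun x => h (a * x)).
  by apply: (@measurableT_comp _ _ _ _ _ _ h) => //; exact: measurable_funM.
rewrite [LHS](_ : _ = \int[leb]_x ((a^-1 ^+ d)%:E * h (a * x)%R))%E//.
rewrite (@ge0_integralZl _ _ _ leb _ measurableT (fun x => h (a * x)) ma); last 2 first.
- by move=> x _; exact: h0.
- by rewrite lee_fin exprn_ge0// invr_ge0 ltW.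
rewrite [X in (_ * X)%E](_ : _ = \int[leb]_x h (a * x + 0)%R)%E; last first.
  by apply: eq_integral => x _; rewrite addr0.
rewrite aff muleA -EFinM exprSr//.
Qed.

Definition halfcube : set R := `]- 2^-1, 2^-1]%classic.

Lemma torus_cons d (p : R * Rd R d) :
  torus (cons_Rd p) <-> halfcube p.1 /\ torus p.2.
Proof.
split=> [H|[H1 H2] i].
  split; first by have := H ord0; rewrite tnth0 /halfcube /= in_itv.
  by move=> i; have := H (lift ord0 i); rewrite tnthS.
case: (unliftP ord0 i) => [j|] ->; first by rewrite tnthS; exact: H2.
by rewrite tnth0; move: H1; rewrite /halfcube /= in_itv.
Qed.

Lemma measurable_torus d : measurable (@torus R d).
Proof.
rewrite (_ : torus = \bigcap_(i in [set: 'I_d])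
    ((@tnth d _)^~ i @^-1` halfcube)).
  apply: fin_bigcap_measurable => // i _.
  rewrite -[X in measurable X]setTI; by apply: measurable_tnth => //; exact: measurable_itv.
apply/seteqP; split => x /= H i => [_|].
  by have := H i; rewrite /halfcube /= in_itv.
by have := H i I; rewrite /halfcube /= in_itv.
Qed.

Lemma ge0_integral_torusS d (f : Rd R d.+1 -> \bar R) :
  measurable_fun setT f -> (forall x, 0 <= f x)%E ->
  (\int[lebesgue_tuple d.+1]_(x in torus) f x =
   \int[leb]_(x in halfcube)
     \int[lebesgue_tuple d]_(t in torus) f (cons_Rd (x, t)))%E.
Proof.
move=> mf f0.
rewrite integral_mkcond ge0_integral_lebesgue_tupleS; last 2 first.
- by apply/(measurable_restrictT _ (@measurable_torus _)); exact: measurable_funS mf.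
- by move=> x; apply: erestrict_ge0.
rewrite [RHS]integral_mkcond; apply: eq_integral => x _.
rewrite patchE; case: ifPn => [/set_mem xI|/negP xI].
  rewrite [RHS]integral_mkcond; apply: eq_integral => t _.
  rewrite !patchE; congr (if _ then _ else _).
  apply/idP/idP => [/set_mem/torus_cons[_ ?]|/set_mem ?]; apply/mem_set => //.
  exact/torus_cons.
rewrite integral0_eq// => t _; rewrite patchE; case: ifPn => // /set_mem.
by move=> /torus_cons[h _]; case: xI; apply/mem_set.
Qed.

Lemma ge0_integral_translate (a b c : R) (f : R -> \bar R) :
  measurable_fun setT f -> (forall x, 0 <= f x)%E ->
  (\int[leb]_(x in `](a + c)%R, (b + c)%R]) f x =
   \int[leb]_(x in `]a, b]) f (x + c)%R)%E.
Proof.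
move=> mf f0; rewrite [LHS]integral_mkcond [RHS]integral_mkcond.
set I := `](a + c)%R, (b + c)%R]%classic.
have mI : measurable I by exact: measurable_itv.
have := @ge0_integral_affine R 1 c ltr01 (f \_ I).
rewrite invr1 mul1e => <-; last 2 first.
- by apply/(measurable_restrictT _ mI); exact: measurable_funS mf.
- by move=> x; apply: erestrict_ge0.
apply: eq_integral => x _; rewrite mul1r !patchE; congr (if _ then _ else _).
by rewrite /I; apply/idP/idP => /set_mem /=; rewrite in_itv/= => h; apply/mem_set;
  rewrite /= in_itv/=; lra.
Qed.

(** The translated window overhangs the unit interval on one side by |x|, and moving the overhang by
    1 fills the gap on the other side. Periodicity is asked on [0, 1] only, because [circ_norm], a
    minimum over three shifts, is not periodic on the whole line. *)
Lemma ge0_integral_halfcube_translate (x : R) (f : R -> \bar R) :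
  measurable_fun setT f -> (forall x, 0 <= f x)%E ->
  (forall s, 0 <= s <= 1 -> f (s - 1) = f s) -> halfcube x ->
  (\int[leb]_(y in halfcube) f (y - x)%R = \int[leb]_(y in halfcube) f y)%E.
Proof.
move=> mf f0 fper; rewrite /halfcube/= in_itv/= => xI.
rewrite -ge0_integral_translate//.
have split3 (a b c : R) : a <= b -> b <= c ->
    (\int[leb]_(y in `]a, c]) f y =
     \int[leb]_(y in `]a, b]) f y + \int[leb]_(y in `]b, c]) f y)%E.
  move=> ab bc; rewrite (@itv_bndbnd_setU _ _ _ (BRight b)) ?bnd_simp//.
  rewrite ge0_integral_setU//=.
  - exact: measurable_funS mf.
  - apply/disj_setPS => z [] /=; rewrite !in_itv/= => h1 h2; lra.
case: (leP 0 x) => x0.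
  rewrite (split3 _ (- 2^-1)); [|lra..].
  rewrite [RHS](split3 _ (2^-1 - x)); [|lra..].
  rewrite addeC; congr adde.
  rewrite (_ : `]- 2^-1 - x, - 2^-1]%classic =
    `]2^-1 - x + (- 1), 2^-1 + (- 1)]%classic); last first.
    by apply/seteqP; split => z /=; rewrite !in_itv/= => h; lra.
  rewrite ge0_integral_translate//; apply: eq_integral => s /set_mem/=.
  by rewrite in_itv/= => h; apply: fper; lra.
rewrite (split3 _ (2^-1)); [|lra..].
rewrite [RHS](split3 _ (- 2^-1 - x)); [|lra..].
rewrite addeC; congr adde.
rewrite (_ : `]2^-1, 2^-1 - x]%classic =
  `]- 2^-1 + 1, - 2^-1 - x + 1]%classic); last first.
  by apply/seteqP; split => z /=; rewrite !in_itv/= => h; lra.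
rewrite ge0_integral_translate//; apply: eq_integral => s /set_mem/=.
by rewrite in_itv/= => h; rewrite -[in RHS](addrK 1 s); apply/esym/fper; lra.
Qed.

(* For |s| <= 1, the distance from s to the nearest integer: the minimum in
   torus_dist is attained coordinatewise. *)
Definition circ_norm (s : R) : R := Num.min (Num.min `|s - 1| `|s|) `|s + 1|.

Lemma circ_norm_le s : [/\ circ_norm s <= `|s - 1|, circ_norm s <= `|s| &
  circ_norm s <= `|s + 1|].
Proof. by rewrite /circ_norm !ge_min !lexx ?orbT. Qed.

Lemma circ_norm_cases s :
  [\/ circ_norm s = `|s - 1|, circ_norm s = `|s| | circ_norm s = `|s + 1|].
Proof.
rewrite /circ_norm minEle; case: ifP => _; last by constructor 3.
by rewrite minEle; case: ifP => _; [constructor 1|constructor 2].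
Qed.

Lemma circ_norm_ge0 s : 0 <= circ_norm s.
Proof. by rewrite /circ_norm !le_min !normr_ge0. Qed.

Lemma circ_normN s : circ_norm (- s) = circ_norm s.
Proof.
rewrite /circ_norm (_ : - s - 1 = - (s + 1)); last by rewrite opprD.
rewrite (_ : - s + 1 = - (s - 1)); last by rewrite opprB addrC.
by rewrite !normrN minC minA minC minA [Num.min _ `|s - 1|]minC.
Qed.

Lemma circ_norm_periodic s : 0 <= s <= 1 -> circ_norm (s - 1) = circ_norm s.
Proof.
move=> /andP[s0 s1].
have n1 : `|s - 1| = 1 - s by rewrite ler0_norm//; lra.
have n2 : `|s| = s by rewrite ger0_norm.
have n3 : `|s + 1| = s + 1 by rewrite ger0_norm//; lra.
have n4 : `|s - 1 - 1| = 2 - s by rewrite ler0_norm//; lra.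
rewrite /circ_norm subrK n1 n2 n3 n4 (min_r (_ : 1 - s <= 2 - s)); last lra.
by rewrite [RHS]min_l// ge_min; apply/orP; right; lra.
Qed.

Lemma circ_norm_halfcube s : halfcube s -> circ_norm s = `|s|.
Proof.
rewrite /halfcube/= in_itv/= => /andP[s0 s1].
have n : `|s| <= 2^-1 by rewrite ler_norml; lra.
have n1 : 2^-1 <= `|s - 1| by rewrite ler0_norm//; lra.
have n2 : 2^-1 <= `|s + 1| by rewrite ger0_norm//; lra.
by rewrite /circ_norm min_l ?min_r//; lra.
Qed.

Lemma measurable_circ_norm : measurable_fun setT circ_norm.
Proof.
have ms c : measurable_fun setT (fun s : R => `|s + c|).
  by apply: measurableT_comp => //; exact: measurable_funD.
apply: measurable_minr; last exact: ms.
apply: measurable_minr; first exact: ms.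
by have := ms 0; under eq_fun do rewrite addr0.
Qed.

Definition circ_sqnorm d (x y : Rd R d) : R :=
  \sum_(i < d) circ_norm (tnth x i - tnth y i) ^+ 2.

Lemma measurable_circ_sqnorm d disp (T : measurableType disp)
    (f g : T -> Rd R d) : measurable_fun setT f -> measurable_fun setT g ->
  measurable_fun setT (fun t => circ_sqnorm (f t) (g t)).
Proof.
move=> mf mg; apply: measurable_sum => i; apply: measurable_funX.
apply: (measurableT_comp measurable_circ_norm).
by apply: measurable_funB; apply: (measurableT_comp (measurable_tnth i)).
Qed.

Lemma torus_dist_circ d (x y : Rd R d) :
  torus_dist x y = Num.sqrt (circ_sqnorm x y).
Proof.
apply/eqP; rewrite eq_le; apply/andP; split; last first.
  apply/bigmin_geP; split=> [|v _]; rewrite /enorm ler_wsqrtr//;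
    apply: ler_sum => i _; rewrite tnth_mktuple -[leRHS]real_normK ?num_real//;
    apply: lerXn2r; rewrite ?nnegrE ?circ_norm_ge0//;
    have [h1 h2 h3] := circ_norm_le (tnth x i - tnth y i) => //.
  case: (v i) => -[|[|[|//]]] _ /=; first by rewrite sub0r.
    by rewrite subrr addr0.
  by rewrite (_ : 2%:R - 1 = 1 :> R) //; ring.
(* In each coordinate the shift attaining [circ_norm] is selected; the values 0, 1, 2 stand for the
   shifts -1, 0, 1. *)
pose v : {ffun 'I_d -> 'I_3} := [ffun i =>
  let s := tnth x i - tnth y i in
  if circ_norm s == `|s - 1| then ord0
  else if circ_norm s == `|s| then inord 1 else inord 2].
apply: (le_trans (bigmin_le _ v _)).
rewrite /enorm ler_wsqrtr// /circ_sqnorm; apply: ler_sum => i _.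
rewrite tnth_mktuple ffunE /=; set s := _ - _.
rewrite -[leLHS]real_normK ?num_real//.
case: ifPn => [/eqP ->|h1]; first by rewrite /= sub0r.
case: ifPn => [/eqP ->|h2]; first by rewrite inordK// subrr addr0.
case: (circ_norm_cases s) => [h|h|->]; rewrite ?h ?eqxx// in h1 h2.
by rewrite inordK// (_ : 2%:R - 1 = 1 :> R)//; ring.
Qed.

(** Translation invariance, one coordinate at a time. The function [f] is arbitrary so that the
    induction hypothesis applies to [f] shifted by the contribution of the first coordinate. *)
Lemma ge0_integral_circ d (x : Rd R d) (f : R -> \bar R) :
  measurable_fun setT f -> (forall x, 0 <= f x)%E -> torus x ->
  (\int[lebesgue_tuple d]_(y in torus) f (circ_sqnorm x y) =
   \int[lebesgue_tuple d]_(y in torus) f (\sum_(i < d) tnth y i ^+ 2)%R)%E.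
Proof.
elim: d x f => [|d IH] x f mf f0 tx.
  by apply: eq_integral => y _; rewrite /circ_sqnorm !big_ord0.
pose x' : Rd R d := [tuple of behead x].
have xE : x = cons_Rd (tnth x ord0, x').
  by rewrite [LHS]tuple_eta; apply: val_inj.
have [tx0 tx'] : halfcube (tnth x ord0) /\ torus x'.
  by apply/(@torus_cons _ (tnth x ord0, x')); rewrite -xE.
have cE a t : circ_sqnorm x (cons_Rd (a, t)) =
    circ_norm (tnth x ord0 - a) ^+ 2 + circ_sqnorm x' t.
  rewrite [X in circ_sqnorm X]xE /circ_sqnorm big_ord_recl !tnth0.
  by congr (_ + _); apply: eq_bigr => i _; rewrite !tnthS.
have sE a (t : Rd R d) : \sum_(i < d.+1) tnth (cons_Rd (a, t)) i ^+ 2 =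
    a ^+ 2 + \sum_(i < d) tnth t i ^+ 2.
  by rewrite big_ord_recl !tnth0; congr (_ + _); apply: eq_bigr => i _; rewrite !tnthS.
have msum n : measurable_fun setT
    (fun y : Rd R n => (\sum_(i < n) tnth y i ^+ 2)%R : R).
  by apply: measurable_sum => i; apply: measurable_funX; exact: measurable_tnth.
have mfx : measurable_fun setT (fun y => f (circ_sqnorm x y)).
  by apply: (measurableT_comp mf); apply: measurable_circ_sqnorm.
rewrite (ge0_integral_torusS mfx) => [|y]; last exact: f0.
rewrite (ge0_integral_torusS (measurableT_comp mf (msum _))) => [|y]; last exact: f0.
(* [g r] integrates out the other coordinates when the first contributes [r]; what remains is a
   translation in dimension one. *)
pose g r := (\int[lebesgue_tuple d]_(t in torus) f (r + \sum_(i < d) tnth t i ^+ 2)%R)%E.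
have madd (r : R) : measurable_fun setT (fun s : R => f (r + s)).
  by apply: (@measurableT_comp _ _ _ _ _ _ f) => //; exact: measurable_funD.
have mg : measurable_fun setT g.
  rewrite /g; under eq_fun do rewrite integral_mkcond.
  apply: (@measurable_fun_fubini_tonelli_F _ _ _ _ _ (lebesgue_tuple d)
    (fun p : R * Rd R d =>
       ((fun t => f (p.1 + \sum_(i < d) tnth t i ^+ 2)%R) \_ torus) p.2)); last first.
    by move=> p; apply: erestrict_ge0 => t _; exact: f0.
  rewrite (_ : (fun _ => _) = (fun p : R * Rd R d =>
       f (p.1 + \sum_(i < d) tnth p.2 i ^+ 2)%R) \_ (setT `*` torus)); last first.
    apply/funext => p; rewrite !patchE; congr (if _ then _ else _).
    by apply/idP/idP => /set_mem h; apply/mem_set => //; case: h.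
  have mT : measurable ([set: measurableTypeR R] `*` @torus R d).
    by apply: measurableX => //; exact: measurable_torus.
  apply/(measurable_restrictT _ mT).
  apply: (@measurable_funS _ _ _ _ setT) => //.
  apply: (@measurableT_comp _ _ _ _ _ _ f) => //; apply: measurable_funD => //.
  exact: (measurableT_comp (msum d)).
have g0 r : (0 <= g r)%E by apply: integral_ge0 => *; exact: f0.
transitivity (\int[leb]_(a in halfcube) g (circ_norm (a - tnth x ord0) ^+ 2)%R)%E.
  apply: eq_integral => a _; under eq_integral do rewrite cE.
  rewrite (IH x' (fun s => f (_ + s)))//.
  by rewrite -circ_normN opprB.
have mgc : measurable_fun setT (fun s => g (circ_norm s ^+ 2)).
  by apply: (measurableT_comp mg); apply: measurable_funX; exact: measurable_circ_norm.
rewrite (ge0_integral_halfcube_translate mgc); [|by move=> s; exact: g0| |exact: tx0].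
  apply: eq_integral => a /set_mem aI.
  rewrite circ_norm_halfcube// real_normK ?num_real//.
  by apply: eq_integral => t _; rewrite /= sE.
by move=> s s01; rewrite circ_norm_periodic.
Qed.

End lebesgue_tuple_integrals.

(** * Mean of the profile over the torus *)

Section mean_edge_probability.
Variables (R : realType) (d : nat).
Local Notation mu := (@lebesgue_tuple R d).

Lemma measurable_enorm : measurable_fun setT (@enorm R d).
Proof.
rewrite /enorm; apply: (@measurableT_comp _ _ _ _ _ _ (@Num.sqrt R)).
  by apply: continuous_measurable_fun; exact: sqrt_continuous.
by apply: measurable_sum => i; apply: measurable_funX; exact: measurable_tnth.
Qed.

Lemma enorm_ge0 (x : Rd R d) : 0 <= enorm x.
Proof. exact: sqrtr_ge0. Qed.

Lemma enorm_scale_Rd a (x : Rd R d) : 0 <= a ->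
  enorm (scale_Rd a x) = a * enorm x.
Proof.
move=> a0; rewrite /enorm; under eq_bigr do rewrite tnth_mktuple exprMn.
by rewrite -mulr_sumr sqrtrM ?sqr_ge0// sqrtr_sqr ger0_norm.
Qed.

Lemma scale_RdK a (x : Rd R d) : a != 0 -> scale_Rd a^-1 (scale_Rd a x) = x.
Proof.
by move=> a0; apply: eq_from_tnth => i; rewrite !tnth_mktuple mulKf.
Qed.

Variable phi : R -> R.
Hypothesis phiP : profile d phi.

(** The profile is monotone on the nonnegative half-line only; composed with [Num.max r 0] it is
    monotone on the whole line, hence measurable. *)
Lemma measurable_profile_comp disp (T : measurableType disp) (f : T -> R) :
  measurable_fun setT f -> (forall t, 0 <= f t) ->
  measurable_fun setT (fun t => phi (f t)).
Proof.
move=> mf f0.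
rewrite (_ : (fun _ => _) = (fun r => phi (Num.max r 0)) \o f); last first.
  by apply/funext => t /=; rewrite max_l.
apply: measurableT_comp => //; apply: nonincreasing_measurable => // r s rs.
apply: profile_nonincreasing phiP _ _ _ _; first by rewrite le_max lexx orbT.
by rewrite ge_max !le_max rs lexx !orbT.
Qed.

Let F (y : Rd R d) := (phi (enorm y ^+ d))%:E.

Let F0 y : (0 <= F y)%E.
Proof. by rewrite lee_fin (profile_ge0 phiP)// exprn_ge0// enorm_ge0. Qed.

Let mF : measurable_fun setT F.
Proof.
apply/measurable_EFinP; apply: measurable_profile_comp.
  by apply: measurable_funX; exact: measurable_enorm.
by move=> y; rewrite exprn_ge0// enorm_ge0.
Qed.

(** The torus scaled by [a], a cube of side [a] for positive [a]. *)
Let cube (a : R) : set (Rd R d) := scale_Rd a^-1 @^-1` torus.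

Let mcube a : measurable (cube a).
Proof.
rewrite -[X in measurable X]setTI; apply: measurable_scale_Rd => //.
exact: measurable_torus.
Qed.

Let cube_subset a b : 0 < a -> a <= b -> cube a `<=` cube b.
Proof.
move=> a0 ab x xa i; have := xa i; rewrite !tnth_mktuple.
have b0 := lt_le_trans a0 ab.
rewrite ![_^-1 * tnth x i]mulrC !ltr_pdivlMr// !ler_pdivrMr// => /andP[h1 h2].
by apply/andP; split; nra.
Qed.

Let integral_cube_le a : (\int[mu]_(y in cube a) F y <= 1)%E.
Proof. by rewrite -(profile_normalized phiP); exact: ge0_subset_integral. Qed.

Let integral_cube_cvg :
  (\int[mu]_(y in cube n.+1%:R) F y)%E @[n --> \oo] --> (1 : \bar R)%E.
Proof.
rewrite -(profile_normalized phiP).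
under eq_fun do rewrite integral_mkcond.
have -> : (\int[mu]_x (phi (enorm x ^+ d))%:E =
    \int[mu]_x limn (fun n => (F \_ (cube n.+1%:R)) x))%E.
  apply: eq_integral => x _; apply/esym/cvg_lim => //.
  apply: cvg_near_cst.
  (* Every coordinate is bounded by the norm, so a cube whose side exceeds twice the norm contains
     [x]. *)
  have [N _ HN] : \forall n \near \oo, 2 * (enorm x + 1) < n.+1%:R :> R.
    near=> n; apply: (@le_lt_trans _ _ n%:R); last by rewrite ltr_nat.
    near: n; exact: nbhs_infty_ger.
  exists N => // n /HN/= nx; rewrite patchE mem_set// => i.
  rewrite tnth_mktuple mulrC ltr_pdivlMr// ler_pdivrMr//.
  have : `|tnth x i : R| <= enorm x.
    rewrite -sqrtr_sqr /enorm ler_wsqrtr// (bigD1 i)//= lerDl.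
    by apply: sumr_ge0 => j _; exact: sqr_ge0.
  rewrite ler_norml => /andP[h1 h2]; apply/andP; split; lra.
apply: cvg_monotone_convergence => //.
- move=> n; apply/(measurable_restrictT _ (mcube _)).
  exact: measurable_funS mF.
- by move=> n x _; apply: erestrict_ge0.
- move=> x _ m n mn; rewrite !patchE; case: ifPn => [/set_mem xm|_].
    rewrite mem_set//; apply: cube_subset xm => //.
    by rewrite ler_nat.
  by case: ifP.
Unshelve. all: by end_near. Qed.

(** With one endpoint at the origin and the other uniform on the torus, this is the mean edge
    probability when the d-th power of the distance is multiplied by [c]; by translation invariance
    the fixed endpoint may be anywhere on the torus. *)
Definition edge_mean (c : R) : R :=
  fine (\int[mu]_(y in torus) (phi (c * enorm y ^+ d))%:E)%E.

Hypothesis d_ge1 : (1 <= d)%N.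

(** Scaling by c^(1/d) absorbs [c] into the norm and turns the torus into a cube. The upper bound
    and the limit of [c * edge_mean c] are read off from this. *)
Let integral_torus_cube c : 0 < c ->
  (\int[mu]_(y in torus) (phi (c * enorm y ^+ d))%:E =
   (c^-1)%:E * \int[mu]_(y in cube (c `^ d%:R^-1)) F y)%E.
Proof.
move=> c0; set a := c `^ _.
have a0 : 0 < a by exact: powR_gt0.
have ad : a ^+ d = c.
  rewrite -powR_mulrn ?powR_ge0// -powRrM mulVf ?powRr1 ?ltW//.
  by rewrite pnatr_eq0 -lt0n.
have -> : c^-1 = a^-1 ^+ d by rewrite exprVn ad.
rewrite [in RHS]integral_mkcond.
rewrite -(ge0_integral_scale_Rd (f := (F \_ (cube a))))//; last 2 first.
- by apply/(measurable_restrictT _ (mcube _)); exact: measurable_funS mF.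
- by move=> y; apply: erestrict_ge0.
rewrite integral_mkcond; apply: eq_integral => y _.
rewrite !patchE /cube -[in X in _ = if X then _ else _]/(scale_Rd a y).
have -> : (scale_Rd a y \in scale_Rd a^-1 @^-1` torus) = (y \in torus).
  by apply/idP/idP => /set_mem h; apply/mem_set; move: h;
    rewrite /preimage/= scale_RdK// gt_eqF.
by rewrite /F enorm_scale_Rd 1?ltW// exprMn ad.
Qed.

Lemma edge_meanE c : 0 < c ->
  (\int[mu]_(y in torus) (phi (c * enorm y ^+ d))%:E = (edge_mean c)%:E)%E.
Proof.
move=> c0; rewrite /edge_mean fineK// ge0_fin_numE; last first.
  apply: integral_ge0 => y _; rewrite lee_fin (profile_ge0 phiP)//.
  by apply: mulr_ge0; [exact: ltW|apply: exprn_ge0; exact: enorm_ge0].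
rewrite integral_torus_cube//; apply: (@le_lt_trans _ _ ((c^-1)%:E * 1)%E).
  by rewrite lee_wpmul2l// lee_fin invr_ge0 ltW.
by rewrite mule1 ltry.
Qed.

Let edge_mean_cube c : 0 < c ->
  ((c * edge_mean c)%:E = \int[mu]_(y in cube (c `^ d%:R^-1)) F y)%E.
Proof.
move=> c0; rewrite EFinM -edge_meanE// integral_torus_cube//.
by rewrite muleA -EFinM divff ?gt_eqF// mul1e.
Qed.

Lemma edge_mean_ge0 c : 0 < c -> 0 <= edge_mean c.
Proof.
move=> c0; rewrite -(pmulr_rge0 _ c0) -lee_fin edge_mean_cube//.
by apply: integral_ge0.
Qed.

Lemma edge_mean_mul_le1 c : 0 < c -> c * edge_mean c <= 1.
Proof. by move=> c0; rewrite -lee_fin edge_mean_cube. Qed.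

Lemma edge_mean_mul_cvg1 e : 0 < e ->
  exists M, forall c, 0 < c -> M <= c -> 1 - e <= c * edge_mean c.
Proof.
move=> e0.
have /fine_cvgP[_ /cvgrPdist_le/(_ e e0)[N _ HN]] := integral_cube_cvg.
(* From this threshold on, the side c^(1/d) is at least N + 1. *)
exists (N.+1%:R ^+ d) => c c0 Nc.
have := HN N (leqnn N); rewrite /= distrC ler_norml => /andP[+ _].
set J := (\int[mu]_(y in cube N.+1%:R) F y)%E => h.
suff : fine J <= c * edge_mean c by lra.
have J0 : (0 <= J)%E by apply: integral_ge0.
have Jfin : J \is a fin_num.
  by rewrite ge0_fin_numE// (le_lt_trans (integral_cube_le _))// ltry.
rewrite -lee_fin fineK// edge_mean_cube//; apply: ge0_subset_integral => //.
  exact: measurable_funS mF.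
apply: cube_subset => //.
have -> : N.+1%:R = (N.+1%:R ^+ d) `^ d%:R^-1 :> R.
  rewrite -powR_mulrn// -powRrM mulfV ?powRr1//.
  by rewrite pnatr_eq0 -lt0n.
apply: ge0_ler_powR Nc; rewrite ?nnegrE; [by rewrite invr_ge0|exact: exprn_ge0|exact: ltW].
Qed.

Lemma mean_torus_edge c (x : Rd R d) : 0 < c -> torus x ->
  (\int[mu]_(y in torus) (phi (c * torus_dist x y ^+ d))%:E =
   (edge_mean c)%:E)%E.
Proof.
move=> c0 tx; rewrite -edge_meanE//.
have f0 r : 0 <= c * Num.sqrt r ^+ d.
  by apply: mulr_ge0; [exact: ltW|apply: exprn_ge0; exact: sqrtr_ge0].
have mf : measurable_fun setT (fun r : R => (phi (c * Num.sqrt r ^+ d))%:E).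
  apply/measurable_EFinP/measurable_profile_comp => //.
  apply: measurable_funM => //; apply: measurable_funX.
  by apply: continuous_measurable_fun; exact: sqrt_continuous.
transitivity (\int[mu]_(y in torus)
    (phi (c * Num.sqrt (circ_sqnorm x y) ^+ d))%:E)%E.
  by apply: eq_integral => y _; rewrite torus_dist_circ.
rewrite (ge0_integral_circ mf)// => r.
by rewrite lee_fin (profile_ge0 phiP).
Qed.

Lemma measurable_torus_dist disp (T : measurableType disp) (f g : T -> Rd R d) :
  measurable_fun setT f -> measurable_fun setT g ->
  measurable_fun setT (fun t => torus_dist (f t) (g t)).
Proof.
move=> mf mg; under eq_fun do rewrite torus_dist_circ.
apply: (@measurableT_comp _ _ _ _ _ _ (@Num.sqrt R)).
  by apply: continuous_measurable_fun; exact: sqrt_continuous.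
exact: measurable_circ_sqnorm.
Qed.

Lemma torus_dist_ge0 (x y : Rd R d) : 0 <= torus_dist x y.
Proof. by rewrite torus_dist_circ sqrtr_ge0. Qed.

Lemma torus_distC (x y : Rd R d) : torus_dist x y = torus_dist y x.
Proof.
rewrite !torus_dist_circ; congr Num.sqrt; apply: eq_bigr => i _.
by rewrite -circ_normN opprB.
Qed.

(** The truncation keeps the argument of the profile in its domain; the scales at which [edge_mean]
    is evaluated later are positive and not affected. *)
Lemma measurable_edge_mean : measurable_fun setT (fun c : R => edge_mean (Num.max c 0)).
Proof.
pose f (p : R * Rd R d) :=
  ((EFin \o (fun p : R * Rd R d => phi (Num.max p.1 0 * enorm p.2 ^+ d)))
    \_ (setT `*` torus)) p.
have f0 p : (0 <= f p)%E.
  apply: erestrict_ge0 => -[c y] _ /=; rewrite lee_fin (profile_ge0 phiP)//.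
  apply: mulr_ge0; first by rewrite le_max lexx orbT.
  by apply: exprn_ge0; exact: enorm_ge0.
have mT : measurable ([set: measurableTypeR R] `*` @torus R d).
  by apply: measurableX => //; exact: measurable_torus.
have mf : measurable_fun setT f.
  apply/(measurable_restrictT _ mT); apply: (@measurable_funS _ _ _ _ setT) => //.
  apply/measurable_EFinP/measurable_profile_comp => [|p].
    apply: measurable_funM; first exact: measurable_maxr.
    apply: measurable_funX; apply: (measurableT_comp measurable_enorm).
    exact: measurable_snd.
  apply: mulr_ge0; first by rewrite le_max lexx orbT.
  by apply: exprn_ge0; exact: enorm_ge0.
have -> : (fun c => edge_mean (Num.max c 0)) = fine \o fubini_F mu f.
  apply/funext => c; rewrite /edge_mean /= /fubini_F [in LHS]integral_mkcond.
  congr fine; apply: eq_integral => y _; rewrite /f !patchE.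
  congr (if _ then _ else _).
  by apply/idP/idP => /set_mem h; apply/mem_set => //; case: h.
by apply: measurableT_comp => //; exact: measurable_fun_fubini_tonelli_F.
Qed.

End mean_edge_probability.

(** * Averaging out positions *)

Section independent_sigma_algebras.
Context {disp} {T : measurableType disp} {R : realType} (P : probability T R).
Variables (I : choiceType) (F : I -> set_system T).
Hypothesis indF : mutually_independent P F.
Hypothesis F_measurable : forall i, F i `<=` measurable.
Hypothesis FT : forall i, F i setT.
Hypothesis FI : forall i, setI_closed (F i).

Definition other_events (i : I) : set_system T :=
  \bigcup_(j in [set j | j != i]) F j.

(** Finite intersections of events with indices other than [i]: a generating family closed under
    intersection, as uniqueness of measures requires. *)
Let cylinders (i : I) : set_system T := [set A | exists (s : seq I) (B : I -> set T),
  [/\ uniq s, i \notin s, forall j, F j (B j) & A = \bigcap_(j in [set` s]) B j]].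

Let cylindersI i : setI_closed (cylinders i).
Proof.
move=> _ _ [s1 [B1 [u1 i1 FB1 ->]]] [s2 [B2 [u2 i2 FB2 ->]]].
exists (undup (s1 ++ s2)),
  (fun j => (if j \in s1 then B1 j else setT) `&` (if j \in s2 then B2 j else setT)).
split; first exact: undup_uniq.
- by rewrite mem_undup mem_cat negb_or i1.
- by move=> j; apply: FI; case: ifP.
- apply/seteqP; split=> [w [h1 h2] j _|w h].
    split; [case: ifP => // js; exact: h1|case: ifP => // js; exact: h2].
  split=> j /= js.
    have [] := h j; first by rewrite /= mem_undup mem_cat js.
    by rewrite js.
  have hj : j \in undup (s1 ++ s2) by rewrite mem_undup mem_cat js orbT.
  by have [_] := h j hj; rewrite js.
Qed.

Let cylinders_measurable i : cylinders i `<=` measurable.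
Proof.
move=> _ [s [B [_ _ FB ->]]]; apply: fin_bigcap_measurable => //.
by move=> j _; exact: F_measurable.
Qed.

Let other_cylinders i : <<s other_events i >> `<=` <<s cylinders i >>.
Proof.
apply: smallest_sub; first exact: smallest_sigma_algebra.
move=> A [j /= ji FA]; apply: sub_sigma_algebra.
exists [:: j], (fun k => if k == j then A else setT); split => //.
- by rewrite mem_seq1 eq_sym.
- by move=> k; case: eqP => [->|].
- apply/seteqP; split=> [w Aw k /=|w /(_ j)]; first by case: eqP.
  by rewrite eqxx; apply; rewrite /= mem_seq1.
Qed.

Lemma other_events_measurable i : <<s other_events i >> `<=` measurable.
Proof.
apply: smallest_sub; first exact: sigma_algebra_measurable.
by move=> A [j _ FA]; exact: F_measurable FA.
Qed.

(** Both sides are finite measures as functions of [A], and they agree on cylinders. *)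
Lemma other_events_independent i A B : <<s other_events i >> A -> F i B ->
  P (A `&` B) = (P A * P B)%E.
Proof.
move=> /other_cylinders sA FB.
have mB := F_measurable FB.
pose m1 := mrestr P mB.
pose m2 := mscale (NngNum (fine_ge0 (measure_ge0 P B))) P.
have -> : P (A `&` B) = m1 A by [].
have -> : (P A * P B)%E = m2 A.
  by rewrite /m2 /mscale /= fineK ?fin_num_measure// muleC.
apply: (g_sigma_algebra_measure_unique (cylinders i) _ (fun=> setT)) => //.
- by move=> _; exists [::], (fun=> setT); split => //; apply/seteqP; split.
- by rewrite bigcup_const.
- move=> _ [s [C [us is_ FC ->]]].
  set D := \bigcap_(j in _) _.
  have E : P (D `&` B) = ((fine (P B))%:E * P D)%E; last exact: E.
  rewrite fineK ?fin_num_measure// {}/D.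
  (* With [B] placed at index [i], mutual independence is applied once to [i :: s] and once to
     [s]. *)
  pose C' j := if j == i then B else C j.
  have FC' j : F j (C' j) by rewrite /C'; case: eqP => [->|].
  have C'E j : j \in s -> C' j = C j.
    by move=> js; rewrite /C'; case: eqP js is_ => // -> ->.
  have -> : \bigcap_(j in [set` s]) C j = \bigcap_(j in [set` s]) C' j.
    by apply: eq_bigcapr => j js; rewrite C'E.
  have C'i : C' i = B by rewrite /C' eqxx.
  have uis : uniq (i :: s) by rewrite /= is_ us.
  have := indF uis (fun j _ => FC' j).
  rewrite big_cons -(indF us (fun j _ => FC' j)) C'i => <-.
  by rewrite !bigcap_seq big_cons C'i setIC.
- by move=> _; rewrite /= /mrestr setTI ltey_eq fin_num_measure.
Qed.

(** The substitute for conditioning on all marks but one: with outcomes carrying the smaller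
    sigma-algebra, the pair of outcome and mark has a product law, and Tonelli's theorem integrates
    the mark first. *)
Lemma integral_freeze i disp' (T' : measurableType disp') (X : {RV P >-> T'})
    (f : g_sigma_algebraType (other_events i) * T' -> \bar R) :
  events_of X = F i ->
  measurable_fun setT f -> (forall p, 0 <= f p)%E ->
  (\int[P]_w f (w, X w) = \int[P]_w \int[distribution P X]_y f (w, y))%E.
Proof.
move=> XF mf f0.
pose GT := g_sigma_algebraType (other_events i).
have mid : measurable_fun setT (id : T -> GT).
  by move=> _ A mA; rewrite setTI preimage_id; exact: (@other_events_measurable i).
pose idG : {mfun T >-> GT} := HB.pack (id : T -> GT)
  (isMeasurableFun.Build _ _ _ _ (id : T -> GT) mid).
pose j (w : T) : GT * T' := (w, X w).
have mj : measurable_fun setT j.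
  by apply/measurable_fun_pairP; split => //; exact: measurable_funP X.
pose jm : {mfun T >-> (GT * T')%type} := HB.pack j (isMeasurableFun.Build _ _ _ _ j mj).
have prodE (A : set GT) (B : set T') : measurable A -> measurable B ->
    distribution P jm (A `*` B) = (distribution P idG A * distribution P X B)%E.
  move=> mA mB; rewrite -(@other_events_independent i)//.
  by rewrite -XF; exists B => //; rewrite setTI.
transitivity (\int[distribution P jm]_p f p)%E.
  by rewrite ge0_integral_distribution.
have -> : (\int[distribution P jm]_p f p =
    \int[(distribution P idG \x distribution P X)%E]_p f p)%E.
  apply: eq_measure_integral => A mA _; apply/esym.
  exact: product_measure_unique.
rewrite fubini_tonelli1// ge0_integral_distribution//.
- exact: measurable_fun_fubini_tonelli_F.
- by move=> w; apply: integral_ge0.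
Qed.

End independent_sigma_algebras.

(** * Expectations of bounded random variables *)

Section bounded_measurable.
Context {disp} {T : measurableType disp} {R : realType} (P : probability T R).
Implicit Types f g : T -> R.

(** On this class, closed under sums and products, the real-valued integral is linear and monotone
    without integrability side conditions. *)
Definition bounded_measurable f :=
  measurable_fun setT f /\ exists M, forall w, `|f w| <= M.

Local Notation bm := bounded_measurable.

Lemma bm_cst c : bm (fun=> c).
Proof. by split => //; exists `|c|. Qed.

Lemma bmD f g : bm f -> bm g -> bm (fun w => f w + g w).
Proof.
move=> [mf [M fM]] [mg [N gN]]; split; first exact: measurable_funD.
by exists (M + N) => w; rewrite (le_trans (ler_normD _ _))// lerD.
Qed.

Lemma bmM f g : bm f -> bm g -> bm (fun w => f w * g w).
Proof.
move=> [mf [M fM]] [mg [N gN]]; split; first exact: measurable_funM.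
by exists (M * N) => w; rewrite normrM ler_pM.
Qed.

Lemma bmN f : bm f -> bm (fun w => - f w).
Proof.
move=> [mf [M fM]]; split; first exact: measurableT_comp.
by exists M => w; rewrite normrN.
Qed.

Lemma bmB f g : bm f -> bm g -> bm (fun w => f w - g w).
Proof. by move=> bf /bmN; exact: bmD. Qed.

Lemma bm_prod (I : Type) (s : seq I) (Q : pred I) (F : I -> T -> R) :
  (forall i, Q i -> bm (F i)) -> bm (fun w => \prod_(i <- s | Q i) F i w).
Proof.
move=> bF; elim: s => [|i s IH].
  by under eq_fun do rewrite big_nil; exact: bm_cst.
under eq_fun do rewrite big_cons.
case: (boolP (Q i)) => // Qi.
by apply: bmM => //; exact: bF.
Qed.

Lemma bm_sum (I : Type) (s : seq I) (Q : pred I) (F : I -> T -> R) :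
  (forall i, Q i -> bm (F i)) -> bm (fun w => \sum_(i <- s | Q i) F i w).
Proof.
move=> bF; elim: s => [|i s IH].
  by under eq_fun do rewrite big_nil; exact: bm_cst.
under eq_fun do rewrite big_cons.
case: (boolP (Q i)) => // Qi.
by apply: bmD => //; exact: bF.
Qed.

Lemma bm_norm f : bm f -> bm (fun w => `|f w|).
Proof.
move=> [mf [M fM]]; split; first exact: measurableT_comp.
by exists M => w; rewrite normr_id.
Qed.

Lemma bm_indic A : measurable A -> bm (\1_A).
Proof.
move=> mA; split; first exact: measurable_indic.
by exists 1 => w; rewrite indicE; case: (w \in A); rewrite ?normr1 ?normr0.
Qed.

Lemma bm01 f : measurable_fun setT f -> (forall w, 0 <= f w <= 1) -> bm f.
Proof.
by move=> mf f01; split=> //; exists 1 => w; rewrite ger0_norm; case/andP: (f01 w).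
Qed.

Lemma bm_integrable f : bm f -> P.-integrable setT (EFin \o f).
Proof.
move=> [mf [M fM]]; apply: measurable_bounded_integrable => //.
  by rewrite ltey_eq fin_num_measure.
exists M; split; first exact: num_real.
by move=> x Mx w _; apply: (le_trans (fM w)); exact: ltW.
Qed.

Lemma bm_EFin f : bm f -> (\int[P]_w (f w)%:E = (\int[P]_w f w)%:E)%E.
Proof.
by move=> bf; rewrite /Rintegral fineK//; apply: integrable_fin_num => //; exact: bm_integrable.
Qed.

Lemma bm_EFD f g : bm f -> bm g ->
  \int[P]_w (f w + g w) = \int[P]_w f w + \int[P]_w g w.
Proof. by move=> bf bg; rewrite RintegralD//; exact: bm_integrable. Qed.

Lemma bm_EFB f g : bm f -> bm g ->
  \int[P]_w (f w - g w) = \int[P]_w f w - \int[P]_w g w.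
Proof. by move=> bf bg; rewrite RintegralB//; exact: bm_integrable. Qed.

Lemma bm_EFZ f c : bm f -> \int[P]_w (c * f w) = c * \int[P]_w f w.
Proof. by move=> bf; rewrite RintegralZl//; exact: bm_integrable. Qed.

Lemma bm_EF_cst c : \int[P]_w c = c.
Proof.
have PT : P setT = 1%E := probability_setT P.
rewrite Rintegral_cst//; transitivity (c * fine (P setT)) => //.
by rewrite PT mulr1.
Qed.

Lemma bm_EF_sum (I : Type) (s : seq I) (F : I -> T -> R) :
  (forall i, bm (F i)) ->
  \int[P]_w (\sum_(i <- s) F i w) = \sum_(i <- s) \int[P]_w F i w.
Proof.
move=> bF; elim: s => [|i s IH].
  by rewrite big_nil; under eq_Rintegral do rewrite big_nil; rewrite bm_EF_cst.
rewrite big_cons -IH -bm_EFD//; last exact: bm_sum.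
by apply: eq_Rintegral => w _; rewrite big_cons.
Qed.

Lemma bm_EF_le f g : bm f -> bm g -> (forall w, f w <= g w) ->
  \int[P]_w f w <= \int[P]_w g w.
Proof. by move=> bf bg fg; apply: le_Rintegral => //; exact: bm_integrable. Qed.

Lemma bm_EF_indic A : measurable A -> \int[P]_w \1_A w = fine (P A).
Proof. by move=> mA; rewrite /Rintegral integral_indic// setIT. Qed.

End bounded_measurable.

Lemma measurable_fun_inv_gt0 disp (T : measurableType disp) (R : realType)
    (f : T -> R) : measurable_fun setT f -> (forall t, 0 < f t) ->
  measurable_fun setT (fun t => (f t)^-1).
Proof.
move=> mf f0.
rewrite (_ : (fun _ => _) = (fun x => x `^ (-1)) \o f).
  by apply: measurableT_comp => //; exact: measurable_powR.
by apply/funext => t /=; rewrite powR_inv1// ltW.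
Qed.

(** * Edge probabilities given all marks but one position *)

Section network_marks.
Context {R : realType} {d : nat} {disp} {T : measurableType disp}
  {P : probability T R}.
Variables (gamma beta : R) (phi : R -> R).
Variables (gap : nat -> {RV P >-> measurableTypeR R})
  (pos : nat -> {RV P >-> Rd R d}) (adj : T -> rel nat).
Hypothesis d_ge1 : (1 <= d)%N.
Hypothesis beta_gt0 : 0 < beta.
Hypothesis phiP : profile d phi.
Hypothesis G : age_based_network gamma beta phi gap pos adj.

Local Notation events := (mark_events gap pos).
Local Notation sub i := (g_sigma_algebraType (other_events events i)).

Lemma mark_events_measurable i : events i `<=` measurable.
Proof.
by case: i => n A [B mB <-]; apply: measurable_funP.
Qed.

Lemma mark_eventsT i : events i setT.
Proof. by case: i => n; exists setT => //; rewrite setTI preimage_setT. Qed.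

Lemma mark_eventsI i : setI_closed (events i).
Proof.
case: i => n _ _ [A mA <-] [B mB <-]; exists (A `&` B);
  by [exact: measurableI|rewrite !setTI preimage_setI].
Qed.

Lemma measurable_sub i disp' (T' : measurableType disp') (f : T -> T') :
  measurable_fun setT (f : sub i -> T') -> measurable_fun setT f.
Proof.
move=> mf _ A mA; rewrite setTI.
apply: (other_events_measurable mark_events_measurable (i := i)).
by rewrite -[X in _ X]setTI; exact: mf.
Qed.

Lemma measurable_gap_sub k n :
  measurable_fun setT (gap n : sub (inr k) -> measurableTypeR R).
Proof.
move=> _ A mA; apply: sub_sigma_algebra; exists (inl n) => //=.
by exists A.
Qed.

Lemma measurable_pos_sub (k n : nat) : n != k ->
  measurable_fun setT (pos n : sub (inr k) -> Rd R d).
Proof.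
move=> nk _ A mA; apply: sub_sigma_algebra; exists (inr n) => //=.
by exists A.
Qed.

Lemma measurable_birth_sub k n :
  measurable_fun setT (birth gap n : sub (inr k) -> R).
Proof. by apply: measurable_sum => i; exact: measurable_gap_sub. Qed.

Lemma birth_gt0 n w : 0 < birth gap n w.
Proof.
rewrite /birth big_ord_recl ltr_pwDl ?(network_gap_gt0 G)//.
by apply: sumr_ge0 => i _; exact/ltW/(network_gap_gt0 G).
Qed.

Lemma birthS n w : birth gap n.+1 w = birth gap n w + gap n.+1 w.
Proof. by rewrite /birth big_ord_recr. Qed.

Lemma birth_lt w : {homo (fun n => birth gap n w) : m n / (m < n)%N >-> m < n}.
Proof.
apply: homo_ltn => [x y z|n]; first exact: lt_trans.
by rewrite birthS ltrDl (network_gap_gt0 G).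
Qed.

(** The part of the argument of [phi] determined by birth times alone; positions enter only through
    the distance. *)
Definition edge_scale (m n : nat) (w : T) : R :=
  birth gap n w / (beta * (birth gap n w / birth gap m w) `^ gamma).

Lemma edge_scale_gt0 m n w : 0 < edge_scale m n w.
Proof.
rewrite /edge_scale divr_gt0 ?birth_gt0// mulr_gt0// powR_gt0//.
by rewrite divr_gt0 ?birth_gt0.
Qed.

Lemma measurable_edge_scale_sub k m n :
  measurable_fun setT (edge_scale m n : sub (inr k) -> R).
Proof.
apply: measurable_funM; first exact: measurable_birth_sub.
apply: (@measurable_fun_inv_gt0 _ (sub (inr k))); last first.
  move=> w; apply: mulr_gt0 => //; apply: powR_gt0.
  by apply: divr_gt0; exact: birth_gt0.
apply: measurable_funM => //.
apply: (@measurableT_comp _ _ _ _ _ _ (@powR R ^~ gamma)); first exact: measurable_powR.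
apply: measurable_funM; first exact: measurable_birth_sub.
apply: (@measurable_fun_inv_gt0 _ (sub (inr k))); first exact: measurable_birth_sub.
by move=> w; exact: birth_gt0.
Qed.

Local Notation w_ := (edge_prob gamma beta phi gap pos).

Lemma edge_probE m n w : w_ m n w =
  phi (edge_scale m n w * torus_dist (pos n w) (pos m w) ^+ d).
Proof. by rewrite /edge_prob /edge_scale mulrAC. Qed.

Lemma edge_scale_dist_ge0 m n w (x y : Rd R d) :
  0 <= edge_scale m n w * torus_dist x y ^+ d.
Proof.
apply: mulr_ge0; first exact/ltW/edge_scale_gt0.
by apply: exprn_ge0; exact: torus_dist_ge0.
Qed.

Lemma edge_prob01 m n w : 0 <= w_ m n w <= 1.
Proof.
rewrite edge_probE (profile_ge0 phiP) ?(profile_le1 phiP)//;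
  exact: edge_scale_dist_ge0.
Qed.

Definition mean_edge (m n : nat) (w : T) : R := edge_mean d phi (edge_scale m n w).

Lemma measurable_edge_prob_sub (k m n : nat) : m != k -> n != k ->
  measurable_fun setT (w_ m n : sub (inr k) -> R).
Proof.
move=> mk nk.
rewrite (_ : w_ m n = fun w =>
  phi (edge_scale m n w * torus_dist (pos n w) (pos m w) ^+ d)); last first.
  by apply/funext => w; exact: edge_probE.
apply: (measurable_profile_comp phiP) => [|w]; last exact: edge_scale_dist_ge0.
apply: measurable_funM; first exact: measurable_edge_scale_sub.
by apply: measurable_funX; apply: measurable_torus_dist; exact: measurable_pos_sub.
Qed.

Lemma measurable_mean_edge_sub k m n :
  measurable_fun setT (mean_edge m n : sub (inr k) -> R).
Proof.
rewrite (_ : mean_edge m n =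
  (fun c => edge_mean d phi (Num.max c 0)) \o edge_scale m n).
  apply: measurableT_comp; last exact: measurable_edge_scale_sub.
  exact: measurable_edge_mean.
by apply/funext => w /=; rewrite max_l// ltW// edge_scale_gt0.
Qed.

Lemma integral_pos k (f : Rd R d -> \bar R) :
  measurable_fun setT f -> (forall y, 0 <= f y)%E ->
  (\int[distribution P (pos k)]_y f y = \int[lebesgue_tuple d]_(y in torus) f y)%E.
Proof.
move=> mf f0.
have mt : measurable (~` @torus R d) by apply: measurableC; exact: measurable_torus.
rewrite (ge0_negligible_integral mt)//=; last first.
  by rewrite /distribution /pushforward (network_pos G)// setICl measure0.
rewrite setTD setCK; apply: eq_measure_integral => A mA At.
transitivity (P (pos k @^-1` A)) => //.
by rewrite (network_pos G)// setIidl.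
Qed.

Lemma mean_edge01 m n w : 0 <= mean_edge m n w <= 1.
Proof.
rewrite (edge_mean_ge0 phiP)// ?edge_scale_gt0//=.
rewrite -lee_fin -(edge_meanE phiP) ?edge_scale_gt0//.
have h0 (y : Rd R d) : 0 <= edge_scale m n w * enorm y ^+ d.
  by apply: mulr_ge0; [exact/ltW/edge_scale_gt0|apply: exprn_ge0; exact: enorm_ge0].
have mh : measurable_fun setT
    (fun y : Rd R d => (phi (edge_scale m n w * enorm y ^+ d))%:E).
  apply/measurable_EFinP/(measurable_profile_comp phiP) => //.
  by apply: measurable_funM => //; apply: measurable_funX; exact: measurable_enorm.
have h1 (y : Rd R d) : (0 <= (phi (edge_scale m n w * enorm y ^+ d))%:E)%E.
  by rewrite lee_fin (profile_ge0 phiP).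
(* The integral over the torus becomes one against the law of the position of vertex 0, a
   probability, so that bounding the integrand by 1 suffices. *)
rewrite -(integral_pos 0%N mh h1).
apply: (@le_trans _ _ (\int[distribution P (pos 0%N)]_y 1)%E).
  apply: ge0_le_integral => //.
  by move=> y _; rewrite lee_fin (profile_le1 phiP).
by rewrite integral_cst// mul1e; exact: probability_le1.
Qed.

(* Given all other marks, the position of k is uniform on the torus, and
   translation invariance makes the mean edge probability depend on the birth
   times only. *)
Lemma expectation_edge_prob (f : T -> R) (k m n : nat) :
  m != n -> (k == m) || (k == n) ->
  measurable_fun setT (f : sub (inr k) -> R) -> (forall w, 0 <= f w) ->
  (\int[P]_w (f w * w_ m n w)%:E = \int[P]_w (f w * mean_edge m n w)%:E)%E.
Proof.
move=> mn kmn mf f0.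
(* The endpoint other than [k], whose position is frozen together with the remaining marks. *)
pose o := if k == m then n else m.
have ok : o != k.
  rewrite /o; have [->|nkm] := eqVneq k m; first by rewrite eq_sym.
  by have := kmn; rewrite (negbTE nkm)/= => /eqP ->.
pose h (p : sub (inr k) * Rd R d) :=
  f p.1 * phi (edge_scale m n p.1 * torus_dist (pos o p.1) p.2 ^+ d).
have h0 p : 0 <= h p.
  by rewrite mulr_ge0// (profile_ge0 phiP)// edge_scale_dist_ge0.
have mh : measurable_fun setT h.
  apply: measurable_funM; first exact: (measurableT_comp mf).
  apply: (measurable_profile_comp phiP) => [|p]; last exact: edge_scale_dist_ge0.
  apply: measurable_funM.
    apply: (measurableT_comp (@measurable_edge_scale_sub k m n)).
    exact: measurable_fst.
  apply: measurable_funX; apply: measurable_torus_dist => //.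
  exact: (measurableT_comp (measurable_pos_sub ok)).
have E := integral_freeze (network_marks G) mark_events_measurable mark_eventsT
  mark_eventsI (i := inr k) (X := pos k) (f := EFin \o h) erefl
  ((measurable_EFinP _ _).2 mh) h0.
transitivity (\int[P]_w (h (w, pos k w))%:E)%E.
  apply: eq_integral => w _; rewrite /h /= edge_probE /o.
  case: (eqVneq k m) kmn => [->//|_ /eqP->//].
  by rewrite torus_distC.
rewrite E; apply: eq_integral => w _.
rewrite integral_pos; last 2 first.
- by apply/measurable_EFinP; apply: (measurableT_comp mh).
- by move=> y; rewrite lee_fin.
rewrite /h /=; under eq_integral do rewrite EFinM.
rewrite ge0_integralZl//=; last 4 first.
- exact: measurable_torus.
- apply: (@measurable_funS _ _ _ _ setT) => //.
  apply/measurable_EFinP/(measurable_profile_comp phiP) => [|y]; last exact: edge_scale_dist_ge0.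
  by apply: measurable_funM => //; apply: measurable_funX; exact: measurable_torus_dist.
- by move=> y _; rewrite lee_fin (profile_ge0 phiP)// edge_scale_dist_ge0.
- by rewrite lee_fin.
by rewrite (mean_torus_edge phiP)//; [exact: edge_scale_gt0|exact: (network_pos_torus G)].
Qed.

End network_marks.

(** * Expectations of products over edges *)

Section edge_expectations.
Context {R : realType} {d : nat} {disp} {T : measurableType disp}
  {P : probability T R}.
Variables (gamma beta : R) (phi : R -> R).
Variables (gap : nat -> {RV P >-> measurableTypeR R})
  (pos : nat -> {RV P >-> Rd R d}) (adj : T -> rel nat).
Hypothesis d_ge1 : (1 <= d)%N.
Hypothesis beta_gt0 : 0 < beta.
Hypothesis phiP : profile d phi.
Hypothesis G : age_based_network gamma beta phi gap pos adj.

Local Notation events := (mark_events gap pos).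
Local Notation sub i := (g_sigma_algebraType (other_events events i)).
Local Notation bm := bounded_measurable.
Local Notation w_ := (edge_prob gamma beta phi gap pos).
Local Notation p_ := (@mean_edge R d disp T P gamma beta phi gap).

Lemma bm_edge_prob m n : bm (w_ m n).
Proof.
apply: bm01; last exact: (edge_prob01 beta_gt0 phiP G).
(* Any vertex other than the two endpoints would do here. *)
apply: (@measurable_sub _ _ _ _ _ gap pos (inr (m + n).+1)).
by apply: (measurable_edge_prob_sub beta_gt0 phiP G); lia.
Qed.

Lemma bm_mean_edge m n : bm (p_ m n).
Proof.
apply: bm01; last exact: (mean_edge01 d_ge1 beta_gt0 phiP G).
apply: (@measurable_sub _ _ _ _ _ gap pos (inr 0%N)).
exact: (measurable_mean_edge_sub beta_gt0 phiP G).
Qed.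

Definition adjR (m n : nat) (w : T) : R := (adj w m n)%:R.

Lemma measurable_adjR m n : measurable_fun setT (adjR m n).
Proof.
rewrite (_ : adjR m n = \1_[set w | adj w m n]).
  exact/measurable_indic/(network_adj_measurable G).
by apply/funext => w; rewrite indicE mem_setE.
Qed.

Lemma bm_adjR m n : bm (adjR m n).
Proof.
apply: bm01; first exact: measurable_adjR.
by move=> w; rewrite /adjR ler0n lern1; case: adj.
Qed.

(** The event stays measurable whichever single position is left out, as is the case when it is
    determined by the birth times. Its indicator can therefore be carried along while any position
    is averaged. *)
Definition birth_event (A : set T) :=
  forall k, <<s other_events events (inr k) >> A.

Variable A : set T.
Hypothesis birthA : birth_event A.

Let I (w : T) : R := \1_A w.

Let I01 w : 0 <= I w <= 1.
Proof. by rewrite /I indicE; case: (w \in A) => /=; rewrite ?lexx ler01. Qed.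

Lemma birth_event_measurable : measurable A.
Proof.
exact: (other_events_measurable (@mark_events_measurable _ _ _ _ _ gap pos) (@birthA 0%N)).
Qed.
Let mA := birth_event_measurable.

Let bmI : bm I. Proof. exact: bm_indic. Qed.

Let measurable_I_sub k : measurable_fun setT (I : sub (inr k) -> R).
Proof. by apply: (@measurable_indic _ (sub (inr k))); exact: birthA. Qed.

Let vertexA : vertex_events gap pos A.
Proof.
move: (@birthA 0%N); apply: smallest_sub; first exact: smallest_sigma_algebra.
move=> B [j _ eB]; apply: sub_sigma_algebra; exists j => //.
Qed.

(** The model specifies the probabilities that given edges are all present. Expanding the factors
    [1 + c * adjR] one by one reduces the claim to products of [adjR] alone. *)
Lemma expectation_edges (c : R) (s : seq (nat * nat)) : uniq s ->
  {in s, forall e, (e.1 < e.2)%N} ->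
  \int[P]_w (I w * \prod_(e <- s) (1 + c * adjR e.1 e.2 w)) =
  \int[P]_w (I w * \prod_(e <- s) (1 + c * w_ e.1 e.2 w)).
Proof.
(* [s1] collects the edges whose factor has contributed its edge term; the factors over [s] are not
   yet expanded. *)
suff H s1 : uniq (s1 ++ s) -> {in s1 ++ s, forall e, (e.1 < e.2)%N} ->
    \int[P]_w (I w * (\prod_(e <- s1) adjR e.1 e.2 w *
      \prod_(e <- s) (1 + c * adjR e.1 e.2 w))) =
    \int[P]_w (I w * (\prod_(e <- s1) w_ e.1 e.2 w *
      \prod_(e <- s) (1 + c * w_ e.1 e.2 w))).
  move=> us lts; have := H [::] us lts.
  by under eq_Rintegral do rewrite big_nil mul1r;
    under [in RHS]eq_Rintegral do rewrite big_nil mul1r.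
elim: s s1 => [|e s IH] s1.
  rewrite cats0 => us lts.
  under eq_Rintegral do rewrite big_nil mulr1.
  under [RHS]eq_Rintegral do rewrite big_nil mulr1.
  have /(congr1 fine) := network_edges G us lts vertexA.
  rewrite /Rintegral => E.
  transitivity (fine (P (A `&` [set w | all (fun e => adj w e.1 e.2) s1]))).
    rewrite -(setIT (_ `&` _)) -integral_indic//; last first.
      apply: measurableI => //.
      rewrite (_ : [set _ | _] =
        \bigcap_(e in [set` s1]) [set w | adj w e.1 e.2]); last first.
        apply/seteqP; split=> w /=; first by move/allP => h e /h.
        by move=> h; apply/allP => e; exact: h.
      by apply: fin_bigcap_measurable => // e _; exact: (network_adj_measurable G).
    congr fine; apply: eq_integral => w _; congr EFin.
    rewrite indicI /I; congr (_ * _); rewrite indicE.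
    have -> : (w \in [set w | all (fun e => adj w e.1 e.2) s1]) =
        all (fun e => adj w e.1 e.2) s1.
      by apply/idP/idP => [/set_mem//|h]; exact/mem_set.
    elim: {us lts E} s1 => [|e s1 IH]; first by rewrite big_nil.
    by rewrite big_cons IH /= /adjR; case: adj; rewrite ?mul1r ?mul0r.
  rewrite E [in LHS]integral_mkcond; congr fine; apply: eq_integral => w _.
  rewrite patchE /I indicE; case: (w \in A) => /=; rewrite ?mul1r ?mul0r//.
rewrite -cat_rcons => us lts.
have us1 : uniq (s1 ++ s).
  by apply: subseq_uniq us; rewrite cat_rcons; apply: cat_subseq => //; exact: subseq_cons.
have lts1 : {in s1 ++ s, forall e, (e.1 < e.2)%N}.
  move=> f fs; apply: lts; rewrite cat_rcons mem_cat inE.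
  by move: fs; rewrite mem_cat => /orP[|] ->; rewrite ?orbT.
pose X (h : nat -> nat -> T -> R) (s1 : seq (nat * nat)) w :=
  I w * (\prod_(e <- s1) h e.1 e.2 w * \prod_(e <- s) (1 + c * h e.1 e.2 w)).
have bX h s2 : (forall m n, bm (h m n)) -> bm (X h s2).
  move=> bh; apply: bmM => //; apply: bmM; apply: bm_prod => f _ //.
  by apply: bmD; [exact: bm_cst|apply: bmM => //; exact: bm_cst].
have step h : (forall m n, bm (h m n)) ->
    \int[P]_w (I w * (\prod_(e <- s1) h e.1 e.2 w *
      \prod_(e <- e :: s) (1 + c * h e.1 e.2 w))) =
    \int[P]_w X h s1 w + c * \int[P]_w X h (rcons s1 e) w.
  move=> bh; rewrite -bm_EFZ; last exact: bX.
  rewrite -bm_EFD; [|exact: bX|by apply: bmM; [exact: bm_cst|exact: bX]].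
  apply: eq_Rintegral => w _; rewrite /X big_cons -cats1 big_cat big_seq1 /=.
  by move: (\prod_(_ <- s1) _) (\prod_(_ <- s) _) (h _ _ w) => x y z; ring.
rewrite (step adjR)//; last exact: bm_adjR.
rewrite (step w_)//; last exact: bm_edge_prob.
by congr (_ + c * _); rewrite /X IH.
Qed.

(* Replaces the factors one position at a time: the factors still present when
   position j is averaged out do not depend on that position. *)
Lemma expectation_replace_factors (N : nat) (a b : nat -> T -> R)
    (s M : R) (err : nat -> R) : 1 <= M ->
  (forall j w, 0 <= a j w <= M) -> (forall j w, 0 <= b j w <= M) ->
  (forall i j, (j < i < N)%N -> measurable_fun setT (a i : sub (inr j) -> R)) ->
  (forall i j, measurable_fun setT (b i : sub (inr j) -> R)) ->
  (forall j, bm (a j)) ->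
  (forall j (f : T -> R), (j < N)%N -> measurable_fun setT (f : sub (inr j) -> R) ->
    bm f -> (forall w, 0 <= f w <= I w * M ^+ N) ->
    s * \int[P]_w (f w * a j w) <= s * \int[P]_w (f w * b j w) + err j) ->
  s * \int[P]_w (I w * \prod_(j < N) a j w) <=
  s * \int[P]_w (I w * \prod_(j < N) b j w) + \sum_(j < N) err j.
Proof.
move=> M1 a01 b01 ma mb bma step.
have M0 : 0 <= M by exact: le_trans ler01 M1.
(* Hybrid products: the factors below [k] have been replaced, at the cost of the first [k]
   errors. *)
suff H k : (k <= N)%N ->
    s * \int[P]_w (I w * \prod_(0 <= j < N) a j w) <=
    s * \int[P]_w (I w * (\prod_(0 <= j < k) b j w * \prod_(k <= j < N) a j w))
    + \sum_(0 <= j < k) err j.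
  have := H N (leqnn N); rewrite [X in _ <= _ + X]big_mkord.
  under eq_Rintegral do rewrite big_mkord.
  have -> : \int[P]_w (I w * (\prod_(0 <= j < N) b j w * \prod_(N <= j < N) a j w)) =
      \int[P]_w (I w * \prod_(j < N) b j w).
    by apply: eq_Rintegral => w _; rewrite [X in _ * (_ * X)]big_geq// mulr1 big_mkord.
  by [].
elim: k => [_|k IH kN].
  rewrite [X in _ <= _ + X]big_geq// addr0.
  have -> // : \int[P]_w (I w * (\prod_(0 <= j < 0) b j w * \prod_(0 <= j < N) a j w)) =
      \int[P]_w (I w * \prod_(0 <= j < N) a j w).
  by apply: eq_Rintegral => w _; rewrite [X in _ * (X * _)]big_geq// mul1r.
apply: (le_trans (IH (ltnW kN))); rewrite [X in _ <= _ + X]big_nat_recr//=.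
rewrite [X in _ <= _ + X]addrC addrA lerD2r.
pose f w := I w * (\prod_(0 <= j < k) b j w * \prod_(k.+1 <= j < N) a j w).
have bmb j : bm (b j).
  split; first exact: (@measurable_sub _ _ _ _ _ gap pos (inr 0%N)).
  by exists M => w; have /andP[h1 h2] := b01 j w; rewrite ger0_norm.
have := step k f kN _ _ _.
rewrite (_ : \int[P]_w (f w * a k w) = \int[P]_w (I w *
    (\prod_(0 <= j < k) b j w * \prod_(k <= j < N) a j w))); last first.
  by apply: eq_Rintegral => w _; rewrite /f [in RHS](big_ltn kN); ring.
rewrite (_ : \int[P]_w (f w * b k w) = \int[P]_w (I w *
    (\prod_(0 <= j < k.+1) b j w * \prod_(k.+1 <= j < N) a j w))); last first.
  by apply: eq_Rintegral => w _; rewrite /f [in RHS]big_nat_recr//=; ring.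
apply.
- apply: measurable_funM; first exact: measurable_I_sub.
  apply: measurable_funM; apply: (@measurable_prod _ (sub (inr k))) => j.
    by move=> _; exact: mb.
  by rewrite mem_index_iota => /andP[kj jN]; apply: ma; rewrite kj jN.
- by apply: bmM => //; apply: bmM; apply: bm_prod => j _; [exact: bmb|exact: bma].
- move=> w; have /andP[I0 I1] := I01 w.
  have prodM (h : nat -> T -> R) (r : seq nat) : (forall j w, 0 <= h j w <= M) ->
      0 <= \prod_(j <- r) h j w <= M ^+ size r.
    move=> hM; elim: r => [|j r /andP[r0 r1]].
      by rewrite big_nil expr0 ler01 lexx.
    have /andP[h0 h1] := hM j w.
    by rewrite big_cons mulr_ge0//= exprS ler_pM.
  have /andP[b0 b1] := prodM b (index_iota 0 k) b01.
  have /andP[a0 a1] := prodM a (index_iota k.+1 N) a01.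
  apply/andP; split; first by rewrite /f !mulr_ge0.
  apply: ler_wpM2l => //; apply: (@le_trans _ _ (M ^+ k * M ^+ (N - k.+1))).
    by apply: ler_pM => //; [move: b1|move: a1]; rewrite size_iota ?subn0.
  have kN' : (k + (N - k.+1) <= N)%N by clear -kN; lia.
  by rewrite -exprD; exact: ler_weXn2l.
Qed.

Lemma expectation_edge_prob_fin (f : T -> R) (k m n : nat) :
  m != n -> (k == m) || (k == n) ->
  measurable_fun setT (f : sub (inr k) -> R) -> (forall w, 0 <= f w) ->
  \int[P]_w (f w * w_ m n w) = \int[P]_w (f w * p_ m n w).
Proof.
by move=> mn kmn mf f0; congr fine; exact: (expectation_edge_prob d_ge1 beta_gt0 phiP G mn kmn).
Qed.

(** The position of m < n occurs in the m-th factor only, so each replacement is exact and the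
    errors are 0. The bound [-1 <= c] keeps the factors nonnegative. *)
Lemma expectation_prod_edges (c : R) (n : nat) : -1 <= c ->
  \int[P]_w (I w * \prod_(m < n) (1 + c * w_ m n w)) =
  \int[P]_w (I w * \prod_(m < n) (1 + c * p_ m n w)).
Proof.
move=> c1.
have M1 : 1 <= 1 + `|c| by rewrite lerDl.
have rng (x : R) : 0 <= x <= 1 -> 0 <= 1 + c * x <= 1 + `|c|.
  move=> /andP[x0 x1]; apply/andP; split; first by nra.
  by rewrite lerD2l; apply: (le_trans (ler_norm _)); rewrite normrM (ger0_norm x0) ler_piMr.
(* Used for s = 1 and s = -1, which gives the two inequalities. *)
have main s : \sum_(j < n) (0 : R) = 0 ->
    s * \int[P]_w (I w * \prod_(m < n) (1 + c * w_ m n w)) <=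
    s * \int[P]_w (I w * \prod_(m < n) (1 + c * p_ m n w)).
  move=> s0; rewrite -[leRHS]addr0 -s0.
  apply: (@expectation_replace_factors n (fun m w => 1 + c * w_ m n w)
    (fun m w => 1 + c * p_ m n w) s (1 + `|c|) (fun=> 0)) => //.
  - by move=> j w; apply: rng; exact: (edge_prob01 beta_gt0 phiP G).
  - by move=> j w; apply: rng; exact: (mean_edge01 d_ge1 beta_gt0 phiP G).
  - move=> i j /andP[ji iN]; apply: measurable_funD => //; apply: measurable_funM => //.
    by apply: (measurable_edge_prob_sub beta_gt0 phiP G); lia.
  - move=> i j; apply: measurable_funD => //; apply: measurable_funM => //.
    exact: (measurable_mean_edge_sub beta_gt0 phiP G).
  - move=> j; apply: bmD; first exact: bm_cst.
    by apply: bmM; [exact: bm_cst|exact: bm_edge_prob].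
  - move=> j f jn mf bf f01; rewrite addr0.
    suff -> : \int[P]_w (f w * (1 + c * w_ j n w)) = \int[P]_w (f w * (1 + c * p_ j n w)) by [].
    have E h : bm h -> \int[P]_w (f w * (1 + c * h w)) =
        \int[P]_w f w + c * \int[P]_w (f w * h w).
      move=> bh; have bfh := bmM bf bh.
      rewrite -bm_EFZ// -bm_EFD//; last by apply: bmM => //; exact: bm_cst.
      by apply: eq_Rintegral => w _; ring.
    rewrite !E; [|exact: bm_mean_edge|exact: bm_edge_prob].
    rewrite (expectation_edge_prob_fin (k := j))//; first by lia.
    by rewrite eqxx.
    by move=> w; have /andP[] := f01 w.
have s0 : \sum_(j < n) (0 : R) = 0 by rewrite big1.
apply/eqP; rewrite eq_le; have := main 1 s0; rewrite !mul1r => ->.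
by have := main (-1) s0; rewrite !mulN1r lerN2.
Qed.

(** Here the positions of n and n' are averaged, each of which enters a single factor, instead of
    that of j, which enters both. *)
Lemma expectation_edge_prob2 (j n n' : nat) : (j < n < n')%N ->
  \int[P]_w (I w * (w_ j n w * w_ j n' w)) =
  \int[P]_w (I w * (p_ j n w * p_ j n' w)).
Proof.
move=> /andP[jn nn'].
transitivity (\int[P]_w ((I w * w_ j n' w) * w_ j n w)).
  by apply: eq_Rintegral => w _; rewrite mulrA mulrAC.
have w0 m k w : 0 <= w_ m k w by have /andP[] := edge_prob01 beta_gt0 phiP G m k w.
have p0 m k w : 0 <= p_ m k w by have /andP[] := mean_edge01 d_ge1 beta_gt0 phiP G m k w.
have I0 w : 0 <= I w by have /andP[] := I01 w.
rewrite (expectation_edge_prob_fin (k := n)); last 4 first.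
- by lia.
- by rewrite eqxx orbT.
- apply: measurable_funM; first exact: measurable_I_sub.
  by apply: (measurable_edge_prob_sub beta_gt0 phiP G); lia.
- by move=> w; rewrite mulr_ge0.
transitivity (\int[P]_w ((I w * p_ j n w) * w_ j n' w)).
  by apply: eq_Rintegral => w _; rewrite mulrAC.
rewrite (expectation_edge_prob_fin (k := n')); last 4 first.
- by lia.
- by rewrite eqxx orbT.
- apply: measurable_funM; first exact: measurable_I_sub.
  exact: (measurable_mean_edge_sub beta_gt0 phiP G).
- by move=> w; rewrite mulr_ge0.
by apply: eq_Rintegral => w _; rewrite mulrA.
Qed.

(* The correction term is due to the older vertices m < n, whose positions enter
   both products. *)
Lemma expectation_prod_edges2 (c : R) (n n' : nat) : -1 <= c <= 0 -> (n < n')%N ->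
  \int[P]_w (I w * (\prod_(m < n) (1 + c * w_ m n w) *
                    \prod_(m < n') (1 + c * w_ m n' w))) <=
  \int[P]_w (I w * (\prod_(m < n) (1 + c * p_ m n w) *
                    \prod_(m < n') (1 + c * p_ m n' w))) +
  \sum_(m < n) \int[P]_w (I w * (p_ m n w * p_ m n' w)).
Proof.
move=> c01 nn'.
(* Extending the shorter product by trivial factors up to n' lets both products be indexed by the
   position to be averaged. *)
pose u j w := if (j < n)%N then w_ j n w else 0.
pose v j w := if (j < n)%N then p_ j n w else 0.
pose a j w := (1 + c * u j w) * (1 + c * w_ j n' w).
pose b j w := (1 + c * v j w) * (1 + c * p_ j n' w).
pose err j := if (j < n)%N then \int[P]_w (I w * (p_ j n w * p_ j n' w)) else 0.
have u01 j w : 0 <= u j w <= 1.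
  by rewrite /u; case: ifP; rewrite ?(edge_prob01 beta_gt0 phiP G)// lexx ler01.
have v01 j w : 0 <= v j w <= 1.
  by rewrite /v; case: ifP; rewrite ?(mean_edge01 d_ge1 beta_gt0 phiP G)// lexx ler01.
have bmu j : bm (u j) by rewrite /u; case: (j < n)%N; [exact: bm_edge_prob|exact: bm_cst].
have bmv j : bm (v j) by rewrite /v; case: (j < n)%N; [exact: bm_mean_edge|exact: bm_cst].
have widen (f : nat -> R) (g : nat -> R) :
    \prod_(m < n) (1 + c * f m) * \prod_(m < n') (1 + c * g m) =
    \prod_(m < n') ((1 + c * (if (m < n)%N then f m else 0)) * (1 + c * g m)).
  rewrite big_split /= (big_ord_widen n' (fun m => 1 + c * f m) (ltnW nn')).
  rewrite [in LHS]big_mkcond /=; congr (_ * _); apply: eq_bigr => m _.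
  by case: ifP => // _; rewrite mulr0 addr0.
have := @expectation_replace_factors n' a b 1 1 err (lexx _).
rewrite !mul1r.
have -> : \int[P]_w (I w * \prod_(j < n') a j w) =
  \int[P]_w (I w * (\prod_(m < n) (1 + c * w_ m n w) *
                    \prod_(m < n') (1 + c * w_ m n' w))).
  by apply: eq_Rintegral => w _; rewrite (widen (w_ ^~ n ^~ w) (w_ ^~ n' ^~ w)).
have -> : \int[P]_w (I w * \prod_(j < n') b j w) =
  \int[P]_w (I w * (\prod_(m < n) (1 + c * p_ m n w) *
                    \prod_(m < n') (1 + c * p_ m n' w))).
  by apply: eq_Rintegral => w _; rewrite (widen (p_ ^~ n ^~ w) (p_ ^~ n' ^~ w)).
have -> : \sum_(j < n') err j = \sum_(m < n) \int[P]_w (I w * (p_ m n w * p_ m n' w)).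
  rewrite (big_ord_widen n' (fun m => \int[P]_w (I w * (p_ m n w * p_ m n' w))) (ltnW nn')).
  by rewrite [RHS]big_mkcond.
have rng2 (x y : R) : 0 <= x <= 1 -> 0 <= y <= 1 -> 0 <= (1 + c * x) * (1 + c * y) <= 1.
  move=> /andP[x0 x1] /andP[y0 y1]; move: c01 => /andP[c0 c1].
  have h1 : 0 <= 1 + c * x <= 1 by nra.
  have h2 : 0 <= 1 + c * y <= 1 by nra.
  by move: h1 h2 => /andP[? ?] /andP[? ?]; rewrite mulr_ge0//= mulr_ile1.
apply.
- by move=> j w; apply: rng2; rewrite ?u01 ?(edge_prob01 beta_gt0 phiP G).
- by move=> j w; apply: rng2; rewrite ?v01 ?(mean_edge01 d_ge1 beta_gt0 phiP G).
(* Factor i involves the positions of i, of n' and, only if i < n, of n. None of them is j when j <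
   i < n'; in particular, position n is averaged only after all factors with i < n have been
   replaced. *)
- move=> i j ji; apply: measurable_funM; apply: measurable_funD => //;
    apply: measurable_funM => //.
    rewrite /u; case: (boolP (i < n)%N) => // iN.
    by apply: (measurable_edge_prob_sub beta_gt0 phiP G); lia.
  by apply: (measurable_edge_prob_sub beta_gt0 phiP G); lia.
- move=> i j; apply: measurable_funM; apply: measurable_funD => //;
    apply: measurable_funM => //.
    rewrite /v; case: (boolP (i < n)%N) => // iN.
    exact: (measurable_mean_edge_sub beta_gt0 phiP G).
  exact: (measurable_mean_edge_sub beta_gt0 phiP G).
- move=> j; apply: bmM; apply: bmD; try exact: bm_cst;
    apply: bmM; try exact: bm_cst; [exact: bmu|exact: bm_edge_prob].
- move=> j f jn' mf bf f01; rewrite !mul1r.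
  have f0 w : 0 <= f w by have /andP[] := f01 w.
  have E x y : bm x -> bm y -> \int[P]_w (f w * ((1 + c * x w) * (1 + c * y w))) =
      \int[P]_w f w + c * \int[P]_w (f w * x w) + c * \int[P]_w (f w * y w) +
      c ^+ 2 * \int[P]_w (f w * (x w * y w)).
    move=> bx bY; have bfx := bmM bf bx; have bfy := bmM bf bY.
    have bfxy := bmM bf (bmM bx bY).
    have bc (h : T -> R) k : bm h -> bm (fun w => k * h w).
      by move=> bh; apply: bmM => //; exact: bm_cst.
    have b1 := bc _ c bfx; have b2 := bc _ c bfy; have b3 := bc _ (c ^+ 2) bfxy.
    rewrite -!bm_EFZ// -(bm_EFD P bf b1) -(bm_EFD P (bmD bf b1) b2).
    rewrite -(bm_EFD P (bmD (bmD bf b1) b2) b3).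
    by apply: eq_Rintegral => w _; ring.
  rewrite (E (u j) (w_ j n')) ?(E (v j) (p_ j n'))//; last 2 first.
  - exact: bm_mean_edge.
  - exact: bm_edge_prob.
  have -> : \int[P]_w (f w * w_ j n' w) = \int[P]_w (f w * p_ j n' w).
    by apply: (expectation_edge_prob_fin (k := j)) => //; [lia|rewrite eqxx].
  have -> : \int[P]_w (f w * u j w) = \int[P]_w (f w * v j w).
    rewrite /u /v; case: (boolP (j < n)%N) => // jn.
    by apply: (expectation_edge_prob_fin (k := j)) => //; [lia|rewrite eqxx].
  (* The constant and linear terms agree exactly. The quadratic terms are nonnegative, and the one
     to be bounded is at most [err j] because [f <= I]; finally [c ^+ 2 <= 1]. *)
  rewrite -!addrA !lerD2l.
  have vp0 : 0 <= \int[P]_w (f w * (v j w * p_ j n' w)).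
    apply: Rintegral_ge0 => w _; apply: mulr_ge0 => //; apply: mulr_ge0.
      by have /andP[] := v01 j w.
    by have /andP[] := mean_edge01 d_ge1 beta_gt0 phiP G j n' w.
  have uw_le : \int[P]_w (f w * (u j w * w_ j n' w)) <= err j.
    rewrite /err /u; case: (boolP (j < n)%N) => jn; last first.
      under eq_Rintegral do rewrite mul0r mulr0.
      by rewrite bm_EF_cst.
    rewrite -expectation_edge_prob2 ?jn//; apply: bm_EF_le.
    - by apply: bmM => //; apply: bmM; exact: bm_edge_prob.
    - by apply: bmM => //; apply: bmM; exact: bm_edge_prob.
    - move=> w; apply: ler_wpM2r; last first.
        by have /andP[_] := f01 w; rewrite expr1n mulr1.
      by apply: mulr_ge0; [have /andP[] := edge_prob01 beta_gt0 phiP G j n w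
          |have /andP[] := edge_prob01 beta_gt0 phiP G j n' w].
  have uw0 : 0 <= \int[P]_w (f w * (u j w * w_ j n' w)).
    apply: Rintegral_ge0 => w _; apply: mulr_ge0 => //; apply: mulr_ge0.
      by have /andP[] := u01 j w.
    by have /andP[] := edge_prob01 beta_gt0 phiP G j n' w.
  have c2 : 0 <= c ^+ 2 <= 1.
    by rewrite sqr_ge0 /= expr2; move: c01 => /andP[? ?]; nra.
  by move: c2 => /andP[? ?]; nra.
Qed.

End edge_expectations.

(** * Sums of mean edge probabilities *)

Section power_sums.
Variable R : realType.
Implicit Types (g x y e : R) (n m : nat).

Lemma powRD_gt0 x (r s : R) : 0 < x -> x `^ (r + s) = x `^ r * x `^ s.
Proof. by move=> x0; rewrite powRD// (gt_eqF x0) implybT. Qed.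

Lemma powRB1_gt0 x (r : R) : 0 < x -> x `^ (r - 1) = x `^ r / x.
Proof. by move=> x0; rewrite powRD_gt0// powR_inv1 ?ltW. Qed.

Lemma powR_natN_le1 g m : 0 <= g -> (m.+1%:R : R) `^ (- g) <= 1.
Proof.
move=> g0; have : (m.+1%:R : R) `^ (- g) <= m.+1%:R `^ 0.
  by apply: ler_powR; rewrite ?ler1n// oppr_le0.
by rewrite powRr0.
Qed.

(** Young's inequality for the exponents 1/(1-g) and 1/g. Applied to neighbouring integers, it
    replaces derivatives of x^(1-g). *)
Lemma weighted_AM_GM g x y : 0 < g < 1 -> 0 <= x -> 0 <= y ->
  x `^ (1 - g) * y `^ g <= (1 - g) * x + g * y.
Proof.
move=> /andP[g0 g1] x0 y0.
have g1' : 0 < 1 - g by rewrite subr_gt0.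
have := @conjugate_powR R (x `^ (1 - g)) (y `^ g) (1 - g)^-1 g^-1
  (powR_ge0 _ _) (powR_ge0 _ _).
rewrite !invr_gt0 !invrK => /(_ g1' g0); rewrite subrK => /(_ erefl).
by rewrite -!powRrM !mulfV ?gt_eqF// !powRr1// [x * _]mulrC [y * _]mulrC.
Qed.

(** Concavity of x^(1-g): its tangent at n+1 lies above the value at n and, in the companion bound,
    above the value at n+2. This is the weighted mean inequality divided by (n+1)^g. *)
Lemma powR_step_lower g n : 0 < g < 1 ->
  (1 - g) * n.+1%:R `^ (- g) <= n.+1%:R `^ (1 - g) - n%:R `^ (1 - g) :> R.
Proof.
move=> g01; have n0 : 0 < n.+1%:R :> R by rewrite ltr0n.
have := weighted_AM_GM g01 (ler0n R n) (ltW n0).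
have ng : 0 < n.+1%:R `^ g :> R by exact: powR_gt0.
rewrite -ler_pdivlMr// => h; rewrite lerBrDl; apply: (le_trans (lerD h (lexx _))).
have -> : n.+1%:R `^ (1 - g) = n.+1%:R / n.+1%:R `^ g :> R.
  by rewrite powRB ?pnatr_eq0 ?implybT// powRr1.
rewrite powRN -mulrDl ler_pM2r ?invr_gt0//.
by rewrite -natr1; lra.
Qed.

Lemma powR_step_upper g n : 0 < g < 1 ->
  n.+2%:R `^ (1 - g) - n.+1%:R `^ (1 - g) <= (1 - g) * n.+1%:R `^ (- g) :> R.
Proof.
move=> g01; have n0 : 0 < n.+1%:R :> R by rewrite ltr0n.
have := weighted_AM_GM g01 (ler0n R n.+2) (ltW n0).
have ng : 0 < n.+1%:R `^ g :> R by exact: powR_gt0.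
rewrite -ler_pdivlMr// => h; rewrite lerBlDr; apply: (le_trans h).
have -> : n.+1%:R `^ (1 - g) = n.+1%:R / n.+1%:R `^ g :> R.
  by rewrite powRB ?pnatr_eq0 ?implybT// powRr1.
rewrite powRN -mulrDl ler_pM2r ?invr_gt0//.
by rewrite -natr1; lra.
Qed.

Lemma power_sum_upper g n : 0 < g < 1 ->
  (1 - g) * \sum_(m < n) m.+1%:R `^ (- g) <= n.+1%:R `^ (1 - g) :> R.
Proof.
move=> g01; apply: (@le_trans _ _ (n%:R `^ (1 - g))); last first.
  apply: ge0_ler_powR; rewrite ?nnegrE ?ler0n// ?ler_nat//.
  by move: g01 => /andP[_ g1]; rewrite subr_ge0 ltW.
elim: n => [|n IH]; first by rewrite big_ord0 mulr0 powR_ge0.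
by rewrite big_ord_recr /= mulrDr; have := powR_step_lower n g01; lra.
Qed.

Lemma power_sum_lower g n : 0 < g < 1 ->
  n.+1%:R `^ (1 - g) - 1 <= (1 - g) * \sum_(m < n) m.+1%:R `^ (- g) :> R.
Proof.
move=> g01; elim: n => [|n IH]; first by rewrite big_ord0 mulr0 powR1 subrr.
by rewrite big_ord_recr /= mulrDr; have := powR_step_upper n g01; lra.
Qed.

Lemma cvg_powR_natN g : 0 < g -> n.+1%:R `^ (- g) @[n --> \oo] --> (0 : R).
Proof.
move=> g0; apply/cvgrPdist_le => e e0; near=> n.
rewrite sub0r normrN ger0_norm ?powR_ge0// powRN -[leRHS]invrK lef_pV2 ?posrE//.
- have -> : e^-1 = (e^-1 `^ g^-1) `^ g.
    by rewrite -powRrM mulVf ?gt_eqF// powRr1// invr_ge0 ltW.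
  apply: ge0_ler_powR; rewrite ?nnegrE ?powR_ge0//; first exact: ltW.
  apply: (@le_trans _ _ n%:R); last by rewrite ler_nat.
  by near: n; exact: nbhs_infty_ger.
- by rewrite invr_gt0.
Unshelve. all: by end_near. Qed.

Lemma power_sum_cvg g : 0 < g < 1 ->
  n.+1%:R `^ (g - 1) * \sum_(m < n) m.+1%:R `^ (- g) @[n --> \oo] --> ((1 - g)^-1 : R).
Proof.
move=> g01; have /andP[g0 g1] := g01.
have g1' : 0 < 1 - g by rewrite subr_gt0.
have gE : g - 1 = - (1 - g) by rewrite opprB.
apply: (@squeeze_cvgr _ _ _ _ (fun n => (1 - n.+1%:R `^ (g - 1)) / (1 - g)) (fun=> (1 - g)^-1)).
- near=> n; set S := \sum_(_ < _) _.
  have n0 : 0 < n.+1%:R `^ (1 - g) :> R by rewrite powR_gt0.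
  have lo := power_sum_lower n g01; have up := power_sum_upper n g01.
  rewrite -/S in lo up; rewrite gE powRN.
  apply/andP; split.
    rewrite ler_pdivrMr// -(ler_pM2l n0) mulrBr mulr1 mulfV ?gt_eqF//.
    by rewrite !mulrA mulfV ?gt_eqF// mul1r mulrC.
  rewrite -(ler_pM2l n0) !mulrA mulfV ?gt_eqF// mul1r ler_pdivlMr//.
  by rewrite mulrC.
- rewrite -[X in _ --> X]mul1r; apply: cvgM; last exact: cvg_cst.
  rewrite -[X in _ --> X]subr0; apply: cvgB; first exact: cvg_cst.
  by rewrite gE; exact: cvg_powR_natN.
- exact: cvg_cst.
Unshelve. all: by end_near. Qed.

(** A Toeplitz argument: the weights (n+1)^(g-1) (m+1)^(-g) have bounded total mass and each tends
    to 0 in n. The first M terms, where [f] is merely bounded, disappear, and in the others [f] is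
    uniformly close to 1. *)
Lemma weighted_power_sum_cvg g (f : nat -> nat -> R) (C : R) : 0 < g < 1 ->
  (forall m n, (m < n)%N -> `|f m n| <= C) ->
  (forall e, 0 < e -> exists M, forall m n, (M <= m < n)%N -> `|f m n - 1| <= e) ->
  n.+1%:R `^ (g - 1) * \sum_(m < n) m.+1%:R `^ (- g) * f m n @[n --> \oo]
    --> ((1 - g)^-1 : R).
Proof.
move=> g01 fC f1; have /andP[g0 g1] := g01.
have g1' : 0 < 1 - g by rewrite subr_gt0.
have gE : g - 1 = - (1 - g) by rewrite opprB.
pose L := (1 - g)^-1; have L0 : 0 < L by rewrite invr_gt0.
rewrite -[X in _ --> X]addr0.
rewrite (_ : (fun n => _) = (fun n =>
   n.+1%:R `^ (g - 1) * \sum_(m < n) m.+1%:R `^ (- g) +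
   n.+1%:R `^ (g - 1) * \sum_(m < n) m.+1%:R `^ (- g) * (f m n - 1))); last first.
  apply/funext => n; rewrite -mulrDr -big_split/=; congr (_ * _).
  by apply: eq_bigr => m _; rewrite mulrBr mulr1 addrC subrK.
apply: cvgD; first exact: power_sum_cvg.
apply/cvgrPdist_le => e e0.
have e2 : 0 < e / 2 / L by rewrite !divr_gt0.
have [M HM] := f1 _ e2.
have C0 : 0 <= `|C| + 1 by rewrite addr_ge0.
(* The 1 added to the denominator keeps it positive when M = 0. *)
have /cvgrPdist_le/(_ (e / 2 / (M%:R * (`|C| + 1) + 1))) := cvg_powR_natN g1'.
rewrite -gE => small.
near=> n.
have a0 : 0 <= n.+1%:R `^ (g - 1) :> R by exact: powR_ge0.
rewrite sub0r normrN normrM (ger0_norm a0).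
have bnd : \sum_(m < n) m.+1%:R `^ (- g) * `|f m n - 1| <=
    M%:R * (`|C| + 1) + e / 2 / L * \sum_(m < n) m.+1%:R `^ (- g).
  rewrite mulr_sumr.
  have -> : M%:R * (`|C| + 1) = \sum_(m < M) (`|C| + 1).
    by rewrite sumr_const card_ord -[in RHS]mulr_natl.
  apply: (@le_trans _ _ (\sum_(m < n) ((if (m < M)%N then `|C| + 1 else 0) +
      e / 2 / L * m.+1%:R `^ (- g)))).
    apply: ler_sum => m _.
    have m1 : 0 < (m.+1%:R : R) `^ (- g) <= 1.
      by rewrite powR_gt0//= powR_natN_le1// ltW.
    case: ltnP => mM.
      have h1 : `|f m n - 1| <= `|C| + 1.
        apply: (le_trans (ler_normB _ _)); rewrite normr1 lerD2r.
        by apply: (le_trans (fC _ _ (ltn_ord m))); exact: ler_norm.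
      move: m1 => /andP[m0 m1]; apply: (@le_trans _ _ (`|C| + 1)).
        by rewrite -[leRHS]mul1r ler_pM// ltW.
      by rewrite lerDl mulr_ge0// ltW.
    rewrite add0r mulrC ler_pM2r; last by have /andP[] := m1.
    by apply: HM; rewrite mM ltn_ord.
  rewrite big_split /= lerD2r -big_mkcond /=.
  case: (leqP n M) => nM.
    apply: (@le_trans _ _ (\sum_(i < n) (`|C| + 1))).
      by rewrite [leLHS]big_mkcond/=; apply: ler_sum => i _; case: ifP.
    by rewrite !sumr_const !card_ord -!(mulr_natl (`|C| + 1)) ler_wpM2r// ler_nat.
  by rewrite (big_ord_narrow (ltnW nM)).
apply: (@le_trans _ _ (n.+1%:R `^ (g - 1) *
   (M%:R * (`|C| + 1) + e / 2 / L * \sum_(m < n) m.+1%:R `^ (- g)))).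
  apply: ler_wpM2l => //; apply: le_trans bnd.
  apply: (le_trans (ler_norm_sum _ _ _)); apply: ler_sum => m _.
  by rewrite normrM ger0_norm// powR_ge0.
have D0 : 0 < M%:R * (`|C| + 1) + 1 by rewrite ltr_wpDl// mulr_ge0.
have s1 : n.+1%:R `^ (g - 1) <= e / 2 / (M%:R * (`|C| + 1) + 1).
  have : `|0 - n.+1%:R `^ (g - 1)| <= e / 2 / (M%:R * (`|C| + 1) + 1).
    by near: n; apply: small; rewrite !divr_gt0.
  by rewrite sub0r normrN ger0_norm.
have s2 : n.+1%:R `^ (g - 1) * \sum_(m < n) m.+1%:R `^ (- g) <= L.
  have n0 : 0 < n.+1%:R `^ (1 - g) :> R by rewrite powR_gt0.
  rewrite gE powRN -(ler_pM2l n0) !mulrA mulfV ?gt_eqF// mul1r ler_pdivlMr//.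
  by rewrite mulrC; exact: power_sum_upper.
rewrite mulrDr (mulrCA _ (e / 2 / L)).
rewrite [leRHS](_ : e = e / 2 + e / 2); last by lra.
apply: lerD; last first.
  apply: (le_trans (ler_wpM2l (ltW e2) s2)).
  by rewrite divfK ?gt_eqF.
apply: (le_trans (ler_wpM2r _ s1)); first by rewrite mulr_ge0.
rewrite mulrAC ler_pdivrMr//; apply: ler_wpM2l; first by rewrite divr_ge0// ltW.
by rewrite lerDl.
Unshelve. all: by end_near. Qed.

(** One factor is exchanged at a time, the others being at most 1. *)
Lemma prod_diff_le n (a b : nat -> R) :
  (forall i, 0 <= a i <= 1) -> (forall i, 0 <= b i <= 1) ->
  `|\prod_(i < n) a i - \prod_(i < n) b i| <= \sum_(i < n) `|a i - b i|.
Proof.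
move=> a01 b01; elim: n => [|n IH]; first by rewrite !big_ord0 subrr normr0.
rewrite !big_ord_recr /=.
have pr (f : nat -> R) : (forall i, 0 <= f i <= 1) -> 0 <= \prod_(i < n) f i <= 1.
  move=> f01; apply/andP; split; first by apply: prodr_ge0 => i _; case/andP: (f01 i).
  elim: n {IH} => [|k IHk]; first by rewrite big_ord0.
  rewrite big_ord_recr /= mulr_ile1//; [|by case/andP: (f01 k)..].
  by apply: prodr_ge0 => i _; case/andP: (f01 i).
set A := \prod_(i < n) a i in IH *; set B := \prod_(i < n) b i in IH *.
have -> : A * a n - B * b n = (A - B) * a n + B * (a n - b n) by ring.
apply: (le_trans (ler_normD _ _)); apply: lerD.
  rewrite normrM; apply: le_trans IH; rewrite -[leRHS]mulr1; apply: ler_wpM2l => //.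
  by have /andP[? ?] := a01 n; rewrite ger0_norm.
rewrite normrM -[leRHS]mul1r; apply: ler_wpM2r => //.
by have /andP[? ?] := pr b b01; rewrite ger0_norm.
Qed.

(** The nontrivial side is exp(-x) <= 1/(1+x) <= 1 - x + x^2. *)
Lemma expR_linear_error x : 0 <= x <= 1 -> `|1 - x - expR (- x)| <= x ^+ 2.
Proof.
move=> /andP[x0 x1]; have lo := expR_ge1Dx (- x).
rewrite ler0_norm; last by lra.
have up : expR (- x) <= (1 + x)^-1.
  rewrite expRN lef_pV2 ?posrE ?expR_gt0//; last by lra.
  exact: expR_ge1Dx.
have : (1 + x)^-1 <= 1 - x + x ^+ 2.
  rewrite -[leLHS]mul1r ler_pdivrMr; last by lra.
  have -> : (1 - x + x ^+ 2) * (1 + x) = 1 + x ^+ 3 by ring.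
  by rewrite lerDl exprn_ge0.
by lra.
Qed.

(** * Deterministic sums along a sequence of birth times *)

Section birth_sums.
Variables (g beta : R) (h : R -> R) (t : nat -> R).
Hypotheses (g01 : 0 < g < 1) (beta0 : 0 < beta).
Hypothesis h_ge0 : forall c, 0 < c -> 0 <= h c.
Hypothesis h_le : forall c, 0 < c -> c * h c <= 1.
Hypothesis h_cvg : forall e, 0 < e ->
  exists M, forall c, 0 < c -> M <= c -> 1 - e <= c * h c.
Hypothesis t_gt0 : forall n, 0 < t n.

(** For a fixed outcome, [t] stands for the birth times, [h] for [edge_mean] and [sc] for
    [edge_scale]. *)
Let sc m n := t n / (beta * (t n / t m) `^ g).

Let sc_gt0 m n : 0 < sc m n.
Proof. by rewrite divr_gt0// mulr_gt0// powR_gt0// divr_gt0. Qed.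

Let g0 : 0 < g. Proof. by case/andP: g01. Qed.
Let g1 : g < 1. Proof. by case/andP: g01. Qed.

Lemma scale_le_inv m n : h (sc m n) <= (sc m n)^-1.
Proof. by rewrite -[leRHS]mul1r ler_pdivlMr// mulrC h_le. Qed.

Let scE m n : (sc m n)^-1 = beta * t n `^ (g - 1) * t m `^ (- g).
Proof.
rewrite /sc invf_div powRM ?ltW// ?invr_gt0//.
have -> : (t m)^-1 `^ g = t m `^ (- g).
  by rewrite -powR_inv1 ?ltW// -powRrM mulN1r.
by rewrite powRB1_gt0// [in LHS]mulrA mulrAC [in RHS]mulrA.
Qed.

(** The exponents g - 1 and -g are both negative, so a lower bound on [t] gives an upper bound here;
    the powers K^(1-g) and K^g combine to K. *)
Lemma scale_inv_bound (K : R) m n : 0 < K ->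
  (forall k, k.+1%:R / K <= t k) ->
  (sc m n)^-1 <= beta * K * n.+1%:R `^ (g - 1) * m.+1%:R `^ (- g).
Proof.
move=> K0 Kt.
have powN (x y : R) r : 0 < x -> x <= y -> 0 <= r -> y `^ (- r) <= x `^ (- r).
  move=> x0 xy r0; rewrite !powRN lef_pV2 ?posrE ?powR_gt0//; last exact: lt_le_trans xy.
  by apply: ge0_ler_powR; rewrite // nnegrE ltW// (lt_le_trans x0).
have KN r k : (k.+1%:R / K) `^ (- r) = K `^ r * k.+1%:R `^ (- r) :> R.
  rewrite powRM ?invr_ge0 ?ltW// mulrC; congr (_ * _).
  by rewrite -powR_inv1 ?ltW// -powRrM mulN1r opprK.
have -> : beta * K * n.+1%:R `^ (g - 1) * m.+1%:R `^ (- g) =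
    beta * (n.+1%:R / K) `^ (g - 1) * (m.+1%:R / K) `^ (- g).
  have KK : K `^ (1 - g) * K `^ g = K by rewrite -powRD_gt0// subrK powRr1 ?ltW.
  by rewrite -(opprB 1 g) !KN -[X in beta * X * _ * _]KK; ring.
rewrite scE; apply: ler_pM; rewrite ?mulr_ge0 ?powR_ge0 ?(ltW beta0)//.
  apply: ler_wpM2l; first exact: ltW.
  by rewrite -(opprB 1 g); apply: powN; rewrite ?divr_gt0// subr_ge0 ltW.
by apply: powN; rewrite ?divr_gt0// (ltW g0).
Qed.

Lemma mean_degree_bound (K : R) n : 0 < K -> (forall k, k.+1%:R / K <= t k) ->
  \sum_(m < n) h (sc m n) <= beta * K / (1 - g).
Proof.
move=> K0 Kt; have g1' : 0 < 1 - g by rewrite subr_gt0.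
apply: (@le_trans _ _ (\sum_(m < n) beta * K * n.+1%:R `^ (g - 1) * m.+1%:R `^ (- g))).
  by apply: ler_sum => m _; apply: (le_trans (scale_le_inv _ _)); exact: scale_inv_bound.
rewrite -mulr_sumr -mulrA ler_pM2l ?mulr_gt0//.
have n0 : 0 < n.+1%:R `^ (1 - g) :> R by rewrite powR_gt0.
rewrite -(opprB 1 g) powRN -(ler_pM2l n0) mulrA mulfV ?gt_eqF// mul1r ler_pdivlMr//.
by rewrite mulrC; exact: power_sum_upper.
Qed.

Lemma mean_edge_bound (K : R) m n : 0 < K -> (forall k, k.+1%:R / K <= t k) ->
  h (sc m n) <= beta * K * n.+1%:R `^ (g - 1).
Proof.
move=> K0 Kt; apply: (le_trans (scale_le_inv _ _)).
apply: (le_trans (scale_inv_bound _ _ K0 Kt)).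
rewrite -[leRHS]mulr1; apply: ler_wpM2l.
  by rewrite !mulr_ge0 ?powR_ge0// ltW.
by rewrite powR_natN_le1// ltW.
Qed.

Hypothesis t_cvg : t n / n.+1%:R @[n --> \oo] --> (1 : R).
Hypothesis t_le : {homo t : m n / (m <= n)%N >-> m <= n}.

Lemma linear_growth : exists2 K : R, 0 < K & forall k, k.+1%:R / K <= t k.
Proof.
have h2 : 0 < 2^-1 :> R by rewrite invr_gt0.
have /cvgrPdist_le/(_ _ h2)[N _ HN] := t_cvg.
(* The 2 serves k >= N, where t_k >= (k+1)/2; the second summand serves k < N, where t_k >= t_0 and
   k + 1 <= N. *)
pose K := 2 + N%:R / t 0%N.
have K0 : 0 < K by rewrite ltr_pwDl// divr_ge0// ltW.
exists K => // k; rewrite ler_pdivrMr//.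
have [Nk|kN] := leqP N k.
  have := HN k Nk; rewrite /= ler_norml => /andP[_].
  have k0 : 0 < k.+1%:R :> R by rewrite ltr0n.
  rewrite lerBlDr -lerBlDl ler_pdivlMr// => tk.
  apply: (@le_trans _ _ (t k * 2)); first by lra.
  by rewrite ler_pM2l// lerDl divr_ge0// ltW.
apply: (@le_trans _ _ (t 0%N * (N%:R / t 0%N))).
  by rewrite mulrCA mulfV ?gt_eqF// mulr1 ler_nat.
apply: ler_pM; [exact: ltW|by rewrite divr_ge0// ltW|exact: t_le|].
by rewrite /K lerDr.
Qed.

Let r n := t n / n.+1%:R.

Let powR_r (a : R) n : r n `^ a = t n `^ a * n.+1%:R `^ (- a).
Proof.
rewrite powRM ?invr_ge0 ?ltW//; congr (_ * _).
by rewrite -powR_inv1// -powRrM mulN1r.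
Qed.

Let r_pow_cvg (a : R) : r n `^ a @[n --> \oo] --> (1 : R).
Proof.
have c : {for (1 : R), continuous (@powR R ^~ a)}.
  apply: differentiable_continuous; apply/derivable1_diffP.
  by apply: derivable_powR; rewrite in_itv/= ltr01.
have := cvg_comp _ _ t_cvg c; rewrite powR1; exact.
Qed.

(** Each term is beta r_n^(g-1) (n+1)^(g-1) (m+1)^(-g) times a correction [f m n]. As r_n tends to
    1, and the correction to 1 as m grows, uniformly in n > m, the weighted power sum gives the
    limit. *)
Lemma mean_degree_cvg :
  \sum_(m < n) h (sc m n) @[n --> \oo] --> beta / (1 - g).
Proof.
pose f m n := r m `^ (- g) * (sc m n * h (sc m n)).
have E n : \sum_(m < n) h (sc m n) = beta * r n `^ (g - 1) *
    (n.+1%:R `^ (g - 1) * \sum_(m < n) m.+1%:R `^ (- g) * f m n).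
  rewrite !mulr_sumr; apply: eq_bigr => m _.
  have sne : sc m n != 0 by rewrite gt_eqF.
  have -> : h (sc m n) = (sc m n)^-1 * (sc m n * h (sc m n)) by rewrite mulKf.
  rewrite scE /f !powR_r !opprK.
  have e1 : n.+1%:R `^ (- (g - 1)) * n.+1%:R `^ (g - 1) = 1 :> R.
    by rewrite -powRD_gt0// addNr powRr0.
  have e2 : m.+1%:R `^ (- g) * m.+1%:R `^ g = 1 :> R.
    by rewrite -powRD_gt0// addNr powRr0.
  have alg (u v q a b c d : R) : a * b = 1 -> c * d = 1 ->
      beta * u * v * q = beta * (u * a) * (b * (c * (v * d * q))).
    move=> ab cd; transitivity (beta * u * v * q * (a * b) * (c * d)); last by ring.
    by rewrite ab cd !mulr1.
  exact: alg.
rewrite (_ : (fun n => _) = (fun n => beta * r n `^ (g - 1) *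
    (n.+1%:R `^ (g - 1) * \sum_(m < n) m.+1%:R `^ (- g) * f m n))); last first.
  exact/funext.
have -> : beta / (1 - g) = beta * 1 * (1 - g)^-1 by rewrite mulr1.
apply: cvgM; first by apply: cvgM; [exact: cvg_cst|exact: r_pow_cvg].
have rb : cvgn (fun n => r n `^ (- g)) by apply/cvg_ex; exists 1; exact: r_pow_cvg.
have [C [_ HC]] := cvg_seq_bounded rb.
pose C1 := `|C| + 1.
have rC m : r m `^ (- g) <= C1.
  have := HC C1; rewrite /C1 (le_lt_trans (ler_norm C)) ?ltrDl// => /(_ isT m I).
  by rewrite /= ger0_norm ?powR_ge0.
have C10 : 0 <= C1 by rewrite addr_ge0.
apply: (@weighted_power_sum_cvg g f C1) => //.
  move=> m n _; rewrite ger0_norm; last first.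
    by rewrite mulr_ge0 ?powR_ge0// mulr_ge0 ?h_ge0// ltW.
  rewrite -[leRHS]mulr1; apply: ler_pM; rewrite ?powR_ge0 ?h_le//.
  by rewrite mulr_ge0 ?h_ge0// ltW.
move=> e e0.
have e2 : 0 < e / 2 / C1 by rewrite !divr_gt0// ltr_wpDl.
have [M HM] := h_cvg e2.
have e3 : 0 < e / 2 by rewrite divr_gt0.
have /cvgrPdist_le/(_ _ e3)[N1 _ HN1] := r_pow_cvg (- g).
have [K K0 HK] := linear_growth.
have [N2 _ HN2] := nbhs_infty_ger (M * beta * K).
exists (maxn N1 N2) => m n /andP[+ mn]; rewrite geq_max => /andP[N1m N2m].
(* As g < 1 and t_n >= t_m, the scale is at least t_m / beta, a bound free of n that grows linearly
   in m. *)
have scM : M <= sc m n.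
  have : (sc m n)^-1 <= beta / t m.
    rewrite /sc invf_div -!mulrA ler_pM2l//.
    have q1 : 1 <= t n / t m by rewrite ler_pdivlMr// mul1r t_le// ltnW.
    apply: (@le_trans _ _ (t n / t m * (t n)^-1)).
      apply: ler_wpM2r; first by rewrite invr_ge0 ltW.
      by apply: ler1_powR => //; exact: ltW.
    by rewrite mulrAC mulfV ?gt_eqF// mul1r.
  have tb : 0 < t m / beta by rewrite divr_gt0.
  rewrite -[beta / t m]invf_div lef_pV2 ?posrE// => ts.
  apply: le_trans ts; rewrite ler_pdivlMr//; apply: le_trans (HK m).
  rewrite ler_pdivlMr//; apply: (le_trans (HN2 N2 (leqnn N2))).
  by rewrite ler_nat (leq_trans N2m).
have lo := HM _ (sc_gt0 m n) scM; have up := h_le (sc_gt0 m n).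
have := HN1 m N1m; rewrite /= distrC => near1.
have -> : f m n - 1 = (r m `^ (- g) - 1) - r m `^ (- g) * (1 - sc m n * h (sc m n)).
  by rewrite /f; ring.
apply: (le_trans (ler_normB _ _)).
rewrite [leRHS](_ : e = e / 2 + e / 2); last by lra.
apply: lerD => //.
rewrite ger0_norm ?mulr_ge0 ?powR_ge0 ?subr_ge0//.
apply: (@le_trans _ _ (C1 * (e / 2 / C1))).
  by apply: ler_pM; rewrite ?powR_ge0 ?subr_ge0//; lra.
by rewrite mulrC divfK// gt_eqF// ltr_wpDl.
Qed.

(** As [t] is nondecreasing, the inverse scale at m = 0 dominates every [h (sc m n)]. *)
Lemma max_mean_edge_cvg : (sc 0 n)^-1 @[n --> \oo] --> (0 : R).
Proof.
rewrite (_ : (fun n => _) = (fun n => beta * t 0%N `^ (- g) *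
    (r n `^ (g - 1) * n.+1%:R `^ (- (1 - g))))); last first.
  apply/funext => n; rewrite scE powR_r.
  have alg (u v a b : R) : a * b = 1 -> beta * u * v = beta * v * (u * a * b).
    by move=> ab; rewrite -[X in _ = _ * X]mulrA ab mulr1 mulrAC.
  by apply: alg; rewrite -powRD_gt0// opprB subrr powRr0.
rewrite -[X in _ --> X](mulr0 (beta * t 0%N `^ (- g))).
apply: cvgM; first exact: cvg_cst.
rewrite -(mulr0 1); apply: cvgM; first exact: r_pow_cvg.
by apply: cvg_powR_natN; rewrite subr_gt0.
Qed.

Hypothesis h_le1 : forall m n, h (sc m n) <= 1.

(** Replacing 1 - y by exp(-y) costs at most y^2 per factor, and the sum of these squares is at most
    the inverse scale at m = 0 times the mean degree, which tends to 0. *)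
Lemma prod_mean_edge_cvg (x : R) : 0 <= x <= 1 ->
  \prod_(m < n) (1 - x * h (sc m n)) @[n --> \oo] --> expR (- (x * (beta / (1 - g)))).
Proof.
move=> /andP[x0 x1].
have h01 m n : 0 <= h (sc m n) <= 1.
  by rewrite h_le1 h_ge0.
have xh01 m n : 0 <= x * h (sc m n) <= 1.
  by have /andP[? ?] := h01 m n; rewrite mulr_ge0//= mulr_ile1.
have expE n : expR (- (x * \sum_(m < n) h (sc m n))) =
    \prod_(m < n) expR (- (x * h (sc m n))).
  by rewrite mulr_sumr -sumrN expR_sum.
rewrite -[X in _ --> X]add0r.
rewrite (_ : (fun n => _) = (fun n =>
    (\prod_(m < n) (1 - x * h (sc m n)) - expR (- (x * \sum_(m < n) h (sc m n)))) +
    expR (- (x * \sum_(m < n) h (sc m n))))); last first.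
  by apply/funext => n; rewrite subrK.
apply: cvgD; last first.
  apply: continuous_cvg; first exact: continuous_expR.
  by apply: cvgN; apply: cvgM; [exact: cvg_cst|exact: mean_degree_cvg].
apply: norm_cvg0.
apply: (@squeeze_cvgr _ _ _ _ (fun=> 0)
  (fun n => (sc 0 n)^-1 * \sum_(m < n) h (sc m n))).
- near=> n; rewrite normr_ge0 /= expE.
  apply: le_trans.
    apply: (@prod_diff_le n (fun m => 1 - x * h (sc m n))
      (fun m => expR (- (x * h (sc m n))))) => m.
      by have /andP[? ?] := xh01 m n; lra.
    by rewrite expR_ge0 /= -expR0 ler_expR oppr_le0; case/andP: (xh01 m n).
  rewrite mulr_sumr; apply: ler_sum => m _.
  apply: (le_trans (expR_linear_error (xh01 m n))).
  have /andP[hh0 hh1] := h01 m n.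
  have : h (sc m n) <= (sc 0 n)^-1.
    apply: (le_trans (scale_le_inv _ _)); rewrite !scE; apply: ler_wpM2l.
      by rewrite mulr_ge0 ?powR_ge0// ltW.
    rewrite !powRN lef_pV2 ?posrE ?powR_gt0//.
    by apply: ge0_ler_powR; rewrite ?nnegrE ?(ltW (t_gt0 _)) ?(ltW g0)//; exact: t_le.
  move=> hsc; rewrite exprMn expr2 -mulrA expr2.
  have x2 : x * x <= 1 by rewrite mulr_ile1.
  apply: (@le_trans _ _ (1 * (h (sc m n) * h (sc m n)))).
    by rewrite mulrA; apply: ler_wpM2r => //; exact: mulr_ge0.
  by rewrite mul1r; apply: ler_wpM2r.
- exact: cvg_cst.
- rewrite -[X in _ --> X](mul0r (beta / (1 - g))).
  by apply: cvgM; [exact: max_mean_edge_cvg|exact: mean_degree_cvg].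
Unshelve. all: by end_near. Qed.

End birth_sums.

End power_sums.

(** * Law of large numbers for the birth times *)

Section integral_density.
Local Open Scope ereal_scope.
Context d (T : measurableType d) (R : realType).
Variables (mu nu : {measure set T -> \bar R}) (p : T -> \bar R).
Hypothesis mp : measurable_fun setT p.
Hypothesis p_fin : forall x, p x \is a fin_num.
Hypothesis p0 : forall x, 0 <= p x.
Hypothesis nuE : forall A, measurable A -> nu A = \int[mu]_(x in A) p x.

Import HBNNSimple.

Let nnsfun_density (h : {nnsfun T >-> R}) :
  \int[nu]_x (h x)%:E = \int[mu]_x ((h x)%:E * p x).
Proof.
rewrite integralT_nnsfun sintegralE.
under [in RHS]eq_integral.
  move=> x _.
  rewrite fimfunE -fsumEFin// ge0_mule_fsuml; last first.
    by move=> r; rewrite nnfun_muleindic_ge0.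
  over.
rewrite ge0_integral_fsum//; last 2 first.
- by move=> r; apply: emeasurable_funM => //; exact/measurable_EFinP/measurable_funM.
- by move=> r x _; rewrite mule_ge0// nnfun_muleindic_ge0.
apply: eq_fsbigr => r _.
have [r0|r0] := ltP r 0%R.
  rewrite preimage_nnfun0// measure0 mule0 integral0_eq// => x _.
  by rewrite indic0 mulr0 mul0e.
under eq_integral do rewrite EFinM -muleA.
rewrite ge0_integralZl//; last 2 first.
- by apply: emeasurable_funM => //; exact/measurable_EFinP.
- by move=> x _; rewrite mule_ge0// lee_fin.
congr (_ * _); rewrite nuE// [LHS]integral_mkcond; apply: eq_integral => x _.
by rewrite patchE indicE; case: (x \in _); rewrite ?mul1e ?mul0e.
Qed.

(** By approximation with simple functions. It serves the exponential law over Lebesgue measure and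
    the Poisson law over counting measure. *)
Lemma ge0_integral_density (f : T -> \bar R) :
  measurable_fun setT f -> (forall x, 0 <= f x) ->
  \int[nu]_x f x = \int[mu]_x (f x * p x).
Proof.
move=> mf f0.
pose f_ := nnsfun_approx measurableT mf.
transitivity (lim (\int[nu]_x (f_ n x)%:E @[n --> \oo])).
  rewrite -monotone_convergence//=.
  - apply: eq_integral => ? _; apply/esym/cvg_lim => //=.
    exact: cvg_nnsfun_approx.
  - by move=> n; exact/measurable_EFinP/measurable_funTS.
  - by move=> n ? _; rewrite lee_fin.
  - by move=> ? _ ? ? mn; rewrite lee_fin; exact/lefP/nd_nnsfun_approx.
transitivity (lim (\int[mu]_x ((f_ n x)%:E * p x) @[n --> \oo])).
  by apply: congr_lim; apply/funext => n; exact: nnsfun_density.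
rewrite -monotone_convergence//=.
- apply: eq_integral => x _; apply/cvg_lim => //.
  by apply: cvgeZr => //; exact: cvg_nnsfun_approx.
- move=> n; apply: emeasurable_funM => //.
  exact/measurable_EFinP/measurable_funTS.
- by move=> n x _; rewrite mule_ge0// lee_fin.
- move=> x _ m n mn; apply: lee_wpmul2r => //.
  by rewrite lee_fin; exact/lefP/nd_nnsfun_approx.
Qed.

End integral_density.

(** Against the density, the integrand is (1 - s)^-1 times the exponential density of parameter 1 -
    s. *)
Lemma exponential_mgf (R : realType) (s : R) : s < 1 ->
  (\int[exponential_prob (1 : R)]_x (expR (s * x))%:E = ((1 - s)^-1)%:E)%E.
Proof.
move=> s1; have s1' : 0 < 1 - s by rewrite subr_gt0.
have mexp : measurable_fun setT (fun x : R => (expR (s * x))%:E).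
  by apply/measurable_EFinP; apply: measurableT_comp => //; exact: measurable_funM.
rewrite (@ge0_integral_density _ _ _ lebesgue_measure _
  (fun x => (exponential_pdf 1 x)%:E))//; last 2 first.
- by apply/measurable_EFinP; exact: measurable_exponential_pdf.
- by move=> x; rewrite lee_fin exponential_pdf_ge0.
transitivity (\int[lebesgue_measure]_x
    (((1 - s)^-1)%:E * (exponential_pdf (1 - s) x)%:E))%E.
  apply: eq_integral => x _; rewrite -!EFinM; congr EFin.
  have [x0|x0] := ltP x 0; first by rewrite !lt0_exponential_pdf// !mulr0.
  rewrite !exponential_pdfE// mul1r mulKf ?gt_eqF// -expRD; congr expR; ring.
rewrite ge0_integralZl//=; last 3 first.
- by apply/measurable_EFinP; exact: measurable_exponential_pdf.
- by move=> x _; rewrite lee_fin exponential_pdf_ge0// ltW.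
- by rewrite lee_fin invr_ge0 ltW.
by rewrite integral_exponential_pdf// mule1.
Qed.

Section arrival_times.
Context {R : realType} {d : nat} {disp} {T : measurableType disp}
  {P : probability T R}.
Variables (gamma beta : R) (phi : R -> R).
Variables (gap : nat -> {RV P >-> measurableTypeR R})
  (pos : nat -> {RV P >-> Rd R d}) (adj : T -> rel nat).
Hypothesis G : age_based_network gamma beta phi gap pos adj.

Local Notation events := (mark_events gap pos).
Local Notation sub i := (g_sigma_algebraType (other_events events i)).

Lemma measurable_birth n : measurable_fun setT (birth gap n).
Proof.
apply: (@measurable_sub _ _ _ _ _ gap pos (inr 0%N)).
exact: measurable_birth_sub.
Qed.

(** The last gap is integrated against its law while the preceding birth time is frozen. *)
Lemma birth_mgf (s : R) n : s < 1 ->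
  (\int[P]_w (expR (s * birth gap n w))%:E = (((1 - s)^-1) ^+ n.+1)%:E)%E.
Proof.
move=> s1.
have gapE k : (\int[distribution P (gap k)]_y (expR (s * y))%:E = ((1 - s)^-1)%:E)%E.
  rewrite -exponential_mgf//; apply: eq_measure_integral => A mA _.
  exact: (network_gap G k mA).
have mexp : measurable_fun setT (fun x : R => (expR (s * x))%:E).
  by apply/measurable_EFinP; apply: measurableT_comp => //; exact: measurable_funM.
elim: n => [|n IH].
  rewrite expr1 -(gapE 0%N) ge0_integral_distribution//.
  by apply: eq_integral => w _; rewrite /birth big_ord1.
pose f (p : sub (inl n.+1) * measurableTypeR R) : \bar R :=
  ((expR (s * birth gap n p.1))%:E * (expR (s * p.2))%:E)%E.
have mb : measurable_fun setT (birth gap n : sub (inl n.+1) -> R).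
  apply: measurable_sum => i _ A mA; apply: sub_sigma_algebra.
  exists (inl (i : nat)); last by exists A.
  by rewrite /=; apply/eqP => -[]; move: (ltn_ord i) => /[swap] ->; rewrite ltnn.
have mf : measurable_fun setT f.
  apply: emeasurable_funM; apply/measurable_EFinP; apply: measurableT_comp => //;
    apply: measurable_funM => //.
  exact: (measurableT_comp mb).
have f0 p : (0 <= f p)%E by rewrite mule_ge0// lee_fin expR_ge0.
have E := integral_freeze (network_marks G) (@mark_events_measurable _ _ _ _ _ gap pos)
  (@mark_eventsT _ _ _ _ _ gap pos) (@mark_eventsI _ _ _ _ _ gap pos)
  (i := inl n.+1) (X := gap n.+1) erefl mf f0.
transitivity (\int[P]_w f (w, gap n.+1 w))%E.
  by apply: eq_integral => w _; rewrite /f -EFinM -expRD -mulrDr -birthS.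
rewrite E; under eq_integral.
  move=> w _.
  rewrite /f /= ge0_integralZl ?lee_fin ?expR_ge0//.
  rewrite gapE; over.
rewrite ge0_integralZr//=; last 2 first.
- apply/measurable_EFinP; apply: measurableT_comp => //; apply: measurable_funM => //.
  exact: measurable_birth.
- by rewrite lee_fin invr_ge0 subr_ge0 ltW.
by rewrite IH -EFinM -exprSr.
Qed.

(** Exponential Markov inequality; the sign of [s] selects the tail, upper for s > 0 and lower for s
    < 0. *)
Lemma birth_chernoff (s a : R) n : s < 1 ->
  (P [set w | (s * (a * n.+1%:R) <= s * birth gap n w)%R] <=
   ((expR (s * a) * (1 - s))^-1 ^+ n.+1)%:E)%E.
Proof.
move=> s1.
set E := [set w | _].
have mE : measurable E.
  have mb : measurable_fun setT (fun w => s * birth gap n w).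
    by apply: measurable_funM => //; exact: measurable_birth.
  have := mb measurableT _ (measurable_itv `[s * (a * n.+1%:R), +oo[).
  by rewrite setTI; congr measurable; apply/seteqP; split => w /=; rewrite in_itv/= andbT.
have mexp : measurable_fun setT (fun w => (expR (s * birth gap n w))%:E).
  apply/measurable_EFinP; apply: measurableT_comp => //; apply: measurable_funM => //.
  exact: measurable_birth.
pose c := expR (- (s * (a * n.+1%:R))).
have -> : ((expR (s * a) * (1 - s))^-1 ^+ n.+1)%:E =
    (\int[P]_w (c%:E * (expR (s * birth gap n w))%:E))%E.
  rewrite ge0_integralZl//; last by rewrite lee_fin expR_ge0.
  rewrite birth_mgf// -EFinM; congr EFin.
  rewrite invfM exprMn /c mulrA expRN; congr (_ * _).
  by rewrite expRM_natr exprVn.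
rewrite -[X in P X]setIT -integral_indic//; apply: ge0_le_integral => //.
- exact/measurable_EFinP/measurable_indic.
- by apply: emeasurable_funM.
- move=> w _; rewrite -EFinM lee_fin /c -expRD indicE.
  case: (boolP (w \in E)) => [/set_mem wE|_]; last exact: expR_ge0.
  have -> : true%:R = expR 0 :> R by rewrite expR0.
  by rewrite ler_expR addrC subr_ge0.
Qed.

Let dev (e : R) n := [set w | e < `|birth gap n w / n.+1%:R - 1|].

Lemma measurable_birth_deviation e n : measurable (dev e n).
Proof.
have mb : measurable_fun setT (fun w => `|birth gap n w / n.+1%:R - 1|).
  apply: measurableT_comp => //; apply: measurable_funB => //.
  by apply: measurable_funM => //; exact: measurable_birth.
have := mb measurableT _ (measurable_itv `]e, +oo[).
by rewrite setTI; congr measurable; apply/seteqP; split => w /=; rewrite in_itv/= andbT.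
Qed.

Lemma birth_deviation (e : R) : 0 < e <= 1 ->
  exists2 q : R, 0 <= q < 1 &
    forall n, (P (dev e n) <= (2 * q ^+ n.+1)%:E)%E.
Proof.
move=> /andP[e0 e1].
(* Since exp(s a) (1 - s) >= (1 + s a)(1 - s) = 1 + s (a - 1) - s^2 a, a positive remainder makes
   the ratio smaller than 1. *)
have key (s a : R) : 0 < 1 - s -> 0 < s * (a - 1) - s ^+ 2 * a ->
    0 <= (expR (s * a) * (1 - s))^-1 < 1.
  move=> s1 h; have e1sa := expR_ge1Dx (s * a).
  have h1 : 1 < expR (s * a) * (1 - s).
    apply: (@lt_le_trans _ _ ((1 + s * a) * (1 - s))); last by rewrite ler_pM2r.
    by rewrite (_ : _ * _ = 1 + (s * (a - 1) - s ^+ 2 * a)); [rewrite ltrDl|ring].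
  by rewrite invr_ge0 (le_trans ler01 (ltW h1))//= invf_lt1// (lt_trans ltr01 h1).
(* With s = e/4 and a = 1 + e, or s = -e/4 and a = 1 - e, the term s (a - 1) is e^2/4 while s^2 a is
   at most e^2/8. *)
pose q1 := (expR ((e / 4) * (1 + e)) * (1 - (e / 4)))^-1.
pose q2 := (expR (- (e / 4) * (1 - e)) * (1 - - (e / 4)))^-1.
have /andP[q10 q11] : 0 <= q1 < 1 by apply: key; nra.
have /andP[q20 q21] : 0 <= q2 < 1 by apply: key; nra.
exists (Num.max q1 q2); first by rewrite le_max q10/= gt_max q11.
move=> n; have n0 : 0 < n.+1%:R :> R by rewrite ltr0n.
pose E s a := [set w | (s * (a * n.+1%:R) <= s * birth gap n w)%R].
have mE s a : measurable (E s a).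
  have mb : measurable_fun setT (fun w => s * birth gap n w).
    by apply: measurable_funM => //; exact: measurable_birth.
  have := mb measurableT _ (measurable_itv `[s * (a * n.+1%:R), +oo[).
  by rewrite setTI; congr measurable; apply/seteqP; split => w /=; rewrite in_itv/= andbT.
apply: (@le_trans _ _ (P (E (e / 4) (1 + e) `|` E (- (e / 4)) (1 - e)))).
  apply: le_measure; rewrite ?inE//.
  - exact: measurable_birth_deviation.
  - exact: measurableU.
  move=> w; rewrite /dev /E /= => ew.
  have : (1 + e < birth gap n w / n.+1%:R) \/ (birth gap n w / n.+1%:R < 1 - e).
    move: ew; move: (birth gap n w / n.+1%:R) => x; rewrite ltr_normr.
    by case/orP => ?; [left|right]; lra.
  rewrite ltr_pdivlMr// ltr_pdivrMr// => -[h|h]; [left|right].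
    by rewrite ler_pM2l ?divr_gt0// ltW.
  by rewrite !mulNr lerN2 ler_pM2l ?divr_gt0// ltW.
apply: le_trans; first exact: (measureU2 _ (mE _ _) (mE _ _)).
rewrite (_ : (2 * _)%:E = ((Num.max q1 q2 ^+ n.+1)%:E + (Num.max q1 q2 ^+ n.+1)%:E)%E); last first.
  by rewrite -EFinD; congr EFin; ring.
apply: leeD.
  apply: le_trans; first by apply: birth_chernoff; lra.
  by rewrite lee_fin; apply: lerXn2r; rewrite ?nnegrE ?le_max ?q10 ?lexx.
apply: le_trans; first by apply: birth_chernoff; lra.
by rewrite lee_fin; apply: lerXn2r; rewrite ?nnegrE ?le_max ?q20 ?lexx ?orbT.
Qed.

(** The deviation probabilities are summable, so Borel-Cantelli applies at each tolerance 1/(j+1),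
    and countably many null sets are discarded. *)
Lemma birth_slln :
  {ae P, forall w, birth gap n w / n.+1%:R @[n --> \oo] --> (1 : R)}.
Proof.
pose F (j : nat) := dev j.+1%:R^-1.
have F0 j : P (lim_sup_set (F j)) = 0%E.
  have j01 : 0 < (j.+1%:R : R)^-1 <= 1 by rewrite invr_gt0 ltr0n/= invf_le1 ?ltr0n// ler1n.
  have [q /andP[q0 q1] Hq] := birth_deviation j01.
  apply: lim_sup_set_cvg0; first by move=> k; exact: measurable_birth_deviation.
  apply: (@le_lt_trans _ _ (2 / (1 - q))%:E); last exact: ltry.
  apply: lime_le; first by apply: is_cvg_nneseries => k _ _; exact: measure_ge0.
  apply: nearW => N.
  apply: (@le_trans _ _ (\sum_(0 <= i < N) (2 * q ^+ i.+1)%:E)%E).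
    by apply: lee_sum => i _; exact: Hq.
  rewrite sumEFin lee_fin -mulr_sumr ler_pM2l// -[leRHS]mul1r ler_pdivlMr ?subr_gt0//.
  have -> : (\sum_(0 <= i < N) q ^+ i.+1) * (1 - q) = q - q ^+ N.+1.
    elim: N => [|N IH]; first by rewrite big_geq// mul0r expr1 subrr.
    by rewrite big_nat_recr//= mulrDl IH [q ^+ N.+2]exprS; ring.
  by rewrite lerBlDr (le_trans (ltW q1))// lerDl exprn_ge0.
have aeF : {ae P, forall w, forall j, ~ lim_sup_set (F j) w}.
  apply: ae_foralln => j; exists (lim_sup_set (F j)); split.
  - apply: bigcapT_measurable => n.
    by apply: bigcup_measurable => k _; exact: measurable_birth_deviation.
  - exact: F0.
  - by move=> w /= /contrapT.
apply: filterS aeF => w Hw; apply/cvgrPdist_le => e e0.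
have [j ej] : exists j, j.+1%:R^-1 <= e.
  have [N _ HN] := nbhs_infty_ger e^-1; exists N.
  rewrite -[leRHS]invrK lef_pV2 ?posrE ?invr_gt0//.
  by apply: (le_trans (HN N (leqnn N))); rewrite ler_nat.
have := Hw j; rewrite /lim_sup_set => /existsNP[N] /not_implyP[_ HN].
exists N => // n Nn; rewrite /= distrC leNgt; apply/negP => dn.
apply: HN; exists n => //=; rewrite /F /dev/=.
exact: le_lt_trans dn.
Qed.

End arrival_times.

(** * Averages of outdegrees *)

Section degree_averages.
Context {R : realType} {d : nat} {disp} {T : measurableType disp}
  {P : probability T R}.
Variables (gamma beta : R) (phi : R -> R).
Variables (gap : nat -> {RV P >-> measurableTypeR R})
  (pos : nat -> {RV P >-> Rd R d}) (adj : T -> rel nat).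
Hypothesis d_ge1 : (1 <= d)%N.
Hypothesis beta_gt0 : 0 < beta.
Hypothesis phiP : profile d phi.
Hypothesis G : age_based_network gamma beta phi gap pos adj.

Local Notation w_ := (edge_prob gamma beta phi gap pos).
Local Notation p_ := (@mean_edge R d disp T P gamma beta phi gap).
Local Notation adj_ := (@adjR R disp T adj).

(** Edges are counted by vertex number, without reference to time; this is the outdegree of vertex n
    at every time from its birth on. *)
Definition degree (n : nat) (w : T) : nat := (\sum_(m < n) adj w m n)%N.

(** For an indicator b in the exponent, z^b = 1 + (z - 1) b. *)
Lemma degree_exp (z : R) n w :
  z ^+ degree n w = \prod_(m < n) (1 + (z - 1) * adj_ m n w).
Proof.
rewrite /degree expr_sum; apply: eq_bigr => m _; rewrite /adjR.
by case: adj; rewrite ?mulr1 ?mulr0 ?addr0 ?expr0// expr1 addrC subrK.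
Qed.

Lemma measurable_degree_fun (g : nat -> R) n :
  measurable_fun setT (fun w => g (degree n w)).
Proof.
have mD : measurable_fun setT (fun w => (degree n w)%:R : R).
  rewrite (_ : (fun w => _) = (fun w => \sum_(m < n) adj_ m n w)).
    by apply: measurable_sum => m; exact: (measurable_adjR G).
  by apply/funext => w; rewrite /degree natr_sum.
have mk k : measurable [set w | degree n w = k].
  have := mD measurableT _ (measurable_set1 (k%:R : R)).
  rewrite setTI; congr measurable; apply/seteqP; split => w /=.
    by move/eqP; rewrite eqr_nat => /eqP.
  by move=> ->.
move=> _ B mB; rewrite setTI.
rewrite (_ : _ @^-1` B = \bigcup_(k in [set k | B (g k)]) [set w | degree n w = k]).
  exact: bigcup_measurable.
apply/seteqP; split => [w Bw|w [k Bk /= kE]]; first by exists (degree n w).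
by rewrite /preimage/= kE.
Qed.

Let alg_edges (n : nat) : seq (nat * nat) := [seq (m, n) | m <- iota 0 n].

Let prod_edges (F : nat -> nat -> R) n :
  \prod_(e <- alg_edges n) F e.1 e.2 = \prod_(m < n) F m n.
Proof. by rewrite big_map -[X in iota _ X]subn0 -/(index_iota 0 n) big_mkord. Qed.

Let edges_uniq n : uniq (alg_edges n).
Proof. by rewrite map_inj_uniq ?iota_uniq// => a b []. Qed.

Let edges_lt n : {in alg_edges n, forall e, (e.1 < e.2)%N}.
Proof. by move=> e /mapP[m]; rewrite mem_iota add0n => /andP[_ mn] ->. Qed.

Variable A : set T.
Hypothesis birthA : @birth_event R d disp T P gap pos A.
Let I (w : T) : R := \1_A w.

Lemma expectation_degree_exp (z : R) n : 0 <= z ->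
  \int[P]_w (I w * z ^+ degree n w) =
  \int[P]_w (I w * \prod_(m < n) (1 + (z - 1) * p_ m n w)).
Proof.
move=> z0.
rewrite -(expectation_prod_edges d_ge1 beta_gt0 phiP G birthA); last by lra.
have := expectation_edges d_ge1 beta_gt0 phiP G birthA (z - 1) (edges_uniq n) (@edges_lt n).
under eq_Rintegral do rewrite (prod_edges (fun m n => 1 + (z - 1) * adj_ m n _)) -degree_exp.
move=> ->; apply: eq_Rintegral => w _.
by rewrite (prod_edges (fun m n => 1 + (z - 1) * w_ m n _)).
Qed.

Lemma expectation_degree_exp2 (z : R) (n n' : nat) : 0 <= z <= 1 -> (n < n')%N ->
  \int[P]_w (I w * (z ^+ degree n w * z ^+ degree n' w)) <=
  \int[P]_w (I w * (\prod_(m < n) (1 + (z - 1) * p_ m n w) *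
                    \prod_(m < n') (1 + (z - 1) * p_ m n' w))) +
  \sum_(m < n) \int[P]_w (I w * (p_ m n w * p_ m n' w)).
Proof.
move=> z01 nn'.
apply: le_trans (expectation_prod_edges2 d_ge1 beta_gt0 phiP G birthA _ nn'); last by lra.
have u2 : uniq (alg_edges n ++ alg_edges n').
  rewrite cat_uniq !edges_uniq /= andbT; apply/hasPn => e /mapP[m _ ->].
  by apply/negP => /mapP[k _ [_ nE]]; rewrite nE ltnn in nn'.
have lt2 : {in alg_edges n ++ alg_edges n', forall e, (e.1 < e.2)%N}.
  by move=> e; rewrite mem_cat => /orP[]; exact: edges_lt.
have := expectation_edges d_ge1 beta_gt0 phiP G birthA (z - 1) u2 lt2.
under eq_Rintegral do rewrite big_cat /= (prod_edges (fun m n => 1 + (z - 1) * adj_ m n _))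
  (prod_edges (fun m n => 1 + (z - 1) * adj_ m n _)) -!degree_exp.
move=> ->; rewrite le_eqVlt; apply/orP; left; apply/eqP; apply: eq_Rintegral => w _.
by rewrite big_cat /= !(prod_edges (fun m n => 1 + (z - 1) * w_ m n _)).
Qed.

End degree_averages.

Lemma double_sum (R : comPzRingType) (u : nat -> R) n :
  \sum_(i < n) \sum_(j < n) ((i == j)%:R + u i + u j) =
  n%:R + n%:R * (2 * \sum_(i < n) u i).
Proof.
have rowE (i : 'I_n) : \sum_(j < n) ((i == j)%:R + u i + u j) =
    1 + n%:R * u i + \sum_(j < n) u j.
  rewrite !big_split /= sumr_const card_ord mulr_natl; congr (_ + _ + _).
  rewrite (bigD1 i)//= eqxx big1 ?addr0// => j /negPf ji.
  by rewrite eq_sym ji.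
rewrite (eq_bigr _ (fun i _ => rowE i)) !big_split /= !sumr_const card_ord.
by rewrite -mulr_sumr -[X in _ + X]mulr_natl; ring.
Qed.

(** * Second moments on a good event *)

Section good_event.
Context {R : realType} {d : nat} {disp} {T : measurableType disp}
  {P : probability T R}.
Variables (gamma beta : R) (phi : R -> R).
Variables (gap : nat -> {RV P >-> measurableTypeR R})
  (pos : nat -> {RV P >-> Rd R d}) (adj : T -> rel nat).
Hypothesis d_ge1 : (1 <= d)%N.
Hypothesis gamma01 : 0 < gamma < 1.
Hypothesis beta_gt0 : 0 < beta.
Hypothesis phiP : profile d phi.
Hypothesis G : age_based_network gamma beta phi gap pos adj.

Local Notation events := (mark_events gap pos).
Local Notation sub i := (g_sigma_algebraType (other_events events i)).
Local Notation bm := bounded_measurable.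
Local Notation p_ := (@mean_edge R d disp T P gamma beta phi gap).
Local Notation deg := (degree adj).

(** Linear growth of the birth times bounds the mean degrees by [lam * K]. The event depends on
    birth times only and may thus be imposed inside expectations that average over positions. *)
Definition good_event (K : R) : set T :=
  [set w | forall k, k.+1%:R / K <= birth gap k w].

Lemma birth_good_event K : @birth_event R d disp T P gap pos (good_event K).
Proof.
move=> k.
have -> : good_event K = \bigcap_n [set w | n.+1%:R / K <= birth gap n w].
  by apply/seteqP; split => [w h n _|w h n]; exact: h.
apply: (@bigcapT_measurable _ (sub (inr k))) => n.
have := @measurable_birth_sub _ _ _ _ _ gap pos k n measurableT _
  (measurable_itv `[n.+1%:R / K, +oo[).
by rewrite setTI; congr measurable; apply/seteqP; split => w /=; rewrite in_itv/= andbT.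
Qed.

Lemma measurable_good_event K : measurable (good_event K).
Proof. exact: (birth_event_measurable (birth_good_event K)). Qed.

(** The complements shrink as K grows, and by the strong law almost every outcome eventually leaves
    them. *)
Lemma good_event_cvg (e : R) : 0 < e ->
  exists2 K : R, 0 < K & (P (~` good_event K) <= e%:E)%E.
Proof.
move=> e0.
pose F n := ~` good_event n.+1%:R.
have mF n : measurable (F n) by apply: measurableC; exact: measurable_good_event.
have : P (F n) @[n --> \oo] --> P (\bigcap_n F n).
  apply: nonincreasing_cvg_mu => //.
  - by rewrite ltey_eq fin_num_measure.
  - exact: bigcapT_measurable.
  - move=> m n mn; apply/subsetPset; apply: subsetC => w gw k.
    apply: (le_trans _ (gw k)); apply: ler_wpM2l => //.
    by rewrite lef_pV2 ?posrE ?ltr0n// ler_nat.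
have -> : P (\bigcap_n F n) = 0%E.
  apply/negligibleP; first exact: bigcapT_measurable.
  apply: negligibleS (birth_slln G) => w /= Fw slln.
  have mono : {homo (fun n => birth gap n w) : m n / (m <= n)%N >-> m <= n}.
    move=> m n; rewrite leq_eqVlt => /predU1P[->//|mn].
    by apply/ltW; exact: (birth_lt G w).
  have [K K0 HK] := linear_growth (fun n => birth_gt0 G n w) slln mono.
  have [N _ HN] := nbhs_infty_ger K.
  apply: (Fw N I) => k; apply: (le_trans _ (HK k)); apply: ler_wpM2l => //.
  rewrite lef_pV2 ?posrE ?ltr0n//; apply: (le_trans (HN N (leqnn N))).
  by rewrite ler_nat.
move=> /fine_cvgP[_ /cvgrPdist_le/(_ e e0)[N _ HN]].
exists N.+1%:R => //; have := HN N (leqnn N).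
rewrite /= sub0r normrN ger0_norm ?fine_ge0// -lee_fin fineK//.
exact: fin_num_measure.
Qed.

Let lam := beta / (1 - gamma).

Let h_ge0 c : 0 < c -> 0 <= edge_mean d phi c.
Proof. exact: (edge_mean_ge0 phiP d_ge1). Qed.

Let h_le c : 0 < c -> c * edge_mean d phi c <= 1.
Proof. exact: (edge_mean_mul_le1 phiP d_ge1). Qed.

Let p01 m n w : 0 <= p_ m n w <= 1.
Proof. exact: (mean_edge01 d_ge1 beta_gt0 phiP G). Qed.

Lemma prod_mean_edge_ae (z : R) : 0 <= z <= 1 ->
  {ae P, forall w, \prod_(m < n) (1 + (z - 1) * p_ m n w) @[n --> \oo]
    --> expR (- ((1 - z) * lam))}.
Proof.
move=> z01; apply: filterS (birth_slln G) => w slln.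
have mono : {homo (fun n => birth gap n w) : m n / (m <= n)%N >-> m <= n}.
  move=> m n; rewrite leq_eqVlt => /predU1P[->//|mn].
  by apply/ltW; exact: (birth_lt G w).
have x01 : 0 <= 1 - z <= 1 by lra.
have := prod_mean_edge_cvg gamma01 beta_gt0 h_ge0 h_le
  (edge_mean_mul_cvg1 phiP d_ge1) (fun n => birth_gt0 G n w) slln mono
  (fun m n => (andP (p01 m n w)).2) x01.
apply: cvg_trans; apply: near_eq_cvg; near=> n.
by apply: eq_bigr => m _; rewrite -[z - 1]opprB mulNr.
Unshelve. all: by end_near. Qed.

Variable K : R.
Hypothesis K0 : 0 < K.
Let A := good_event K.
Let I (w : T) : R := \1_A w.

Let mA : measurable A. Proof. exact: measurable_good_event. Qed.
Let bI : bm I. Proof. exact: bm_indic. Qed.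
Let I01 w : 0 <= I w <= 1.
Proof. by rewrite /I indicE; case: (w \in A) => /=; rewrite ?lexx ler01. Qed.

Lemma good_mean_edge m n w : A w -> p_ m n w <= beta * K * n.+1%:R `^ (gamma - 1).
Proof.
by move=> Aw; exact: (mean_edge_bound gamma01 beta_gt0 h_le
  (fun n => birth_gt0 G n w) m n K0 Aw).
Qed.

Lemma good_mean_degree n w : A w -> \sum_(m < n) p_ m n w <= lam * K.
Proof.
move=> Aw; rewrite /lam mulrAC; exact: (mean_degree_bound gamma01 beta_gt0 h_le
  (fun n => birth_gt0 G n w) n K0 Aw).
Qed.

Let bp m n : bm (p_ m n). Proof. exact: (bm_mean_edge d_ge1 beta_gt0 phiP G). Qed.

Let bY z n : bm (fun w => \prod_(m < n) (1 + (z - 1) * p_ m n w)).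
Proof.
by apply: bm_prod => m _; apply: bmD; [exact: bm_cst|apply: bmM => //; exact: bm_cst].
Qed.

Lemma bm_degree_exp (z : R) n : bm (fun w => z ^+ degree adj n w).
Proof.
rewrite (_ : (fun w => _) = (fun w => \prod_(m < n) (1 + (z - 1) * adjR adj m n w))).
  apply: bm_prod => m _; apply: bmD; [exact: bm_cst|apply: bmM; first exact: bm_cst].
  exact: (bm_adjR G).
by apply/funext => w; rewrite degree_exp.
Qed.

Let bpow := bm_degree_exp.

(** 1 + x <= exp(x) in each factor, then the bound on the mean degree; the result is uniform in
    n. *)
Lemma good_degree_exp (z : R) n : 1 <= z ->
  \int[P]_w (I w * z ^+ degree adj n w) <= expR ((z - 1) * (lam * K)).
Proof.
move=> z1; rewrite (expectation_degree_exp d_ge1 beta_gt0 phiP G (birth_good_event K)); last by lra.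
rewrite -[leRHS](bm_EF_cst P); apply: bm_EF_le; [by apply: bmM|exact: bm_cst|].
move=> w; rewrite /I indicE; case: (boolP (w \in A)) => [/set_mem Aw|_]; last first.
  by rewrite mul0r expR_ge0.
rewrite mul1r; apply: (@le_trans _ _ (\prod_(m < n) expR ((z - 1) * p_ m n w))).
  apply: ler_prod => m _; have /andP[? ?] := p01 m n w.
  by rewrite expR_ge1Dx andbT; nra.
rewrite -expR_sum -mulr_sumr ler_expR; apply: ler_wpM2l; first by lra.
exact: good_mean_degree.
Qed.

Variable z : R.
Hypothesis z01 : 0 <= z <= 1.
Let F := expR (- ((1 - z) * lam)).
Let Y n w := \prod_(m < n) (1 + (z - 1) * p_ m n w).
(** [Y n] is the generating function of the degree given the birth times, and [F] its limit. On the
    good event, [a] measures their distance and [b] bounds the effect of shared older vertices. *)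
Let a n := \int[P]_w (I w * `|Y n w - F|).
Let b n := beta * K * n.+1%:R `^ (gamma - 1) * (lam * K).

Let lam0 : 0 < lam.
Proof. by rewrite divr_gt0// subr_gt0; case/andP: gamma01. Qed.

Let F01 : 0 <= F <= 1.
Proof.
rewrite expR_ge0 /= -expR0 ler_expR oppr_le0 mulr_ge0// ?(ltW lam0)//.
by rewrite subr_ge0; case/andP: z01.
Qed.

Let Y01 n w : 0 <= Y n w <= 1.
Proof.
have f01 (m : 'I_n) : 0 <= 1 + (z - 1) * p_ m n w <= 1.
  by have /andP[? ?] := p01 m n w; move: z01 => /andP[? ?]; apply/andP; split; nra.
apply/andP; split; first by apply: prodr_ge0 => m _; case/andP: (f01 m).
by rewrite /Y; apply: prodr_ile1 => m _; exact: f01.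
Qed.

Let absYF n w : `|Y n w - F| <= 1.
Proof.
by have /andP[? ?] := Y01 n w; move: F01 => /andP[? ?]; rewrite ler_norml; lra.
Qed.

Let a_cvg : a n @[n --> \oo] --> (0 : R).
Proof.
have bf n : bm (fun w => I w * `|Y n w - F|).
  by apply: bmM => //; apply: bm_norm; apply: bmB; [exact: bY|exact: bm_cst].
have aE n : (a n)%:E = (\int[P]_w (I w * `|Y n w - F|)%:E)%E.
  by rewrite bm_EFin.
have mf n : measurable_fun setT (fun w => (I w * `|Y n w - F|)%:E).
  by apply/measurable_EFinP; exact: (bf n).1.
have ff : {ae P, forall w, setT w -> (I w * `|Y n w - F|)%:E @[n --> \oo] --> (cst 0%E w : \bar R)}.
  apply: filterS (prod_mean_edge_ae z01) => w Yw _; apply: cvg_EFin; first by near=> n.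
  rewrite -[X in _ --> X](mulr0 (I w)); apply: cvgMr; rewrite -(normr0 R).
  by apply: cvg_norm; rewrite -(subrr F); apply: cvgB => //; exact: cvg_cst.
have fg : {ae P, forall w n, setT w -> (`|(I w * `|Y n w - F|)%:E| <= cst 1%:E w)%E}.
  apply: aeW => w n _; rewrite /= lee_fin; have /andP[? ?] := I01 w.
  rewrite ger0_norm ?mulr_ge0//; apply: (@le_trans _ _ (1 * 1)); last by rewrite mulr1.
  by apply: ler_pM.
have [_ _] := dominated_convergence measurableT mf (measurable_cst _) ff
  (bm_integrable P (bm_cst 1)) fg.
rewrite integral0 => /fine_cvgP[_].
by apply: cvg_trans; apply: near_eq_cvg; near=> n; rewrite /= -aE.
Unshelve. all: by end_near. Qed.

Let a_ge0 n : 0 <= a n.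
Proof.
rewrite -(bm_EF_cst P 0); apply: bm_EF_le; first exact: bm_cst.
  by apply: bmM => //; apply: bm_norm; apply: bmB; [exact: bY|exact: bm_cst].
by move=> w; rewrite mulr_ge0//; case/andP: (I01 w).
Qed.

Let b_ge0 n : 0 <= b n.
Proof.
by rewrite mulr_ge0 ?(mulr_ge0 (ltW lam0) (ltW K0))// mulr_ge0 ?powR_ge0// mulr_ge0// ltW.
Qed.

Let b_cvg : b n @[n --> \oo] --> (0 : R).
Proof.
rewrite -(mul0r (lam * K)); apply: cvgMl; rewrite -(mulr0 (beta * K)); apply: cvgMr.
rewrite -[gamma - 1]opprB; apply: cvg_powR_natN.
by rewrite subr_gt0; case/andP: gamma01.
Qed.

(** One factor is bounded by its maximum, which decays with n', and the sum of the other by the mean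
    degree. *)
Let edge_pairs n n' : (n < n')%N ->
  \sum_(m < n) \int[P]_w (I w * (p_ m n w * p_ m n' w)) <= b n'.
Proof.
move=> nn'; rewrite -(bm_EF_sum P); last by move=> m; do 2 apply: bmM => //.
rewrite -[leRHS](bm_EF_cst P); apply: bm_EF_le; [|exact: bm_cst|].
  by apply: bm_sum => m _; do 2 apply: bmM => //.
move=> w; rewrite -mulr_sumr /I indicE; case: (boolP (w \in A)) => [/set_mem Aw|_]; last first.
  by rewrite mul0r b_ge0.
rewrite mul1r; apply: (@le_trans _ _ (beta * K * n'.+1%:R `^ (gamma - 1) * \sum_(m < n) p_ m n w)).
  rewrite mulr_sumr; apply: ler_sum => m _; rewrite mulrC; apply: ler_wpM2r.
    by case/andP: (p01 m n w).
  exact: good_mean_edge.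
apply: ler_wpM2l; last exact: good_mean_degree.
by rewrite !mulr_ge0// ?powR_ge0// ltW.
Qed.

Let centered_product (X X' : T -> R) : bm X -> bm X' ->
  \int[P]_w (I w * ((X w - F) * (X' w - F))) =
  \int[P]_w (I w * (X w * X' w)) - F * \int[P]_w (I w * X w)
    - F * \int[P]_w (I w * X' w) + F ^+ 2 * \int[P]_w I w.
Proof.
move=> bX bX'.
have b1 : bm (fun w => I w * (X w * X' w)) by do 2 apply: bmM => //.
have bIX (Z : T -> R) : bm Z -> bm (fun w => F * (I w * Z w)).
  by move=> bZ; apply: bmM; [exact: bm_cst|exact: bmM].
have bFI : bm (fun w => F ^+ 2 * I w) by apply: bmM => //; exact: bm_cst.
rewrite -!bm_EFZ//; [|exact: bmM..].
rewrite -bm_EFB//; last exact: bIX.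
rewrite -bm_EFB//; [|by apply: bmB => //; exact: bIX|exact: bIX].
rewrite -bm_EFD//; last by do 2 (apply: bmB => //; last exact: bIX).
by apply: eq_Rintegral => w _; ring.
Qed.

(** After expansion the linear terms equal those for [Y], and the product term exceeds that for [Y]
    by at most [b n']. There remains the product of [Y n - F] and [Y n' - F], whose second factor
    has absolute value at most 1. *)
Let covariance_lt n n' : (n < n')%N ->
  \int[P]_w (I w * ((z ^+ deg n w - F) * (z ^+ deg n' w - F))) <= a n + b n'.
Proof.
move=> nn'; rewrite centered_product//.
have z0 : 0 <= z by case/andP: z01.
have ED := expectation_degree_exp d_ge1 beta_gt0 phiP G (birth_good_event K) _ z0.
rewrite !ED.
have := expectation_degree_exp2 d_ge1 beta_gt0 phiP G (birth_good_event K) z01 nn'.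
have := edge_pairs nn'.
have := centered_product (bY z n) (bY z n').
have : \int[P]_w (I w * ((Y n w - F) * (Y n' w - F))) <= a n.
  apply: bm_EF_le.
  - by do 2 apply: bmM => //; apply: bmB; rewrite /Y//; exact: bm_cst.
  - by apply: bmM => //; apply: bm_norm; apply: bmB; [exact: bY|exact: bm_cst].
  - move=> w; have /andP[I0 _] := I01 w; apply: ler_wpM2l => //.
    by rewrite (le_trans (ler_norm _))// normrM ler_piMr.
rewrite -/I /Y; lra.
Qed.

Let u n := a n + b n.

Let covariance n n' :
  \int[P]_w (I w * ((z ^+ deg n w - F) * (z ^+ deg n' w - F))) <=
  (n == n')%:R + u n + u n'.
Proof.
have := a_ge0 n; have := b_ge0 n; have := a_ge0 n'; have := b_ge0 n'.
rewrite /u; case: (ltngtP n n') => [nn'|nn'|<-]; rewrite /= ?mulr0n ?mulr1n.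
- by have := covariance_lt nn'; lra.
- by under eq_Rintegral do rewrite [X in _ * X]mulrC; have := covariance_lt nn'; lra.
- suff : \int[P]_w (I w * ((z ^+ deg n w - F) * (z ^+ deg n w - F))) <= 1 by rewrite /=; lra.
  rewrite -[leRHS](bm_EF_cst P); apply: bm_EF_le; [|exact: bm_cst|].
    by do 2 apply: bmM => //; apply: bmB => //; exact: bm_cst.
  move=> w; have /andP[? ?] := I01 w; have /andP[? ?] := F01.
  have : 0 <= z ^+ deg n w <= 1 by rewrite exprn_ge0 ?exprn_ile1//; case/andP: z01.
  move: (z ^+ deg n w) => q /andP[q0 q1].
  have h : (q - F) * (q - F) <= 1 by nra.
  by apply: mulr_ile1 => //; exact: sqr_ge0.
Qed.

Let S n w : R := (\sum_(i < n.+1) z ^+ deg i w) / n.+1%:R.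

(** The diagonal contributes 1/(n+1) and the rest is a Cesaro mean of [u], so that convergence of
    [u] to 0 is enough. *)
Let second_moment n : \int[P]_w (I w * (S n w - F) ^+ 2) <=
  n.+1%:R^-1 + 2 * arithmetic_mean u n.
Proof.
pose x (i : 'I_n.+1) w := z ^+ deg i w - F.
have bx i : bm (x i) by apply: bmB => //; exact: bm_cst.
have n0 : n.+1%:R != 0 :> R by rewrite pnatr_eq0.
have bxx i j : bm (fun w => I w * (x i w * x j w)) by do 2 apply: bmM => //.
have -> : \int[P]_w (I w * (S n w - F) ^+ 2) =
    n.+1%:R ^- 2 * \sum_(i < n.+1) \sum_(j < n.+1) \int[P]_w (I w * (x i w * x j w)).
  under eq_bigr => i _ do rewrite -(bm_EF_sum P _ (bxx i)).
  rewrite -(bm_EF_sum P); last by move=> i; apply: bm_sum => j _; exact: bxx.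
  rewrite -bm_EFZ; last by do 2 (apply: bm_sum => ? _); exact: bxx.
  apply: eq_Rintegral => w _.
  have -> : S n w - F = n.+1%:R^-1 * \sum_(i < n.+1) x i w.
    rewrite sumrB sumr_const card_ord -[F *+ _]mulr_natl mulrBr mulKf//.
    by rewrite /S mulrC.
  rewrite exprMn exprVn mulrCA; congr (_ * _).
  rewrite expr2 big_distrlr mulr_sumr; apply: eq_bigr => i _.
  by rewrite mulr_sumr.
apply: (@le_trans _ _ (n.+1%:R ^- 2 *
    \sum_(i < n.+1) \sum_(j < n.+1) ((i == j)%:R + u i + u j))).
  by apply: ler_wpM2l => //; do 2 (apply: ler_sum => ? _); exact: covariance.
rewrite double_sum.
rewrite /arithmetic_mean /= /series /= big_mkord le_eqVlt; apply/orP; left.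
by apply/eqP; field.
Qed.

Lemma second_moment_cvg : \int[P]_w (I w * (S n w - F) ^+ 2) @[n --> \oo] --> (0 : R).
Proof.
apply: (@squeeze_cvgr _ _ _ _ (fun=> 0) (fun n => n.+1%:R^-1 + 2 * arithmetic_mean u n)).
- near=> n; rewrite second_moment andbT -(bm_EF_cst P 0); apply: bm_EF_le; first exact: bm_cst.
    apply: bmM => //; apply: bmM; apply: bmB; rewrite /S;
      by [exact: bm_cst | apply: bmM; [apply: bm_sum => i _|exact: bm_cst]].
  by move=> w; rewrite mulr_ge0 ?sqr_ge0//; case/andP: (I01 w).
- exact: cvg_cst.
- rewrite -[X in _ --> X](addr0 0); apply: cvgD; first exact: cvg_harmonic.
  rewrite -(mulr0 2); apply: cvgMr; apply: cesaro.
  by rewrite -[X in _ --> X](addr0 0); apply: cvgD.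
Unshelve. all: by end_near. Qed.

End good_event.

(** * Generating function of the Poisson law *)

Section poisson.
Context {R : realType} (lam : R) (n : nat).
Hypothesis lam_gt0 : 0 < lam.
Local Notation nu := (poisson_prob lam n).

Lemma poisson_pgf (z : R) : 0 <= z ->
  (\int[nu]_k (z ^+ k)%:E = (expR (lam * (z - 1)))%:E)%E.
Proof.
move=> z0.
have pmf0 k : (0 <= (poisson_pmf lam k)%:E)%E by rewrite lee_fin poisson_pmf_ge0.
have nuE (A : set nat) : poisson_prob lam n A = (\esum_(k in A) (poisson_pmf lam k)%:E)%E.
  by rewrite /poisson_prob lam_gt0.
rewrite (@ge0_integral_density _ _ _ counting nu (fun k => (poisson_pmf lam k)%:E))//; last first.
- by move=> k; rewrite lee_fin exprn_ge0.
- move=> A mA; apply: (etrans (nuE A)).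
  rewrite integral_mkcond ge0_integral_count; last first.
    by move=> k; rewrite patchE; case: ifP.
  rewrite nneseries_esumT; last by move=> k; rewrite patchE; case: ifP.
  rewrite esum_mkcond; congr (esum setT _).
rewrite ge0_integral_count; last by move=> k; rewrite mule_ge0// lee_fin exprn_ge0.
transitivity ((expR (- lam))%:E * (expR (lam * z))%:E)%E; last first.
  by rewrite -EFinM -expRD mulrBr mulr1 addrC.
transitivity (\sum_(k <oo) ((expR (- lam))%:E * ((lam * z) ^+ k / k`!%:R)%:E))%E.
  apply: eq_eseriesr => k _; rewrite -!EFinM /poisson_pmf lam_gt0 exprMn.
  by congr EFin; ring.
rewrite nneseriesZl; last first.
  by move=> k _; rewrite lee_fin divr_ge0// exprn_ge0// mulr_ge0// ltW.
congr *%E; rewrite expRE -EFin_lim; last first.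
  rewrite /pseries/=; under eq_fun do rewrite mulrC.
  exact: is_cvg_series_exp_coeff.
apply/congr_lim/funext => k/=; rewrite /pseries/= /series/= -sumEFin//.
by apply: eq_bigr => i _; rewrite mulrC.
Qed.

Lemma poisson_integrable (g : nat -> R) (C z : R) : 0 <= z ->
  (forall k, `|g k| <= C * z ^+ k) -> nu.-integrable setT (EFin \o g).
Proof.
move=> z0 gC.
have iz : nu.-integrable setT (fun k => (z ^+ k)%:E).
  apply/integrableP; split => //; under eq_integral do rewrite gee0_abs ?lee_fin ?exprn_ge0//.
  by rewrite poisson_pgf// ltry.
apply: (le_integrable _ _ _ (integrableZl _ C iz)) => // k _ /=.
by rewrite lee_fin (le_trans (gC k))// ler_norm.
Qed.

Lemma poisson_Rpgf (z : R) : 0 <= z -> \int[nu]_k (z ^+ k) = expR (lam * (z - 1)).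
Proof. by move=> z0; rewrite /Rintegral poisson_pgf. Qed.

End poisson.

(** * Convergence in probability along the number of vertices *)

Section convergence_in_probability.
Context {disp} {T : measurableType disp} {R : realType} (P : probability T R).
Implicit Types (X Y : nat -> T -> R).
Local Notation bm := bounded_measurable.

(** The index is a number of vertices, whereas [cvg_in_probability] refers to time. Explicit
    tolerances allow bad events to be combined by union bounds. *)
Definition seq_cip X (l : R) := (forall n, measurable_fun setT (X n)) /\
  forall e eta : R, 0 < e -> 0 < eta -> exists N0, forall n, (N0 <= n)%N ->
    (P [set w | (e < `|X n w - l|)%R] <= eta%:E)%E.

Lemma measurable_gt_fun (f : T -> R) (e : R) : measurable_fun setT f ->
  measurable [set w | e < f w].
Proof.
move=> mf; have := mf measurableT _ (measurable_itv `]e, +oo[).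
by rewrite setTI; congr measurable; apply/seteqP; split => w /=; rewrite in_itv/= andbT.
Qed.

Lemma measurable_dist (f g : T -> R) : measurable_fun setT f -> measurable_fun setT g ->
  measurable_fun setT (fun w => `|f w - g w|).
Proof. by move=> mf mg; apply: measurableT_comp => //; exact: measurable_funB. Qed.

Lemma prob_le_U2 (A B C : set T) (a b : R) : measurable A -> measurable B -> measurable C ->
  A `<=` B `|` C -> (P B <= a%:E)%E -> (P C <= b%:E)%E -> (P A <= (a + b)%:E)%E.
Proof.
move=> mA mB mC ABC PB PC; apply: (@le_trans _ _ (P (B `|` C))).
  by apply: le_measure; rewrite ?inE//; exact: measurableU.
by rewrite EFinD (le_trans (measureU2 _ _ _))// leeD.
Qed.

Lemma bm_markov (f : T -> R) (e : R) : bm f -> 0 < e -> (forall w, 0 <= f w) ->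
  (P [set w | (e < f w)%R] <= (e^-1 * \int[P]_w f w)%:E)%E.
Proof.
move=> bf e0 f0; have mE := measurable_gt_fun e bf.1.
rewrite -[leLHS]fineK ?fin_num_measure// lee_fin -(bm_EF_indic P mE) mulrC ler_pdivlMr//.
rewrite mulrC -bm_EFZ; last exact: bm_indic.
apply: bm_EF_le => // [|w]; first by apply: bmM; [exact: bm_cst|exact: bm_indic].
rewrite indicE; case: (boolP (w \in _)) => [/set_mem/= /ltW|_]; first by rewrite mulr1.
by rewrite mulr0.
Qed.

(** Moments are controlled on a good event only; its complement is paid for separately. *)
Lemma bm_markov_on (A : set T) (f : T -> R) (e : R) : measurable A -> bm f -> 0 < e ->
  (forall w, 0 <= f w) ->
  (P [set w | (e < f w)%R] <= P (~` A) + (e^-1 * \int[P]_w (\1_A w * f w))%:E)%E.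
Proof.
move=> mA bf e0 f0.
have bAf : bm (fun w => \1_A w * f w) by apply: bmM => //; exact: bm_indic.
have mE := measurable_gt_fun e bAf.1.
rewrite (le_trans _ (leeD2l _ (bm_markov bAf e0 _)))//; last first.
  by move=> w; rewrite mulr_ge0// indicE.
rewrite (le_trans _ (measureU2 _ _ _))//; last exact: measurableC.
apply: le_measure; rewrite ?inE//.
- exact: measurable_gt_fun bf.1.
- by apply: measurableU => //; exact: measurableC.
move=> w /= ef; have [Aw|] := pselect (A w); last by left.
by right; rewrite /= indicE mem_set// mul1r.
Qed.

Lemma seq_cip_ext X Y l : (forall n w, X n w = Y n w) -> seq_cip X l -> seq_cip Y l.
Proof. by move=> XY; rewrite (_ : X = Y)//; apply/funext => n; apply/funext => w. Qed.

Lemma seq_cipD X Y l m : seq_cip X l -> seq_cip Y m ->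
  seq_cip (fun n w => X n w + Y n w) (l + m).
Proof.
move=> [mX Xl] [mY Ym]; split=> [n|e eta e0 eta0]; first exact: measurable_funD.
have e20 : 0 < e / 2 by rewrite divr_gt0.
have eta20 : 0 < eta / 2 by rewrite divr_gt0.
have [N1 H1] := Xl _ _ e20 eta20; have [N2 H2] := Ym _ _ e20 eta20.
exists (maxn N1 N2) => n; rewrite geq_max => /andP[/H1 PX /H2 PY].
rewrite [eta]splitr; apply: (prob_le_U2 _ _ _ _ PX PY).
- by apply/measurable_gt_fun/measurable_dist => //; exact: measurable_funD.
- exact/measurable_gt_fun/measurable_dist.
- exact/measurable_gt_fun/measurable_dist.
move=> w /= h; case: (ltP (e / 2) `|X n w - l|) => [|h1]; first by left.
right; rewrite ltNge; apply/negP => h2; move: h; rewrite ltNge => /negP; apply.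
rewrite [e]splitr opprD addrACA (le_trans (ler_normD _ _))//; exact: lerD.
Qed.

Lemma seq_cip_cst c : seq_cip (fun _ _ => c) c.
Proof.
split=> // e eta e0 eta0; exists 0%N => n _.
rewrite (_ : [set _ | _] = set0) ?measure0 ?lee_fin ?ltW//.
by apply/seteqP; split => w //=; rewrite subrr normr0 ltNge ltW.
Qed.

Lemma seq_cipZ X l c : seq_cip X l -> seq_cip (fun n w => c * X n w) (c * l).
Proof.
have [->|c0] := eqVneq c 0.
  move=> _; apply: (@seq_cip_ext (fun _ _ => 0)) => [n w|]; first by rewrite mul0r.
  by rewrite mul0r; exact: seq_cip_cst.
move=> [mX Xl]; split=> [n|e eta e0 eta0]; first exact: measurable_funM.
have ec : 0 < e / `|c| by rewrite divr_gt0// normr_gt0.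
have [N0 H] := Xl _ _ ec eta0; exists N0 => n /H; congr (P _ <= _)%E.
apply/seteqP; split => w /=; rewrite -mulrBr normrM ltr_pdivrMr ?normr_gt0// mulrC//.
Qed.

(** The approximating sequence and its limit may depend on both tolerances; e is split as e/4 + e/2
    + e/4. *)
Lemma seq_cip_approx X l : (forall n, measurable_fun setT (X n)) ->
  (forall e eta : R, 0 < e -> 0 < eta -> exists Y m, [/\ seq_cip Y m,
    `|m - l| <= e & exists N0, forall n, (N0 <= n)%N ->
      (P [set w | (e < `|X n w - Y n w|)%R] <= eta%:E)%E]) ->
  seq_cip X l.
Proof.
move=> mX XY; split=> [//|e eta e0 eta0].
have e40 : 0 < e / 4 by rewrite divr_gt0.
have e20 : 0 < e / 2 by rewrite divr_gt0.
have eta20 : 0 < eta / 2 by rewrite divr_gt0.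
have [Y [m [[mY Ym] ml [N1 H1]]]] := XY _ _ e40 eta20.
have [N2 H2] := Ym _ _ e20 eta20.
exists (maxn N1 N2) => n; rewrite geq_max => /andP[/H1 PX /H2 PY].
rewrite [eta]splitr; apply: (prob_le_U2 _ _ _ _ PX PY).
- exact/measurable_gt_fun/measurable_dist.
- exact/measurable_gt_fun/measurable_dist.
- exact/measurable_gt_fun/measurable_dist.
move=> w /= h; case: (ltP (e / 4) `|X n w - Y n w|) => [|h1]; first by left.
right; rewrite ltNge; apply/negP => h2; move: h; rewrite ltNge => /negP; apply.
have -> : X n w - l = (X n w - Y n w) + (Y n w - m) + (m - l) by ring.
rewrite (le_trans (ler_normD _ _))// (_ : e = e / 4 + e / 2 + e / 4); last by field.
by rewrite lerD// (le_trans (ler_normD _ _))// lerD.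
Qed.

End convergence_in_probability.

(** * From powers to exponentially bounded functions *)

Section degree_averages_cvg.
Context {R : realType} {d : nat} {disp} {T : measurableType disp}
  {P : probability T R}.
Variables (gamma beta : R) (phi : R -> R).
Variables (gap : nat -> {RV P >-> measurableTypeR R})
  (pos : nat -> {RV P >-> Rd R d}) (adj : T -> rel nat).
Hypothesis d_ge1 : (1 <= d)%N.
Hypothesis gamma01 : 0 < gamma < 1.
Hypothesis beta_gt0 : 0 < beta.
Hypothesis phiP : profile d phi.
Hypothesis G : age_based_network gamma beta phi gap pos adj.
Local Notation bm := bounded_measurable.
Local Notation deg := (degree adj).
Local Notation good := (good_event gap).
Let lam := beta / (1 - gamma).
Let nu := poisson_prob lam 0.

Let lam_gt0 : 0 < lam.
Proof. by rewrite divr_gt0// subr_gt0; case/andP: gamma01. Qed.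

Definition degree_average (g : nat -> R) n w : R :=
  (\sum_(i < n.+1) g (deg i w)) / n.+1%:R.

Local Notation avg := degree_average.

Lemma measurable_degree_average g n : measurable_fun setT (avg g n).
Proof.
apply: measurable_funM => //; apply: measurable_sum => i.
exact: (measurable_degree_fun G).
Qed.

Lemma degree_averageD g h n w :
  avg (fun k => g k + h k) n w = avg g n w + avg h n w.
Proof. by rewrite /avg big_split mulrDl. Qed.

Lemma degree_averageZ c g n w : avg (fun k => c * g k) n w = c * avg g n w.
Proof. by rewrite /avg -mulr_sumr mulrA. Qed.

Lemma degree_average_le g h n w : (forall k, g k <= h k) -> avg g n w <= avg h n w.
Proof. by move=> gh; rewrite ler_wpM2r// ler_sum. Qed.

Lemma degree_average_norm g n w : `|avg g n w| <= avg (fun k => `|g k|) n w.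
Proof.
rewrite normrM (ger0_norm (x := n.+1%:R^-1))// ler_wpM2r//.
exact: ler_norm_sum.
Qed.

(** Chebyshev's inequality on the good event. [K] is fixed from eta before n grows, since the second
    moment tends to 0 for each fixed [K]. *)
Lemma degree_average_pow_cvg (z : R) : 0 <= z <= 1 ->
  seq_cip P (avg (fun k => z ^+ k)) (\int[nu]_k (z ^+ k)).
Proof.
move=> z01; have /andP[z0 z1] := z01.
rewrite poisson_Rpgf// (_ : lam * (z - 1) = - ((1 - z) * lam)); last by ring.
set F := expR _; split=> [n|e eta e0 eta0]; first exact: measurable_degree_average.
have eta20 : 0 < eta / 2 by rewrite divr_gt0.
have [K K0 PK] := good_event_cvg G eta20.
have e2 : 0 < e ^+ 2 * (eta / 2) by rewrite mulr_gt0// exprn_gt0.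
have /cvgrPdist_le/(_ _ e2)[N _ HN] := second_moment_cvg d_ge1 gamma01 beta_gt0 phiP G K0 z01.
exists N => n Nn; have := HN n Nn; rewrite /= sub0r normrN => /(le_trans (ler_norm _)) H.
have mA : measurable (good K) by exact: (@measurable_good_event R d disp T P gap pos K).
have bf : bm (fun w => (avg (fun k => z ^+ k) n w - F) ^+ 2).
  have b1 : bm (fun w => avg (fun k => z ^+ k) n w - F).
    apply: bmB; last exact: bm_cst.
    apply: bm01 => [|w]; first exact: measurable_degree_average.
    apply/andP; split; first by rewrite divr_ge0// sumr_ge0// => i _; rewrite exprn_ge0.
    rewrite ler_pdivrMr// mul1r -[leRHS]mulr1 mulr_natl -[X in _ *+ X](card_ord n.+1) -sumr_const.
    by apply: ler_sum => i _; rewrite exprn_ile1.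
  exact: bmM.
have -> : [set w | e < `|avg (fun k => z ^+ k) n w - F|] =
          [set w | e ^+ 2 < (avg (fun k => z ^+ k) n w - F) ^+ 2].
  apply/funext => w; apply/propext => /=; rewrite -[(_ - F) ^+ 2]real_normK ?num_real//.
  by rewrite ltr_pXn2r// ?nnegrE// ltW.
have e20 : 0 < e ^+ 2 by rewrite exprn_gt0.
apply: (le_trans (bm_markov_on P mA bf e20 _)) => [w|]; first exact: sqr_ge0.
rewrite [eta in leRHS]splitr EFinD; apply: leeD => //.
by rewrite lee_fin ler_pdivrMl.
Qed.

Definition exp_bounded (g : nat -> R) :=
  exists C Z : R, [/\ 0 <= C, 1 <= Z & forall k, `|g k| <= C * Z ^+ k].

Lemma exp_bounded_integrable g : exp_bounded g -> nu.-integrable setT (EFin \o g).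
Proof.
move=> [C [Z [C0 Z1 gC]]]; apply: (poisson_integrable 0 lam_gt0 _ gC).
by rewrite (le_trans _ Z1).
Qed.

Lemma exp_boundedD g h : exp_bounded g -> exp_bounded h ->
  exp_bounded (fun k => g k + h k).
Proof.
move=> [C [Z [C0 Z1 gC]]] [D [Y [D0 Y1 hD]]].
have Z0 : 0 <= Z by rewrite (le_trans _ Z1).
have Y0 : 0 <= Y by rewrite (le_trans _ Y1).
exists (C + D), (Z * Y); split; [exact: addr_ge0|by rewrite -[1]mulr1 ler_pM|].
move=> k; rewrite (le_trans (ler_normD _ _))// mulrDl; apply: lerD.
  rewrite (le_trans (gC k))// ler_wpM2l// exprMn ler_peMr ?exprn_ge0//.
  exact: exprn_ege1.
rewrite (le_trans (hD k))// ler_wpM2l// exprMn ler_peMl ?exprn_ge0//.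
exact: exprn_ege1.
Qed.

Lemma exp_boundedZ c g : exp_bounded g -> exp_bounded (fun k => c * g k).
Proof.
move=> [C [Z [C0 Z1 gC]]]; exists (`|c| * C), Z; split => //; first exact: mulr_ge0.
by move=> k; rewrite normrM -mulrA ler_wpM2l.
Qed.

(** The growth bound travels with the convergence, as it supplies the integrability under [nu]
    needed to add and scale limits. *)
Definition averages_cvg g :=
  exp_bounded g /\ seq_cip P (avg g) (\int[nu]_k g k).

Lemma averages_cvg_ext g h : g =1 h -> averages_cvg g -> averages_cvg h.
Proof. by move=> /funext ->. Qed.

Lemma averages_cvgD g h : averages_cvg g -> averages_cvg h ->
  averages_cvg (fun k => g k + h k).
Proof.
move=> [bg cg] [bh ch]; split; first exact: exp_boundedD.
rewrite RintegralD//; [|exact: exp_bounded_integrable..].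
by apply: seq_cip_ext (seq_cipD cg ch) => n w; rewrite degree_averageD.
Qed.

Lemma averages_cvgZ c g : averages_cvg g -> averages_cvg (fun k => c * g k).
Proof.
move=> [bg cg]; split; first exact: exp_boundedZ.
rewrite RintegralZl//; last exact: exp_bounded_integrable.
by apply: seq_cip_ext (seq_cipZ c cg) => n w; rewrite degree_averageZ.
Qed.

Lemma averages_cvg_pow (z : R) : 0 <= z <= 1 -> averages_cvg (fun k => z ^+ k).
Proof.
move=> z01; have /andP[z0 z1] := z01; split; last exact: degree_average_pow_cvg.
exists 1, 1; split => // k; rewrite expr1n mulr1 ger0_norm ?exprn_ge0//.
exact: exprn_ile1.
Qed.

Lemma averages_cvg_sum (h : nat -> nat -> R) N :
  (forall j, (j < N)%N -> averages_cvg (h j)) ->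
  averages_cvg (fun k => \sum_(j < N) h j k).
Proof.
elim: N => [_|N IH hN].
  apply: (@averages_cvg_ext (fun k => 0 * 1 ^+ k)) => [k|].
    by rewrite mul0r big_ord0.
  by apply: averages_cvgZ; apply: averages_cvg_pow; rewrite ler01 lexx.
apply: (@averages_cvg_ext (fun k => \sum_(j < N) h j k + h N k)) => [k|].
  by rewrite big_ord_recr.
by apply: averages_cvgD; [apply: IH => j jN; apply: hN; exact: ltnW|exact: hN].
Qed.

(* On a good event the expectation of the average of Z ^ degree is bounded, so
   the tails of the degrees are negligible uniformly in n. *)
Lemma averages_cvg_approx g (Z : R) : 1 <= Z -> exp_bounded g ->
  (forall e, 0 < e -> exists2 h, averages_cvg h &
    forall k, `|g k - h k| <= e * Z ^+ k) ->
  averages_cvg g.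
Proof.
move=> Z1 bg gh; split => //.
apply: seq_cip_approx => [n|e eta e0 eta0]; first exact: measurable_degree_average.
have Z0 : 0 <= Z by rewrite (le_trans _ Z1).
have eta20 : 0 < eta / 2 by rewrite divr_gt0.
have [K K0 PK] := good_event_cvg G eta20.
pose B := expR (lam * (Z - 1)); pose M := expR ((Z - 1) * (lam * K)).
have B0 : 0 < B by exact: expR_gt0. have M0 : 0 < M by exact: expR_gt0.
(* The first entry makes the integrals of [g] and [h] under [nu] differ by at most e; the second
   makes Markov's bound on the good event at most eta/2. *)
pose e' := Num.min (e / B) (e * (eta / 2) / M).
have e'0 : 0 < e' by rewrite lt_min !divr_gt0// mulr_gt0.
have [h [bh ch] ghe] := gh _ e'0.
exists (avg h), (\int[nu]_k h k); split=> //.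
  have ig := exp_bounded_integrable bg; have ih := exp_bounded_integrable bh.
  have iZ : nu.-integrable setT (EFin \o (fun k => e' * Z ^+ k)).
    apply: (@poisson_integrable _ lam 0 lam_gt0 _ e' Z Z0) => k.
    by rewrite ger0_norm// mulr_ge0 ?exprn_ge0// ltW.
  have iZ1 : nu.-integrable setT (EFin \o (fun k => Z ^+ k)).
    apply: (@poisson_integrable _ lam 0 lam_gt0 _ 1 Z Z0) => k.
    by rewrite mul1r ger0_norm// exprn_ge0.
  have igh : nu.-integrable setT (EFin \o (fun k => g k - h k)).
    exact: (poisson_integrable 0 lam_gt0 Z0 ghe).
  rewrite distrC -RintegralB//.
  apply: (@le_trans _ _ (\int[nu]_k `|g k - h k|)).
    by apply: le_normr_Rintegral.
  apply: (@le_trans _ _ (\int[nu]_k (e' * Z ^+ k))).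
    apply: le_Rintegral => //; exact: (integrable_abse igh).
  rewrite RintegralZl// poisson_Rpgf// -/B -ler_pdivlMr//.
  by rewrite /e' ge_min lexx.
exists 0%N => n _.
pose X w : R := e' * avg (fun k => Z ^+ k) n w.
have bX : bm X.
  apply: bmM; first exact: bm_cst.
  apply: bmM; last exact: bm_cst.
  by apply: bm_sum => i _; exact: (bm_degree_exp G).
have X0 w : 0 <= X w.
  by rewrite mulr_ge0 ?(ltW e'0)// divr_ge0// sumr_ge0// => i _; rewrite exprn_ge0.
have mA : measurable (good K) by exact: (@measurable_good_event R d disp T P gap pos K).
apply: (@le_trans _ _ (P [set w | (e < X w)%R])).
  apply: le_measure; rewrite ?inE.
  - by apply/measurable_gt_fun/measurable_dist; exact: measurable_degree_average.
  - exact: measurable_gt_fun bX.1.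
  move=> w /= /lt_le_trans; apply; rewrite /X -degree_averageZ.
  apply: le_trans (degree_average_le _ _ ghe).
  apply: le_trans (degree_average_norm _ _ _).
  rewrite le_eqVlt; apply/orP; left; apply/eqP; congr (`|_|).
  by rewrite -[- avg h n w]mulN1r -degree_averageZ -degree_averageD;
    congr (avg _ n w); apply/funext => k; rewrite mulN1r.
apply: (le_trans (bm_markov_on P mA bX e0 X0)).
rewrite [eta in leRHS]splitr EFinD; apply: leeD => //.
rewrite lee_fin ler_pdivrMl//.
have bIZ i : bm (fun w => \1_(good K) w * Z ^+ deg i w).
  by apply: bmM; [exact: bm_indic|exact: (bm_degree_exp G)].
have -> : \int[P]_w (\1_(good K) w * X w) =
    e' / n.+1%:R * \sum_(i < n.+1) \int[P]_w (\1_(good K) w * Z ^+ deg i w).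
  rewrite -(bm_EF_sum P)// -bm_EFZ; last by apply: bm_sum => i _.
  apply: eq_Rintegral => w _; rewrite -mulr_sumr /X /degree_average.
  by move: (\sum_(i < _) _) => s; ring.
apply: (@le_trans _ _ (e' / n.+1%:R * \sum_(i < n.+1) M)).
  apply: ler_wpM2l; first by rewrite divr_ge0// ltW.
  apply: ler_sum => i _.
  exact: (good_degree_exp d_ge1 gamma01 beta_gt0 phiP G K0).
rewrite sumr_const card_ord -[M *+ _]mulr_natl mulrA divfK// -ler_pdivlMr//.
by rewrite /e' ge_min lexx orbT.
Qed.

(* As q tends to 0, q ^ (k - k0) converges to the indicator of k0 on k >= k0;
   the terms k < k0 are subtracted by induction. *)
Lemma averages_cvg_delta k0 : averages_cvg (fun k => (k == k0)%:R).
Proof.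
elim/ltn_ind: k0 => k0 IH.
apply: (@averages_cvg_approx _ 1) => //.
  by exists 1, 1; split => // k; rewrite expr1n mulr1 normr_nat; case: eqP.
(* q <= e bounds the error q^(k - k0) for k > k0, and q <= 1/2 keeps q among the admissible
   bases. *)
move=> e e0; pose q : R := Num.min (2^-1) e.
have q0 : 0 < q by rewrite lt_min e0 invr_gt0 ltr0n.
have q1 : q <= 1 by rewrite /q ge_min invf_le1// ler1n.
exists (fun k => q ^- k0 * (q ^+ k + (-1) * \sum_(j < k0) q ^+ j * (k == j)%:R)).
  apply/averages_cvgZ/averages_cvgD.
    by apply: averages_cvg_pow; rewrite q1 ltW.
  apply/averages_cvgZ; apply: (@averages_cvg_sum (fun j k => q ^+ j * (k == j)%:R)).
  by move=> j jk0; apply/averages_cvgZ/IH.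
move=> k; rewrite expr1n mulr1 mulN1r.
have qn0 : q ^+ k0 != 0 by rewrite expf_neq0// gt_eqF.
case: (ltngtP k k0) => [kk0|k0k|->].
- rewrite (bigD1 (Ordinal kk0))//= eqxx mulr1 big1 ?addr0 ?subrr ?mulr0 ?subrr ?normr0 ?(ltW e0)//.
  by move=> j; rewrite -val_eqE/= eq_sym => /negPf ->; rewrite mulr0.
- rewrite big1 ?subr0; last first.
    by move=> j _; rewrite gtn_eqF ?mulr0// (ltn_trans (ltn_ord j)).
  rewrite sub0r normrN -(subnKC (ltnW k0k)) exprD mulKf// ger0_norm ?exprn_ge0 ?(ltW q0)//.
  rewrite -(prednK (n := k - k0)) ?subn_gt0// exprS.
  apply: (@le_trans _ _ q); last by rewrite /q ge_min lexx orbT.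
  by rewrite ler_piMr ?(ltW q0)// exprn_ile1// ltW.
- rewrite big1 ?subr0; last by move=> j _; rewrite gtn_eqF ?mulr0.
  by rewrite mulVf// subrr normr0 ltW.
Qed.

(** [g] is cut off at N. The doubled base leaves room for this: beyond N, C Z^k <= e (2 Z)^k because
    C / 2^k <= e. *)
Lemma averages_cvg_exp_bounded g : exp_bounded g -> averages_cvg g.
Proof.
move=> bg; have [C [Z [C0 Z1 gC]]] := bg.
have Z0 : 0 <= Z by rewrite (le_trans _ Z1).
apply: (@averages_cvg_approx _ (2 * Z)) => // [|e e0].
  by lra.
have /cvgrPdist_le/(_ _ e0)[N _ HN] : C / 2 ^+ n @[n --> \oo] --> (0 : R).
  under eq_fun do rewrite -exprVn.
  by apply: cvg_geometric; rewrite ger0_norm// invf_lt1// ltr1n.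
exists (fun k : nat => \sum_(j < N) g j * (k == j)%:R).
  apply: (@averages_cvg_sum (fun j k => g j * (k == j)%:R)) => j _.
  exact/averages_cvgZ/averages_cvg_delta.
move=> k; have [kN|Nk] := ltnP k N.
  rewrite (bigD1 (Ordinal kN))//= eqxx mulr1 big1 ?addr0 ?subrr ?normr0.
    by rewrite mulr_ge0 ?exprn_ge0 ?mulr_ge0// ltW.
  by move=> j; rewrite -val_eqE/= eq_sym => /negPf ->; rewrite mulr0.
rewrite big1 ?subr0; last first.
  by move=> j _; rewrite gtn_eqF ?mulr0// (leq_trans (ltn_ord j)).
have := HN k Nk; rewrite /= sub0r normrN => /(le_trans (ler_norm _)).
rewrite ler_pdivrMr ?exprn_gt0// => CN.
apply: (le_trans (gC k)); rewrite exprMn mulrA; apply: ler_wpM2r => //.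
exact: exprn_ge0.
Qed.

End degree_averages_cvg.

(** * From the number of vertices to time *)

Section vertex_average.
Context {R : realType} {d : nat} {disp} {T : measurableType disp}
  {P : probability T R}.
Variables (gamma beta : R) (phi : R -> R).
Variables (gap : nat -> {RV P >-> measurableTypeR R})
  (pos : nat -> {RV P >-> Rd R d}) (adj : T -> rel nat).
Hypothesis G : age_based_network gamma beta phi gap pos adj.
Local Notation deg := (degree adj).
Local Notation avg := (degree_average adj).

Let birth_le w m n : (birth gap m w <= birth gap n w) = (m <= n)%N.
Proof. exact: (le_mono (birth_lt G w)). Qed.

(** Birth times increase strictly with the number, so the older neighbours are the adjacent m < n,
    the case m = n being excluded by irreflexivity; all of them are present once n is. *)
Lemma outdegreeE t n w : vertices gap t w n -> outdegree gap adj t n w = deg n w.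
Proof.
rewrite /vertices /= => nt; rewrite /outdegree.
have -> : older_neighbours gap adj t n w =
    [set` [fset m in [seq m <- iota 0 n | adj w m n]]%fset].
  apply/seteqP; split => m /=; rewrite inE mem_filter mem_iota add0n /=.
    move=> [_ [nm]]; rewrite birth_le leq_eqVlt => /predU1P[mn|->].
      by move: nm; rewrite mn (network_adj_irr G).
    by rewrite (network_adj_sym G) nm.
  move=> /andP[mn lt_mn]; rewrite /older_neighbours /= birth_le (ltnW lt_mn).
  rewrite (network_adj_sym G) mn; split => //.
  by apply: le_trans nt; rewrite birth_le ltnW.
rewrite set_fsetK card_fseq undup_id; last by rewrite filter_uniq// iota_uniq.
by rewrite size_filter -sumn_count sumnE big_map -[X in iota _ X]subn0 -/(index_iota 0 n) big_mkord.
Qed.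

Variable g : nat -> R.
Hypothesis g_ge0 : forall k, 0 <= g k.

Let h t n w : \bar R := if birth gap n w <= t then (g (deg n w))%:E else 0%E.

Let h_ge0 t n w : (0 <= h t n w)%E.
Proof. by rewrite /h; case: ifP; rewrite ?lee_fin. Qed.

Lemma vertex_averageE t w : vertex_average gap adj g t w =
  ((t^-1)%:E * \sum_(n <oo) h t n w)%E.
Proof.
rewrite /vertex_average nneseries_esumT// esum_mkcond; congr (_ * esum setT _)%E.
apply/funext => n; rewrite /h; case: (boolP (n \in _)) => [|/negP nV].
  by move=> /set_mem nV; rewrite outdegreeE// ifT.
by rewrite ifF//; apply/negP => nt; apply: nV; rewrite inE.
Qed.

Lemma measurable_vertex_average t : measurable_fun setT (vertex_average gap adj g t).
Proof.
rewrite (_ : vertex_average _ _ _ _ = fun w => ((t^-1)%:E * \sum_(n <oo) h t n w)%E); last first.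
  by apply/funext => w; exact: vertex_averageE.
apply: measurable_funeM; apply: ge0_emeasurable_sum => // n _.
apply: measurable_fun_ifT => //.
  by apply: measurable_fun_ler => //; exact: (@measurable_birth _ _ _ _ _ gap pos).
by apply/measurable_EFinP; exact: (measurable_degree_fun G).
Qed.

Lemma vertex_average_integral t w : 0 < t ->
  vertex_average gap adj g t w = (\int[empirical_outdegree gap adj t w]_k (g k)%:E)%E.
Proof.
move=> t0; rewrite /empirical_outdegree ge0_integral_mscale//; last first.
  by move=> k _; rewrite lee_fin.
rewrite ge0_integral_measure_series//; last by move=> k _; rewrite lee_fin.
rewrite vertex_averageE; congr (_ * _)%E.
  by rewrite /= ger0_norm// invr_ge0 ltW.
apply: eq_eseriesr => n _; rewrite /h; case: ifPn => nt.
  by rewrite integral_dirac// diracT mul1e outdegreeE.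
by rewrite integral_measure_zero.
Qed.

Let sum_avg n w : (\sum_(i < n.+1) (g (deg i w))%:E = (n.+1%:R * avg g n w)%:E)%E.
Proof. by rewrite sumEFin /degree_average mulrC divfK. Qed.

(** Only vertices up to n can be present, and as [g] is nonnegative, counting those not yet born
    merely increases the sum. *)
Lemma vertex_average_le t n w : 0 < t -> t < birth gap n.+1 w ->
  (vertex_average gap adj g t w <= (n.+1%:R / t * avg g n w)%:E)%E.
Proof.
move=> t0 tn; rewrite vertex_averageE.
rewrite (_ : n.+1%:R / t * avg g n w = t^-1 * (n.+1%:R * avg g n w)); last by ring.
rewrite EFinM lee_pmul2l ?lte_fin ?invr_gt0// -sum_avg (nneseries_split 0 n.+1)//.
rewrite [X in (_ + X)%E]eseries0 ?adde0; last first.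
  move=> k nk _; rewrite /h ifF//; apply/negbTE; rewrite -ltNge.
  by apply: (lt_le_trans tn); rewrite birth_le.
by rewrite add0n big_mkord; apply: lee_sum => i _; rewrite /h; case: ifP; rewrite ?lee_fin.
Qed.

Lemma vertex_average_ge t n w : 0 < t -> birth gap n w <= t ->
  ((n.+1%:R / t * avg g n w)%:E <= vertex_average gap adj g t w)%E.
Proof.
move=> t0 nt; rewrite vertex_averageE.
rewrite (_ : n.+1%:R / t * avg g n w = t^-1 * (n.+1%:R * avg g n w)); last by ring.
rewrite EFinM lee_pmul2l ?lte_fin ?invr_gt0// -sum_avg.
apply: le_trans (nneseries_lim_ge n.+1 _) => //.
rewrite big_mkord; apply: lee_sum => i _; rewrite /h ifT//.
by apply: le_trans nt; rewrite birth_le -ltnS.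
Qed.

Lemma birth_lln : seq_cip P (fun n w => birth gap n w / n.+1%:R) 1.
Proof.
split=> [n|e eta e0 eta0].
  by apply: measurable_funM => //; exact: (@measurable_birth _ _ _ _ _ gap pos).
(* The deviation bound covers tolerances up to 1. *)
have e01 : 0 < Num.min e (1 : R) <= 1 by rewrite lt_min e0 ltr01/= ge_min lexx orbT.
have [q /andP[q0 q1] Pq] := birth_deviation G e01.
have : 2 * q ^+ n.+1 @[n --> \oo] --> (0 : R).
  under eq_fun do rewrite exprS mulrA.
  by apply: cvg_geometric; rewrite ger0_norm.
move=> /cvgrPdist_le/(_ _ eta0)[N _ HN]; exists N => n Nn.
apply: (@le_trans _ _ (2 * q ^+ n.+1)%:E).
  apply: le_trans (Pq n); apply: le_measure; rewrite ?inE.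
  - apply/measurable_gt_fun/measurable_dist => //.
    by apply: measurable_funM => //; exact: (@measurable_birth _ _ _ _ _ gap pos).
  - exact: (@measurable_birth_deviation _ _ _ _ _ gap pos).
  - by move=> w /=; apply: le_lt_trans; rewrite ge_min lexx.
by rewrite lee_fin; have := HN n Nn; rewrite /= sub0r normrN; exact/le_trans/ler_norm.
Qed.

Variable L : R.
Hypothesis L_ge0 : 0 <= L.
Hypothesis avg_cvg : seq_cip P (avg g) L.

(** Turns a relative error in the number of vertices into an absolute error of the average. The 2 in
    [1 + 2 * dl] leaves room for rounding the vertex count to an integer. *)
Let sandwich (e : R) : 0 < e -> exists dl : R, [/\ 0 < dl, dl <= 2^-1,
  forall a, `|a - L| <= e / 4 -> L - e <= (1 - dl) * a &
  forall a, `|a - L| <= e / 4 -> (1 + 2 * dl) * a <= L + e].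
Proof.
move=> e0; pose dl := Num.min 2^-1 (e / 8 / (L + e)).
have Le : 0 < L + e by rewrite ltr_wpDl.
have dl0 : 0 < dl by rewrite lt_min !divr_gt0// invr_gt0 ltr0n.
have dl1 : dl <= 2^-1 by rewrite /dl ge_min lexx.
have dle : dl * (L + e) <= e / 8 by rewrite -ler_pdivlMr// /dl ge_min lexx orbT.
exists dl; split => // a; rewrite ler_norml => /andP[? ?].
  have : dl * a <= dl * (L + e) by rewrite ler_pM2l//; lra.
  by lra.
have : dl * a <= dl * (L + e) by rewrite ler_pM2l//; lra.
by lra.
Qed.

Let absE (f : T -> \bar R) w (a b e : R) : L - e <= a -> b <= L + e ->
  (a%:E <= f w)%E -> (f w <= b%:E)%E -> (`|f w - L%:E| <= e%:E)%E.
Proof.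
case: (f w) => [r| |] // La Lb; rewrite !lee_fin => ar rb.
by rewrite ler_norml; lra.
Qed.

Lemma vertex_average_cvg : cvg_in_probability P (vertex_average gap adj g) L%:E.
Proof.
split=> [|e e0]; first exact: measurable_vertex_average.
have mB t : measurable [set w | (e%:E < `|vertex_average gap adj g t w - L%:E|)%E].
  have mv : measurable_fun setT (fun w => `|vertex_average gap adj g t w - L%:E|%E).
    apply: measurableT_comp => //; apply: emeasurable_funB => //.
    exact: measurable_vertex_average.
  have := mv measurableT _ (emeasurable_itv `]e%:E, +oo[).
  rewrite setTI; congr measurable; apply/seteqP; split => w /=;
    by rewrite in_itv/= ?andbT.
apply/fine_cvgP; split; first by apply: nearW => t; exact: fin_num_measure.
apply/cvgrPdist_le => eta eta0.
have [dl [dl0 dl2 low up]] := sandwich e0.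
have dl40 : 0 < dl / 4 by rewrite divr_gt0.
have e40 : 0 < e / 4 by rewrite divr_gt0.
have eta40 : 0 < eta / 2 / 2 by rewrite !divr_gt0.
have [N1 HN1] := birth_lln.2 _ _ dl40 eta40.
have [N2 HN2] := avg_cvg.2 _ _ e40 eta40.
pose N := maxn N1 N2.
near=> t.
have t0 : 0 < t by near: t; exact: nbhs_pinfty_gt.
(* This makes [dl * t] at least 2, which absorbs the rounding; the next threshold puts both vertex
   counts beyond N, as 1 - dl >= 1/2. *)
have tdl : 2 / dl <= t by near: t; apply: nbhs_pinfty_ge; exact: num_real.
have tN : N.+1%:R * 2 <= t by near: t; apply: nbhs_pinfty_ge; exact: num_real.
have dlt : 2 <= dl * t by rewrite mulrC -ler_pdivrMr.
rewrite /= sub0r normrN ger0_norm ?fine_ge0// -lee_fin fineK ?fin_num_measure//.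
(* With high probability vertex m0 is born by time t and vertex m1 + 1 is not. *)
pose m0 := Num.truncn ((1 - dl) * t); pose m1 := Num.truncn ((1 + dl) * t).
have x0 : 0 <= (1 - dl) * t by rewrite mulr_ge0 ?(ltW t0)//; lra.
have x1 : 0 <= (1 + dl) * t by rewrite mulr_ge0 ?(ltW t0)//; lra.
have := truncn_itv x0; rewrite -/m0 => /andP[m0l m0u].
have := truncn_itv x1; rewrite -/m1 => /andP[m1l m1u].
have Nm0 : (N <= m0)%N by rewrite truncn_ge_nat//; nra.
have Nm1 : (N <= m1)%N by rewrite truncn_ge_nat//; nra.
pose B1 := [set w | dl / 4 < `|birth gap m0 w / m0.+1%:R - 1|].
pose B2 := [set w | dl / 4 < `|birth gap m1.+1 w / m1.+2%:R - 1|].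
pose B3 := [set w | e / 4 < `|avg g m0 w - L|].
pose B4 := [set w | e / 4 < `|avg g m1 w - L|].
have mB1 : measurable B1 by exact: (@measurable_birth_deviation _ _ _ _ _ gap pos).
have mB2 : measurable B2 by exact: (@measurable_birth_deviation _ _ _ _ _ gap pos).
have mB3 : measurable B3.
  by apply/measurable_gt_fun/measurable_dist => //; exact: avg_cvg.1.
have mB4 : measurable B4.
  by apply/measurable_gt_fun/measurable_dist => //; exact: avg_cvg.1.
have PB1 : (P B1 <= (eta / 2 / 2)%:E)%E.
  by apply: HN1; apply: leq_trans Nm0; exact: leq_maxl.
have PB2 : (P B2 <= (eta / 2 / 2)%:E)%E.
  by apply: HN1; apply: leqW; apply: leq_trans Nm1; exact: leq_maxl.
have PB3 : (P B3 <= (eta / 2 / 2)%:E)%E.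
  by apply: HN2; apply: leq_trans Nm0; exact: leq_maxr.
have PB4 : (P B4 <= (eta / 2 / 2)%:E)%E.
  by apply: HN2; apply: leq_trans Nm1; exact: leq_maxr.
have PB12 := prob_le_U2 (measurableU _ _ mB1 mB2) mB1 mB2 (@subset_refl _ _) PB1 PB2.
have PB34 := prob_le_U2 (measurableU _ _ mB3 mB4) mB3 mB4 (@subset_refl _ _) PB3 PB4.
rewrite -!splitr in PB12 PB34.
rewrite [eta]splitr.
apply: (prob_le_U2 (mB t) (measurableU _ _ mB1 mB2) (measurableU _ _ mB3 mB4) _ PB12 PB34).
move=> w /= eV; apply: contrapT => nB.
have {nB}[h1 h2 h3 h4] : [/\ `|birth gap m0 w / m0.+1%:R - 1| <= dl / 4,
    `|birth gap m1.+1 w / m1.+2%:R - 1| <= dl / 4,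
    `|avg g m0 w - L| <= e / 4 & `|avg g m1 w - L| <= e / 4].
  by split; rewrite leNgt; apply/negP => hB; apply: nB;
    [left; left|left; right|right; left|right; right].
have bm0 : birth gap m0 w <= t.
  move: h1; rewrite ler_norml => /andP[_].
  rewrite lerBlDr ler_pdivrMr// => h1; apply: (le_trans h1).
  (* The rounding costs half of dl, and (1 + dl/4)(1 - dl/2) <= 1. *)
  have m0t : m0.+1%:R <= (1 - dl / 2) * t by rewrite -natr1; lra.
  apply: (@le_trans _ _ ((dl / 4 + 1) * ((1 - dl / 2) * t))).
    by apply: ler_wpM2l m0t; lra.
  by rewrite mulrA -[leRHS]mul1r ler_pM2r//; nra.
have bm1 : t < birth gap m1.+1 w.
  move: h2; rewrite ler_norml => /andP[h2 _]; move: h2.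
  rewrite lerBrDr ler_pdivlMr// => h2; apply: (lt_le_trans _ h2).
  have m1t : (1 + dl) * t <= m1.+2%:R.
    by apply: (le_trans (ltW m1u)); rewrite ler_nat.
  (* (1 - dl/4)(1 + dl) > 1 because 0 < dl <= 1/2. *)
  apply: (@lt_le_trans _ _ ((- (dl / 4) + 1) * ((1 + dl) * t))).
    by rewrite mulrA -[ltLHS]mul1r ltr_pM2r//; nra.
  by apply: ler_wpM2l m1t; lra.
move: eV; apply/negP; rewrite -leNgt.
have a0 n : 0 <= avg g n w by rewrite divr_ge0// sumr_ge0.
apply: (absE (f := vertex_average gap adj g t) _ _
  (vertex_average_ge t0 bm0) (vertex_average_le t0 bm1)).
  apply: le_trans (low _ h3) _; apply: ler_wpM2r => //.
  by rewrite ler_pdivlMr// ltW.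
apply: le_trans _ (up _ h4); apply: ler_wpM2r => //.
by rewrite ler_pdivrMr// -natr1; nra.
Unshelve. all: by end_near. Qed.

End vertex_average.

Theorem theorem4p2 (R : realType) (d : nat) (d_ge1 : (1 <= d)%N)
    (gamma beta : R) (gamma01 : 0 < gamma < 1) (beta_gt0 : 0 < beta)
    (phi : R -> R) (phi_profile : profile d phi)
    (disp : measure_display) (T : measurableType disp) (P : probability T R)
    (gap : nat -> {RV P >-> measurableTypeR R})
    (pos : nat -> {RV P >-> Rd R d}) (adj : T -> rel nat)
    (G : age_based_network gamma beta phi gap pos adj)
    (g : nat -> R) (g_ge0 : forall k, 0 <= g k)
    (g_exp : exists C a : R, forall k, g k <= C * expR (a * k%:R)) :
  (forall t w, 0 < t ->
    vertex_average gap adj g t w =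
    (\int[empirical_outdegree gap adj t w]_k (g k)%:E)%E) /\
  cvg_in_probability P (vertex_average gap adj g)
    (\int[poisson_prob (beta / (1 - gamma)) 0]_k (g k)%:E)%E.
Proof.
split=> [t w t0|]; first exact: (vertex_average_integral G).
have bg : exp_bounded g.
  (* The rate may be negative; its absolute value gives a base of at least 1. *)
  have [C [a gC]] := g_exp; exists `|C|, (expR `|a|).
  split=> [//||k]; first by rewrite -expR0 ler_expR.
  rewrite ger0_norm// (le_trans (gC k))// -expRM_natr.
  apply: (@le_trans _ _ (`|C| * expR (a * k%:R))).
    by apply: ler_wpM2r; [exact: expR_ge0|exact: ler_norm].
  by apply: ler_wpM2l => //; rewrite ler_expR ler_wpM2r// ler_norm.
have lam_gt0 : 0 < beta / (1 - gamma).
  by rewrite divr_gt0// subr_gt0; case/andP: gamma01.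
have [_ g_cvg] := averages_cvg_exp_bounded d_ge1 gamma01 beta_gt0 phi_profile G bg.
have ig := exp_bounded_integrable gamma01 beta_gt0 bg.
have -> : (\int[poisson_prob (beta / (1 - gamma)) 0]_k (g k)%:E)%E =
    (\int[poisson_prob (beta / (1 - gamma)) 0]_k g k)%:E.
  by rewrite /Rintegral fineK//; exact: integrable_fin_num.
apply: (vertex_average_cvg G g_ge0 _ g_cvg).
by apply: Rintegral_ge0 => k _.
Qed.
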